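(* Let $\mathfrak{H}$ be a fat Hoffman graph in which every slim vertex has exactly one fat neighbour. Then $\mathfrak{H}$ has smallest eigenvalue greater than $-3$ if and only if its special graph $\mathcal{S}(\mathfrak{H})$ is switching equivalent to one of the following edge-signed graphs: (i) the line graph $\mathfrak{L}(H)$ (all edges being $(+)$-edges), where $H$ is a simple tree or a unicyclic graph with an odd cycle; (ii) $\mathfrak{L}^\dagger(H,uu')$, where $H$ is a unicyclic graph with an even cycle $C$ and $uu'$ is an edge of $\mathfrak{L}(C)$; (iii) the edge-signed graph obtained from the line graph $\mathfrak{L}(H')$ of a simple tree $H'$ (all edges being $(+)$-edges), with a fixed vertex $u$ of $\mathfrak{L}(H')$, by attaching a new vertex $u'$ and joining $u'$ by $(+)$-edges to every vertex of one of the two cliques forming the neighbourhood of $u$, and by $(-)$-edges to every vertex of the other clique (with $u'$ not adjacent to any other vertex); (iv) an exceptional edge-signed graph with smallest eigenvalue greater than $-2$ (up to switching equivalence these are $32$ edge-signed graphs on $6$ vertices, $233$ on $7$ vertices and $1242$ on $8$ vertices).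
   Context: All graphs are finite. A Hoffman graph $\mathfrak{H}$ is a graph with a distinguished coclique $V_f(\mathfrak{H})$ of vertices, called fat vertices; the remaining vertices are called slim. It is called fat if every slim vertex has at least one fat neighbour. Writing its adjacency matrix, with the fat vertices last, as $\begin{pmatrix}A_s & C\\ C^\top & 0\end{pmatrix}$, put $B(\mathfrak{H})=A_s-CC^\top$. The eigenvalues of $\mathfrak{H}$ are those of $B(\mathfrak{H})$. The special graph $\mathcal{S}(\mathfrak{H})$ is the edge-signed graph on the slim vertices whose adjacency matrix has the same off-diagonal entries as $B(\mathfrak{H})$ and zeros on the diagonal (this is used when those entries lie in $\{0,\pm1\}$, as is the case when each slim vertex has exactly one fat neighbour). An edge-signed graph $G$ is a triple $(V,E^+,E^-)$ of a vertex set $V$ and two disjoint sets $E^+,E^-$ of $2$-subsets of $V$ (the $(+)$-edges and $(-)$-edges). Its underlying graph is $(V,E^+\cup E^-)$; $G$ is connected if its underlying graph is. Its adjacency matrix has entry $1$, $-1$, $0$ at $(u,v)$ according as $\{u,v\}\in E^+$, $\{u,v\}\in E^-$, or neither; the eigenvalues of $G$ are those of this matrix. Switching at a vertex $v$ means swapping the sign of each edge incident to $v$. Two edge-signed graphs $G,G'$ are switching equivalent if $G'$ is isomorphic (by a sign-preserving isomorphism) to a graph obtained from $G$ by switching at each vertex of some subset of $V(G)$. An integral representation of $G$ is a map $\phi:V(G)\to\mathbb{Z}^n$, for some $n$, with $(\phi(u),\phi(u))=2$ for all $u$, and for $u\ne v$: $(\phi(u),\phi(v))=\pm1$ if $\{u,v\}\in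 E^\pm$ respectively, and $0$ otherwise. A connected edge-signed graph with smallest eigenvalue at least $-2$ is called exceptional if it has no integral representation. Trees here have at least one edge. A unicyclic graph is a connected simple graph with exactly one cycle. $\mathfrak{L}(H)$ denotes the line graph of $H$. In the line graph of a tree, the neighbourhood of a vertex $u$ (an edge of the tree with endpoints $v,w$) is the disjoint union of two (possibly empty) cliques: the other edges at $v$ and the other edges at $w$. Let $H$ be unicyclic whose unique cycle $C$ has at least $4$ vertices. Each edge $e$ of $\mathfrak{L}(H)$ lies in a unique maximal clique of $\mathfrak{L}(H)$, denoted $\mathfrak{C}(e)$. For an edge $uu'$ of $\mathfrak{L}(C)$, $\mathfrak{L}^\dagger(H,uu')$ is the edge-signed graph with vertex set $V(\mathfrak{L}(H))$, $E^-=\{uv\in E(\mathfrak{L}(H)) : v\in\mathfrak{C}(uu')\}$ (the edges joining the fixed vertex $u$ to the other vertices of the clique), and $E^+=E(\mathfrak{L}(H))\setminus E^-$.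
   Formalization: The equivalence is stated for connected special graphs, and for arbitrary ones with every connected component switching equivalent to a graph in (i)-(iv); as written it fails when the special graph is disconnected, e.g. three isolated slim vertices with separate fat neighbours. *)

(* Defs.v *)
From HB Require Import structures.
From mathcomp Require Import all_boot all_order all_algebra all_field.

Set Implicit Arguments.
Unset Strict Implicit.
Unset Printing Implicit Defensive.
Import Order.TTheory GRing.Theory Num.Theory.
Local Open Scope ring_scope.

Record graph (V : finType) := Graph {
  adj :> rel V;
  adj_sym : symmetric adj;
  adj_irr : irreflexive adj
}.

(* The graph with no vertices is not connected. *)
Definition gconnected (V : finType) (G : graph V) : Prop :=
  (0 < #|V|)%N /\ forall x y, connect G x y.

(* A cycle, as a subgraph, is identified with its set of edges. *)
Definition is_cycle (V : finType) (G : graph V) (C : {set {set V}}) : Prop :=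
  exists c : seq V,
    [/\ (2 < size c)%N, ucycle G c & C = [set [set x; next c x] | x in c]].

Definition is_tree (V : finType) (G : graph V) : Prop :=
  [/\ gconnected G, forall C, ~ is_cycle G C & exists x y, G x y].

(* [unicyclic G C]: G is unicyclic, and C is its unique cycle. *)
Definition unicyclic (V : finType) (G : graph V) (C : {set {set V}}) : Prop :=
  gconnected G /\ forall D, is_cycle G D <-> D = C.

Definition edges (V : finType) (G : graph V) : {set {set V}} :=
  [set e | [exists x, exists y, G x y && (e == [set x; y])]].

Definition line_vertex (V : finType) (G : graph V) : finType :=
  {e : {set V} | e \in edges G}.

Definition line_rel (V : finType) (G : graph V) : rel (line_vertex G) :=
  fun e f => (e != f) && (val e :&: val f != set0).

Lemma line_rel_sym (V : finType) (G : graph V) : symmetric (@line_rel V G).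
Proof. by move=> e f; rewrite /line_rel eq_sym setIC. Qed.

Lemma line_rel_irr (V : finType) (G : graph V) : irreflexive (@line_rel V G).
Proof. by move=> e; rewrite /line_rel eqxx. Qed.

Definition line_graph (V : finType) (G : graph V) : graph (line_vertex G) :=
  Graph (@line_rel_sym V G) (@line_rel_irr V G).

Definition is_clique (V : finType) (G : graph V) (K : {set V}) : bool :=
  [forall x in K, forall y in K, (x != y) ==> G x y].

(* The union of the maximal cliques containing u and v; it is the maximal
   clique containing them when there is exactly one. *)
Definition max_clique (V : finType) (G : graph V) (u v : V) : {set V} :=
  \bigcup_(K : {set V} |
      [&& maxset (is_clique G) K, u \in K & v \in K]) K.

Record sgraph (V : finType) := SGraph {
  posg : graph V;
  negg : graph V;
  sg_disj : forall x y, posg x y -> ~~ negg x y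
}.

Lemma under_sym (V : finType) (G : sgraph V) :
  symmetric (fun x y => posg G x y || negg G x y).
Proof. by move=> x y; rewrite adj_sym [negg _ _ _]adj_sym. Qed.

Lemma under_irr (V : finType) (G : sgraph V) :
  irreflexive (fun x y => posg G x y || negg G x y).
Proof. by move=> x; rewrite !adj_irr. Qed.

Definition underlying (V : finType) (G : sgraph V) : graph V :=
  Graph (under_sym G) (under_irr G).

Definition sconnected (V : finType) (G : sgraph V) : Prop :=
  gconnected (underlying G).

Definition sadj (V : finType) (G : sgraph V) (x y : V) : int :=
  if posg G x y then 1 else if negg G x y then -1 else 0.

Definition sadj_mx (V : finType) (G : sgraph V) : 'M[int]_#|V| :=
  \matrix_(i, j) sadj G (enum_val i) (enum_val j).

(* [sign_graph G s]: the (-)-edges are the edges xy of G for which s x y or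
   s y x; the other edges of G are (+)-edges. *)
Section SignGraph.
Variables (V : finType) (G : graph V) (s : rel V).

Lemma sign_pos_sym : symmetric (fun x y => G x y && ~~ (s x y || s y x)).
Proof. by move=> x y; rewrite adj_sym orbC. Qed.

Lemma sign_pos_irr : irreflexive (fun x y => G x y && ~~ (s x y || s y x)).
Proof. by move=> x; rewrite adj_irr. Qed.

Lemma sign_neg_sym : symmetric (fun x y => G x y && (s x y || s y x)).
Proof. by move=> x y; rewrite adj_sym orbC. Qed.

Lemma sign_neg_irr : irreflexive (fun x y => G x y && (s x y || s y x)).
Proof. by move=> x; rewrite adj_irr. Qed.

Lemma sign_disj x y :
  Graph sign_pos_sym sign_pos_irr x y -> ~~ Graph sign_neg_sym sign_neg_irr x y.
Proof. by case/andP => _ /negbTE /= ->; rewrite andbF. Qed.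

Definition sign_graph : sgraph V := SGraph sign_disj.
End SignGraph.

Definition all_pos (V : finType) (G : graph V) : sgraph V :=
  sign_graph G (fun _ _ => false).

Section Induced.
Variables (V : finType) (P : pred V).

Lemma induced_sym (G : graph V) :
  symmetric (fun x y : {x : V | P x} => G (val x) (val y)).
Proof. by move=> x y; rewrite adj_sym. Qed.

Lemma induced_irr (G : graph V) :
  irreflexive (fun x y : {x : V | P x} => G (val x) (val y)).
Proof. by move=> x; rewrite adj_irr. Qed.

Definition induced (G : graph V) : graph {x : V | P x} :=
  Graph (induced_sym G) (induced_irr G).

Lemma induced_disj (G : sgraph V) x y :
  induced (posg G) x y -> ~~ induced (negg G) x y.
Proof. exact: sg_disj. Qed.

Definition sinduced (G : sgraph V) : sgraph {x : V | P x} :=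
  SGraph (@induced_disj G).
End Induced.

Definition scomponent (V : finType) (G : sgraph V) (x : V) :
    sgraph {y : V | connect (underlying G) x y} :=
  sinduced (connect (underlying G) x) G.

Section SwitchAt.
Variables (V : finType) (v : V) (G : sgraph V).

Definition sw_rel (A B : rel V) : rel V :=
  fun x y => if (x == v) || (y == v) then B x y else A x y.

Lemma sw_rel_sym (A B : graph V) : symmetric (sw_rel A B).
Proof.
by move=> x y; rewrite /sw_rel orbC [A x y]adj_sym [B x y]adj_sym.
Qed.

Lemma sw_rel_irr (A B : graph V) : irreflexive (sw_rel A B).
Proof. by move=> x; rewrite /sw_rel !adj_irr if_same. Qed.

Lemma switch_disj x y :
  Graph (sw_rel_sym (posg G) (negg G)) (sw_rel_irr (posg G) (negg G)) x y ->
  ~~ Graph (sw_rel_sym (negg G) (posg G)) (sw_rel_irr (negg G) (posg G)) x y.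
Proof.
rewrite /= /sw_rel; case: ifP => _; last exact: sg_disj.
by apply: contraL => /sg_disj.
Qed.

Definition switch_at : sgraph V := SGraph switch_disj.
End SwitchAt.

Definition switch (V : finType) (U : {set V}) (G : sgraph V) : sgraph V :=
  foldr (@switch_at V) G (enum U).

Definition sg_iso (V W : finType) (G : sgraph V) (G' : sgraph W) : Prop :=
  exists2 f : V -> W, bijective f &
    forall x y, posg G' (f x) (f y) = posg G x y
             /\ negg G' (f x) (f y) = negg G x y.

Definition sw_equiv (V W : finType) (G : sgraph V) (G' : sgraph W) : Prop :=
  exists U : {set V}, sg_iso (switch U G) G'.

(* Over algC all complex eigenvalues of M are taken into account. The order of
   algC is partial, and c < a with c real entails that a is real. A matrix of
   size 0 has no eigenvalues, and satisfies both predicates. *)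
Definition smallest_eig_gt n (M : 'M[int]_n) (c : int) : Prop :=
  forall a : algC, eigenvalue (map_mx intr M) a -> c%:~R < a.

Definition smallest_eig_ge n (M : 'M[int]_n) (c : int) : Prop :=
  forall a : algC, eigenvalue (map_mx intr M) a -> c%:~R <= a.

Definition dot n (x y : 'rV[int]_n) : int := \sum_i x 0 i * y 0 i.

Definition integral_rep (V : finType) (G : sgraph V) n
    (phi : V -> 'rV[int]_n) : Prop :=
  (forall x, dot (phi x) (phi x) = 2) /\
  (forall x y, x != y -> dot (phi x) (phi y) = sadj G x y).

Definition exceptional (V : finType) (G : sgraph V) : Prop :=
  [/\ sconnected G,
      smallest_eig_ge (sadj_mx G) (- 2)
    & ~ exists n (phi : V -> 'rV[int]_n), integral_rep G phi].

Definition exceptional_gt (V : finType) (G : sgraph V) : Prop :=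
  exceptional G /\ smallest_eig_gt (sadj_mx G) (- 2).

(* Up to switching equivalence there are exactly k edge-signed graphs on n
   vertices satisfying [exceptional_gt]. *)
Definition exceptional_gt_count (n k : nat) : Prop :=
  exists r : 'I_k -> sgraph 'I_n,
    [/\ forall i, exceptional_gt (r i),
        forall i j, sw_equiv (r i) (r j) -> i = j
      & forall (V : finType) (G : sgraph V),
          #|V| = n -> exceptional_gt G -> exists i, sw_equiv G (r i)].

Definition line_dagger (V : finType) (G : graph V) (u u' : line_vertex G) :
    sgraph (line_vertex G) :=
  sign_graph (line_graph G)
    (fun x y => (x == u) && (y \in max_clique (line_graph G) u u')).

(* The vertex [None] is the new vertex u', attached to the line graph at the
   vertex u = {v, w}; the (-)-edges at u' go to the other edges at w. *)
Section LineTwin.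
Variables (V : finType) (G : graph V) (v w : V).

Definition twin_nbr (e : line_vertex G) : bool :=
  (val e != [set v; w]) && ((v \in val e) || (w \in val e)).

Definition twin_rel : rel (option (line_vertex G)) := fun x y =>
  match x, y with
  | Some e, Some f => line_graph G e f
  | None, Some e | Some e, None => twin_nbr e
  | None, None => false
  end.

Lemma twin_rel_sym : symmetric twin_rel.
Proof. by case=> [e|] [f|] //; apply: adj_sym. Qed.

Lemma twin_rel_irr : irreflexive twin_rel.
Proof. by case=> [e|] //; apply: adj_irr. Qed.

Definition line_twin : sgraph (option (line_vertex G)) :=
  sign_graph (Graph twin_rel_sym twin_rel_irr)
    (fun x y => match x, y with None, Some e => w \in val e | _, _ => false end).
End LineTwin.

Definition is_line_graph (W : finType) (S : sgraph W) : Prop :=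
  exists (V : finType) (H : graph V),
    (is_tree H \/ exists2 C, unicyclic H C & odd #|C|) /\
    sw_equiv S (all_pos (line_graph H)).

Definition is_line_dagger (W : finType) (S : sgraph W) : Prop :=
  exists (V : finType) (H : graph V) (C : {set {set V}}) (u u' : line_vertex H),
    [/\ unicyclic H C, ~~ odd #|C|,
        [/\ val u \in C, val u' \in C & line_graph H u u']
      & sw_equiv S (line_dagger u u')].

Definition is_line_twin (W : finType) (S : sgraph W) : Prop :=
  exists (V : finType) (H : graph V) (v w : V),
    [/\ is_tree H, H v w & sw_equiv S (line_twin H v w)].

Definition is_exceptional_gt (W : finType) (S : sgraph W) : Prop :=
  exists (V : finType) (G : sgraph V), exceptional_gt G /\ sw_equiv S G.

Definition in_families (W : finType) (S : sgraph W) : Prop :=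
  [\/ is_line_graph S, is_line_dagger S, is_line_twin S
    | is_exceptional_gt S].

Record hoffman (V : finType) := Hoffman {
  hgraph :> graph V;
  fat : {set V};
  fat_coclique : {in fat &, forall x y, ~~ hgraph x y}
}.

Section HoffmanGraph.
Variables (V : finType) (H : hoffman V).

Definition slim : {set V} := ~: fat H.

Definition fat_nbrs (x : V) : {set V} := [set y in fat H | H x y].

Definition fat_hoffman : Prop := forall x, x \in slim -> fat_nbrs x != set0.

Definition slim_mx : 'M[int]_#|slim| :=
  \matrix_(i, j) (H (enum_val i) (enum_val j))%:R.

Definition slim_fat_mx : 'M[int]_(#|slim|, #|fat H|) :=
  \matrix_(i, j) (H (enum_val i) (enum_val j))%:R.

Definition hoffman_mx : 'M[int]_#|slim| :=
  slim_mx - slim_fat_mx *m slim_fat_mx^T.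

Lemma hoffman_mx_sym i j : hoffman_mx i j = hoffman_mx j i.
Proof.
rewrite !mxE adj_sym; congr (_ - _).
by apply: eq_bigr => k _; rewrite !mxE mulrC.
Qed.

Lemma entry_sym c : symmetric (fun i j => (i != j) && (hoffman_mx i j == c)).
Proof. by move=> i j; rewrite hoffman_mx_sym eq_sym. Qed.

Lemma entry_irr c : irreflexive (fun i j => (i != j) && (hoffman_mx i j == c)).
Proof. by move=> i; rewrite eqxx. Qed.

Lemma special_disj i j :
  Graph (entry_sym 1) (entry_irr 1) i j ->
  ~~ Graph (entry_sym (- 1)) (entry_irr (- 1)) i j.
Proof. by case/andP => _ /eqP /= ->; rewrite andbF. Qed.

(* The i-th slim vertex [enum_val i : V] is represented by its index i, so that
   the special graph has the same index set as [hoffman_mx]. *)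
Definition special : sgraph 'I_#|slim| := SGraph special_disj.
End HoffmanGraph.

(* Main.v *)
From Stdlib Require Import ZArith FMapPositive.
Require Import Defs.
From mathcomp Require Import all_boot all_order all_algebra all_field.
From mathcomp Require Import ssrZ zify ring.

(** Each slim vertex has one fat neighbour, so the matrix B of the Hoffman graph is
    A - I, where A is the adjacency matrix of the special graph S, and the
    smallest eigenvalue exceeds -3 if and only if A + 2I is positive definite
    ([hoffman_eig_gt], by the spectral theorem). Then A + 2I is the Gram matrix of
    a linearly independent family of vectors of norm 2. Such a family is treated
    through its Gram function M, without the vectors; switching replaces vectors
    by their opposites, so that switching equivalence becomes the relation
    [signed_iso] between Gram functions. The form splits over the components of S
    ([pd_components]), which reduces the theorem to connected S.

    Suppose that the vectors have integral coordinates. A vector of norm 2 has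
    two nonzero coordinates, both 1 or -1, so the family is a connected
    multigraph on the coordinates with signed edges. By independence it has at
    most as many edges as vertices: it is a spanning tree with at most one
    further edge p. Signs can be chosen so that the edges ab of the tree become
    e_a + e_b. If there is no p, the graph is the line graph of a tree. If p is
    parallel to an edge of the tree, it is e_a - e_b, and this is the line graph of
    a tree with a twin. Otherwise p closes a cycle; the tree leaves one alternating
    vector orthogonal to all its edges, which p must not annihilate. So p is
    e_a + e_b if the cycle is odd, which gives a line graph, and e_a - e_b if it is
    even, which gives a graph [line_dagger] ([rep_families]). The same coordinates
    show conversely that these graphs are positive definite ([families_pd]).

    If S is connected, positive definite and has no integral representation, it
    is exceptional. To determine these graphs, replace a vector u by its
    reflection u - (u, v) v in another vector v of the family. Such moves are
    reversible and preserve connectedness and integral representability. They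
    lead to an obtuse basis ([exists_obtuse]): vectors are added one by one to an
    obtuse set, and reflecting the new vector in a member at an acute angle
    decreases a bounded integer. An obtuse basis is a Dynkin diagram A, D or E,
    since in a longest path everything else would give an affine diagram with an
    isotropic vector ([obtuse_classification]). The diagrams A and D are integral
    and E_6, E_7 and E_8 are not ([E_no_rep]), so the exceptional graphs have 6, 7
    or 8 vertices and are those that moves reach from a diagram E.

    They are counted by an atlas for each of the three diagrams: a list of Gram
    matrices that begins with E, in which each other matrix arises by a move from
    an earlier one, and each move leads back to the list up to relabelling and
    signs, by a relabelling that is part of the data. So the list is complete
    ([atlas_complete]). A polynomial in the entries that does not depend on
    labels and signs takes distinct values on the list, so no two of its members
    are equivalent ([atlas_distinct]). The three lists are found by a
    breadth-first search and have 32, 233 and 1242 members. *)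

Set Implicit Arguments.
Unset Strict Implicit.
Unset Printing Implicit Defensive.
Import Order.TTheory GRing.Theory Num.Theory.
Local Open Scope ring_scope.

(** * Gram functions and switching *)

Definition gram (V : finType) (G : sgraph V) (x y : V) : int :=
  if x == y then 2 else sadj G x y.

Definition sgn (b : bool) : int := (-1) ^+ b.

Lemma sgnM b : sgn b * sgn b = 1.
Proof. by case: b. Qed.

Lemma sgn_neq0 b : sgn b != 0.
Proof. by case: b. Qed.

(** Equality of Gram functions up to renaming and up to replacing vectors by
    their opposites. *)
Definition signed_iso (V W : finType) (M : V -> V -> int) (N : W -> W -> int) :=
  exists f : V -> W, exists s : V -> bool,
    bijective f /\ forall x y, N (f x) (f y) = sgn (s x) * sgn (s y) * M x y.

Lemma signed_iso_ext (V : finType) (M N : V -> V -> int) :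
  (forall x y, N x y = M x y) -> signed_iso M N.
Proof.
move=> MN; exists id, (fun=> false); split; first by exists id.
by move=> x y; rewrite MN !mul1r.
Qed.

Lemma signed_iso_refl (V : finType) (M : V -> V -> int) : signed_iso M M.
Proof. exact: signed_iso_ext. Qed.

Lemma signed_iso_sym (V W : finType) (M : V -> V -> int) (N : W -> W -> int) :
  signed_iso M N -> signed_iso N M.
Proof.
case=> f [s [[g fK gK] MN]]; exists g, (s \o g); split; first by exists f.
move=> x y /=; have := MN (g x) (g y); rewrite !gK => ->.
by rewrite mulrA mulrACA !sgnM !mul1r.
Qed.

Lemma signed_iso_trans (V W X : finType) (M : V -> V -> int)
    (N : W -> W -> int) (P : X -> X -> int) :
  signed_iso M N -> signed_iso N P -> signed_iso M P.
Proof.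
case=> f [s [bf MN]] [g [t [bg NP]]].
exists (g \o f), (fun x => s x (+) t (f x)); split; first exact: bij_comp.
by move=> x y /=; rewrite NP MN /sgn !signr_addb; ring.
Qed.

Lemma sadj_sym (V : finType) (G : sgraph V) x y : sadj G x y = sadj G y x.
Proof. by rewrite /sadj adj_sym [negg _ _ _]adj_sym. Qed.

Lemma gram_sym (V : finType) (G : sgraph V) x y : gram G x y = gram G y x.
Proof. by rewrite /gram eq_sym sadj_sym. Qed.

Lemma gram_diag (V : finType) (G : sgraph V) x : gram G x x = 2.
Proof. by rewrite /gram eqxx. Qed.

Lemma sadj_diag (V : finType) (G : sgraph V) x : sadj G x x = 0.
Proof. by rewrite /sadj !adj_irr. Qed.

Lemma sadj_pos (V : finType) (G : sgraph V) x y : posg G x y = (sadj G x y == 1).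
Proof. by rewrite /sadj; case: ifP => // _; case: ifP. Qed.

Lemma sadj_neg (V : finType) (G : sgraph V) x y : negg G x y = (sadj G x y == -1).
Proof.
rewrite /sadj; have := @sg_disj _ G x y.
by case: ifP => [_ /(_ isT)/negbTE->|_ _] //; case: ifP.
Qed.

Lemma sadj_neq0 (V : finType) (G : sgraph V) x y :
  (sadj G x y != 0) = underlying G x y.
Proof. by rewrite /sadj /=; case: ifP => // _; case: ifP. Qed.

Lemma sadj_switch (V : finType) (U : {set V}) (G : sgraph V) x y :
  sadj (switch U G) x y = sgn (x \in U) * sgn (y \in U) * sadj G x y.
Proof.
have at1 v (K : sgraph V) :
  sadj (switch_at v K) x y = sgn (x == v) * sgn (y == v) * sadj K x y.
  have [exy|nxy] := eqVneq x y; first by rewrite exy !sadj_diag mulr0.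
  rewrite {1}/sadj /= /sw_rel; have := @sg_disj _ K x y; rewrite /sadj.
  have [exv|_] := eqVneq x v; have [eyv|_] := eqVneq y v => /=.
  - by case/eqP: nxy; rewrite exv.
  - by case: (posg K x y) => [/(_ isT)/negbTE->|_] //; case: (negg K x y).
  - by case: (posg K x y) => [/(_ isT)/negbTE->|_] //; case: (negg K x y).
  - by rewrite !mul1r.
rewrite /switch.
have -> : (x \in U) = (x \in enum U) by rewrite mem_enum.
have -> : (y \in U) = (y \in enum U) by rewrite mem_enum.
elim: (enum U) (enum_uniq (mem U)) => [|v s IHs] /=; first by rewrite !mul1r.
case/andP=> vs /IHs {}IHs; rewrite at1 IHs !inE.
have sgnU z : sgn (z == v) * sgn (z \in s) = sgn ((z == v) || (z \in s)).
  have [->|_] := eqVneq z v; last by rewrite mul1r.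
  by rewrite (negbTE vs).
by rewrite -!sgnU; ring.
Qed.

(** The adjacency entries determine the signed edges, so switching equivalence
    is a relation between Gram functions. *)
Lemma sw_equivP (V W : finType) (G : sgraph V) (K : sgraph W) :
  sw_equiv G K <-> signed_iso (gram G) (gram K).
Proof.
split.
- case=> U [f bf fE]; exists f, (mem U); split=> // x y.
  rewrite /gram (bij_eq bf); case: eqP => [->|_]; first by rewrite sgnM.
  rewrite -sadj_switch /sadj.
  by case: (fE x y) => -> ->.
- case=> f [s [bf fE]]; exists [set x | s x], f => // x y.
  suff E : sadj K (f x) (f y) = sadj (switch [set x | s x] G) x y.
    by rewrite !sadj_pos !sadj_neg E.
  have [->|nxy] := eqVneq x y; first by rewrite !sadj_diag.
  rewrite sadj_switch !inE; have := fE x y.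
  by rewrite /gram (bij_eq bf) (negbTE nxy).
Qed.

(** * Positive definiteness and the smallest eigenvalue *)

Definition qform (V : finType) (M : V -> V -> int) (c : V -> algC) : algC :=
  \sum_x \sum_y (M x y)%:~R * (c x * (c y)^*).

(** The Hermitian form of M is tested on complex vectors, because the
    eigenvectors are a priori complex. *)
Definition pd (V : finType) (M : V -> V -> int) : Prop :=
  forall c, (exists x, c x != 0) -> 0 < qform M c.

Lemma sumr_neq0_gt0 (V : finType) (c : V -> algC) :
  (exists x, c x != 0) -> 0 < \sum_x c x * (c x)^*.
Proof.
case=> x cx; rewrite (bigD1 x) //= ltr_pwDl ?mul_conjC_gt0 //.
by apply: sumr_ge0 => y _; apply: mul_conjC_ge0.
Qed.

Lemma pd_signed_iso (V W : finType) (M : V -> V -> int) (N : W -> W -> int) :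
  signed_iso M N -> pd M -> pd N.
Proof.
case=> f [s [bf MN]] pdM c [w cw].
have [g fK gK] := bf.
suff -> : qform N c = qform M (fun x => (sgn (s x))%:~R * c (f x)).
  by apply: pdM; exists (g w); rewrite gK mulf_neq0 // intr_eq0 sgn_neq0.
rewrite /qform (reindex f) /=; last exact: onW_bij.
apply: eq_bigr => x _; rewrite (reindex f) /=; last exact: onW_bij.
apply: eq_bigr => y _; rewrite MN !rmorphM /= rmorph_int.
ring.
Qed.

Section Spectral.
Local Open Scope sesquilinear_scope.

Lemma map_mx_intr_herm n (A : 'M[int]_n) : (forall i j, A i j = A j i) ->
  map_mx (intr : int -> algC) A \is hermsymmx.
Proof.
move=> symA; apply/is_hermitianmxP; rewrite expr0 scale1r.
by apply/matrixP=> i j; rewrite !mxE rmorph_int symA.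
Qed.

(** One direction evaluates the form at an eigenvector; for the other one, an
    orthonormal eigenbasis writes the form as a sum of squares whose
    coefficients are the eigenvalues minus c. *)
Lemma smallest_eig_gtP n (A : 'M[int]_n) (c : int) (M : 'I_n -> 'I_n -> int) :
  (forall i j, A i j = A j i) -> (forall i j, M i j = A i j - c *+ (i == j)) ->
  smallest_eig_gt A c <-> pd M.
Proof.
move=> symA ME; set B := map_mx (intr : int -> algC) A.
have qE (u : 'rV[algC]_n) :
    qform M (u 0) = (u *m B *m u ^t*) 0 0 - c%:~R * \sum_i u 0 i * (u 0 i)^*.
  rewrite /qform mxE mulr_sumr exchange_big /= -sumrB; apply: eq_bigr => j _.
  transitivity (\sum_i (u 0 i * B i j * (u 0 j)^* -
      c%:~R * ((i == j)%:R * (u 0 i * (u 0 j)^*)))).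
    by apply: eq_bigr => i _; rewrite ME mxE rmorphB rmorphMn /= -mulr_natr; ring.
  rewrite sumrB; congr (_ - _); first by rewrite !mxE mulr_suml.
  rewrite -mulr_sumr; congr (_ * _).
  rewrite (bigD1 j) //= big1 ?eqxx ?addr0 ?mul1r // => i /negbTE->.
  by rewrite mul0r.
split=> [eigA d [i0 di0]|pdM a /eigenvalueP[v vA v0]]; last first.
  have v_ex : exists i, v 0 i != 0.
    case/rV0Pn: v0 => i vi; by exists i.
  have := pdM _ v_ex; rewrite qE vA -scalemxAl !mxE.
  rewrite [X in a * X](eq_bigr (fun i => v 0 i * (v 0 i)^*)); last first.
    by move=> i _; rewrite !mxE.
  by rewrite -mulrBl pmulr_lgt0 ?subr_gt0 // sumr_neq0_gt0.
have hermB := map_mx_intr_herm symA.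
have /orthomx_spectralP BE := hermitian_normalmx hermB.
have := hermitian_spectral_diag_real hermB.
move: (spectral_unitarymx B) BE; rewrite -/B.
set P := spectralmx B; set D := spectral_diag B => uP BE realD.
have eD i : c%:~R < D 0 i.
  apply: eigA; apply/eigenvalueP; exists (row i P).
    rewrite -/B {1}BE -!row_mul !mulmxA mulmxV ?unitarymx_unit // mul1mx.
    by apply/rowP=> j; rewrite mxE mul_diag_mx !mxE.
  apply/eqP=> /(congr1 (fun u => (u *m u ^t*) 0 0)) /eqP.
  have /row_unitarymxP/(_ i i) := uP; rewrite dotmxE eqxx => ->.
  by rewrite mul0mx mxE oner_eq0.
pose u := \row_i d i; pose y := u *m invmx P.
have uE : u = y *m P by rewrite mulmxKV ?unitarymx_unit.
have -> : qform M d = qform M (u 0).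
  apply: eq_bigr => i _; apply: eq_bigr => j _; by rewrite !mxE.
have uu : \sum_i u 0 i * (u 0 i)^* = \sum_i y 0 i * (y 0 i)^*.
  transitivity ((u *m u ^t*) 0 0).
    by rewrite mxE; apply: eq_bigr => i _; rewrite !mxE.
  rewrite uE trmx_mul map_mxM mulmxA mulmxtVK // mxE.
  by apply: eq_bigr => i _; rewrite !mxE.
rewrite qE uu.
have -> : (u *m B *m u ^t*) 0 0 = \sum_i D 0 i * (y 0 i * (y 0 i)^*).
  rewrite BE uE trmx_mul map_mxM !mulmxA mulmxK ?unitarymx_unit //.
  rewrite mulmxtVK // mxE; apply: eq_bigr => i _.
  by rewrite mul_mx_diag !mxE; ring.
rewrite mulr_sumr -sumrB.
have [j yj] : exists j, y 0 j != 0.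
  apply/rV0Pn; apply: contra_neq di0 => y0.
  by have := congr1 (fun u : 'rV_n => u 0 i0) uE; rewrite y0 mul0mx !mxE.
rewrite (bigD1 j) //= ltr_pwDl //.
  by rewrite -mulrBl pmulr_lgt0 ?mul_conjC_gt0 ?subr_gt0.
apply: sumr_ge0 => i _; rewrite -mulrBl mulr_ge0 ?mul_conjC_ge0 //.
by rewrite subr_ge0 ltW.
Qed.

End Spectral.

(** The Gram function has matrix A + 2I for the adjacency matrix A. *)
Lemma eig_gt_gram (V : finType) (G : sgraph V) :
  smallest_eig_gt (sadj_mx G) (- 2) <-> pd (gram G).
Proof.
pose M (i j : 'I_#|V|) := gram G (enum_val i) (enum_val j).
rewrite (@smallest_eig_gtP _ _ _ M).
- have iso : signed_iso M (gram G).
    exists enum_val, (fun=> false); split; first exact: enum_val_bij.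
    by move=> i j; rewrite !mul1r.
  by split; apply: pd_signed_iso => //; apply: signed_iso_sym.
- by move=> i j; rewrite !mxE sadj_sym.
- move=> i j; rewrite !mxE /M /gram (inj_eq enum_val_inj).
  by case: eqP => [->|_]; rewrite ?sadj_diag ?mulr0n ?subr0.
Qed.

(** * Root systems given by their Gram functions *)

Lemma sum_push (R : pzSemiRingType) (V W : finType) (f : W -> V) (F : V -> R) (c : W -> R) :
  \sum_x F x * (\sum_(w | f w == x) c w) = \sum_w F (f w) * c w.
Proof.
rewrite [RHS](partition_big f predT) //=; apply: eq_bigr => x _.
by rewrite mulr_sumr; apply: eq_bigr => w /eqP->.
Qed.

Lemma sum_delta (R : pzSemiRingType) (V : finType) (F : V -> R) x :
  \sum_y F y * (y == x)%:R = F x.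
Proof.
rewrite (bigD1 x) //= eqxx mulr1 big1 ?addr0 // => y /negbTE->.
by rewrite mulr0.
Qed.

(** Relabelling the vectors of a combination, with possible repetitions. *)
Lemma qform_push (V W : finType) (f : W -> V) (M : V -> V -> int) (c : W -> algC) :
  qform (fun x y => M (f x) (f y)) c = qform M (fun x => \sum_(w | f w == x) c w).
Proof.
pose d x := \sum_(w | f w == x) c w.
rewrite -/d /qform; symmetry.
transitivity (\sum_x (\sum_y (M x y)%:~R * (d y)^*) * d x).
  by apply: eq_bigr => x _; rewrite mulr_suml; apply: eq_bigr => y _; ring.
rewrite sum_push; apply: eq_bigr => x _; rewrite mulrC.
transitivity (c x * \sum_w (M (f x) (f w))%:~R * (c w)^*); last first.
  by rewrite mulr_sumr; apply: eq_bigr => w _; ring.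
congr (_ * _); transitivity (\sum_y (M (f x) y)%:~R * (\sum_(w | f w == y) (c w)^*)).
  by apply: eq_bigr => y _; rewrite rmorph_sum.
exact: sum_push.
Qed.

Lemma sum_fiber (R : nmodType) (V W : finType) (f : W -> V) (c : W -> R) w :
  injective f -> \sum_(u | f u == f w) c u = c w.
Proof. by move=> injf; rewrite (big_pred1 w) // => u; rewrite (inj_eq injf). Qed.

Lemma pd_comp (V W : finType) (f : W -> V) (M : V -> V -> int) :
  injective f -> pd M -> pd (fun x y => M (f x) (f y)).
Proof.
move=> injf pdM c [w cw]; rewrite qform_push; apply: pdM.
by exists (f w); rewrite sum_fiber.
Qed.

Lemma pd_int (V : finType) (M : V -> V -> int) (c : V -> int) :
  pd M -> (exists x, c x != 0) -> 0 < \sum_x \sum_y M x y * (c x * c y).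
Proof.
move=> pdM [x cx]; rewrite -(ltr0z algC) rmorph_sum /=.
suff -> : \sum_x (\sum_y M x y * (c x * c y))%:~R = qform M (fun x => (c x)%:~R).
  by apply: pdM; exists x; rewrite intr_eq0.
apply: eq_bigr => y _; rewrite rmorph_sum; apply: eq_bigr => z _ /=.
by rewrite !rmorphM rmorph_int.
Qed.

(** The Gram functions of bases of root systems all of whose roots have norm 2. *)
Definition root_gram (V : finType) (M : V -> V -> int) : Prop :=
  [/\ forall x y, M x y = M y x, forall x, M x x = 2 & pd M].

Definition gconn (V : finType) (M : V -> V -> int) : Prop :=
  forall x y, connect (fun x y => M x y != 0) x y.

Definition has_rep (V : finType) (M : V -> V -> int) : Prop :=
  exists n (phi : V -> 'rV[int]_n), forall x y, dot (phi x) (phi y) = M x y.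

(** The vectors x + y and x - y have positive norms 4 + 2 M x y and 4 - 2 M x y. *)
Lemma root_gram_bound (V : finType) (M : V -> V -> int) x y :
  root_gram M -> x != y -> -1 <= M x y <= 1.
Proof.
case=> symM diagM pdM nxy.
have Q (s : int) : 0 < 2 + 2 * s * M x y + 2 * (s * s).
  pose c z : int := (z == x)%:R + s * (z == y)%:R.
  suff <- : \sum_z \sum_t M z t * (c z * c t) = 2 + 2 * s * M x y + 2 * (s * s).
    by apply: pd_int => //; exists x; rewrite /c eqxx (negbTE nxy) mulr0 addr0.
  transitivity (\sum_z (M z x + s * M z y) * c z).
    apply: eq_bigr => z _.
    rewrite -(sum_delta (M z) x) -(sum_delta (M z) y) mulr_sumr -big_split mulr_suml /=.
    by apply: eq_bigr => t _; rewrite /c; ring.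
  transitivity (\sum_z ((M z x + s * M z y) * (z == x)%:R
                + ((M z x + s * M z y) * s) * (z == y)%:R)).
    by apply: eq_bigr => z _; rewrite /c; ring.
  by rewrite big_split /= !sum_delta !diagM [M y x]symM; ring.
by have := Q 1; have := Q (-1); lia.
Qed.

(** ** Elementary moves *)

(** The Gram function of the family in which the i-th vector u is replaced by
    its reflection u - (u, v) v in the j-th vector v. *)
Definition mv (V : finType) (M : V -> V -> int) (i j x y : V) : int :=
  let t z := (z == i)%:R * M i j in
  M x y - t x * M j y - t y * M x j + t x * t y * M j j.

Inductive mvs (V : finType) (M : V -> V -> int) : (V -> V -> int) -> Prop :=
| mvs0 : mvs M M
| mvsS N i j : mvs M N -> i != j -> mvs M (mv N i j).

Lemma mvs_trans (V : finType) (M N P : V -> V -> int) :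
  mvs M N -> mvs N P -> mvs M P.
Proof. by move=> MN; elim=> // Q i j _ MQ nij; apply: mvsS. Qed.

Section Moves.
Variables (V : finType) (M : V -> V -> int) (i j : V).
Hypotheses (rM : root_gram M) (nij : i != j).

Lemma mvK x y : mv (mv M i j) i j x y = M x y.
Proof.
case: rM => symM diagM _.
rewrite /mv !eqxx [j == i]eq_sym (negbTE nij) !diagM.
by rewrite /= !mulr1n !mulr0n; ring.
Qed.

(** The form of the moved family at c is the form of M at the coordinates d of
    the same vector with respect to the original family. *)
Lemma mv_root_gram : root_gram (mv M i j).
Proof.
case: rM => symM diagM pdM; split.
- by move=> x y; rewrite /mv [M j y]symM [M x j]symM [M x y]symM; ring.
- move=> x; rewrite /mv !diagM [M x j]symM.
  by have [->|_] := eqVneq x i; rewrite /= ?mulr1n ?mulr0n ?[M j i]symM; ring.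
- move=> c [x cx].
  pose m : algC := (M i j)%:~R.
  pose d y := c y - (m * c i) * (y == j)%:R.
  suff -> : qform (mv M i j) c = qform M d.
    apply: pdM; have [ci|ci] := eqVneq (c i) 0.
      by exists x; rewrite /d ci mulr0 mul0r subr0.
    by exists i; rewrite /d (negbTE nij) mulr0 subr0.
  have conjd y : (d y)^* = (c y)^* - (m * (c i)^*) * (y == j)%:R.
    by rewrite rmorphB !rmorphM /= rmorph_nat rmorph_int.
  pose L := \sum_x (M x j)%:~R * c x; pose R := \sum_y (M j y)%:~R * (c y)^*.
  transitivity (qform M c - m * c i * R - m * (c i)^* * L
                + m * m * (c i * (c i)^*) * (M j j)%:~R).
  + transitivity (\sum_x (\sum_y (M x y)%:~R * (c x * (c y)^*)
        - (m * c x * (x == i)%:R) * \sum_y (M j y)%:~R * (c y)^*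
        - ((M x j)%:~R * c x) * \sum_y m * (c y)^* * (y == i)%:R
        + (m * m * (M j j)%:~R * c x * (x == i)%:R) * \sum_y (c y)^* * (y == i)%:R)).
      apply: eq_bigr => z _; rewrite !mulr_sumr -!sumrB -big_split.
      apply: eq_bigr => y _ /=.
      by rewrite /mv /m !rmorphD !rmorphN !rmorphM !rmorph_nat; ring.
    rewrite big_split !sumrB -!mulr_suml !sum_delta -/L -/R; congr (_ - _ + _); by ring.
  + pose S x := \sum_y (M x y)%:~R * (c y)^* - m * (c i)^* * (M x j)%:~R.
    transitivity (\sum_x (c x * S x - m * c i * (S x * (x == j)%:R))).
      rewrite sumrB -mulr_sumr sum_delta {2}/S -/R.
      suff -> : \sum_x c x * S x = qform M c - m * (c i)^* * L by ring.
      rewrite /qform /L mulr_sumr -sumrB; apply: eq_bigr => z _.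
      rewrite /S mulrBr mulr_sumr; congr (_ - _); last by ring.
      by apply: eq_bigr => y _; ring.
    apply: eq_bigr => z _.
    have -> : c z * S z - m * c i * (S z * (z == j)%:R) = d z * S z.
      by rewrite /d; ring.
    rewrite /S -[in X in _ - X](sum_delta (fun y => (M z y)%:~R : algC) j).
    rewrite mulr_sumr -sumrB mulr_sumr; apply: eq_bigr => y _.
    by rewrite conjd; ring.
Qed.

(** If the moved vector i loses its inner product with y, then j is adjacent to
    y, and i is still adjacent to j. *)
Lemma mv_gconn : gconn M -> gconn (mv M i j).
Proof.
case: rM => symM diagM _ cM.
have [m0|m0] := eqVneq (M i j) 0.
  move=> x y; rewrite (eq_connect (e' := fun x y => M x y != 0)) // => a b.
  by congr (_ != 0); rewrite /mv m0; ring.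
have [symN _ _] := mv_root_gram.
have csym : connect_sym (fun x y => mv M i j x y != 0).
  by apply: sym_connect_sym => x y; rewrite symN.
have cij : connect (fun x y => mv M i j x y != 0) i j.
  apply: connect1; suff -> : mv M i j i j = - M i j by rewrite oppr_eq0.
  by rewrite /mv eqxx [j == i]eq_sym (negbTE nij) !diagM /= mulr1n mulr0n; ring.
have ci y : M i y != 0 -> connect (fun x y => mv M i j x y != 0) i y.
  have [<-//|niy] := eqVneq i y; have [<-//|njy] := eqVneq j y.
  move=> miy; have [mjy|mjy] := eqVneq (M j y) 0.
    apply: connect1; suff -> : mv M i j i y = M i y by [].
    by rewrite /mv eqxx [y == i]eq_sym (negbTE niy) mjy /= mulr1n mulr0n; ring.
  apply: connect_trans cij (connect1 _).
  suff -> : mv M i j j y = M j y by [].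
  by rewrite /mv [y == i]eq_sym [j == i]eq_sym (negbTE niy) (negbTE nij) /= mulr0n; ring.
move=> x y; apply: (connect_sub _ (cM x y)) => {x y} x y mxy.
have [exi|nxi] := eqVneq x i; first by subst x; apply: ci.
have [eyi|nyi] := eqVneq y i; first by subst y; rewrite csym ci // symM.
apply: connect1; suff -> : mv M i j x y = M x y by [].
by rewrite /mv (negbTE nxi) (negbTE nyi) /= mulr0n; ring.
Qed.

End Moves.

Lemma dotC n (u v : 'rV[int]_n) : dot u v = dot v u.
Proof. by apply: eq_bigr => k _; rewrite mulrC. Qed.

Lemma dotBZl n (u v w : 'rV[int]_n) a : dot (u - a *: v) w = dot u w - a * dot v w.
Proof.
rewrite /dot mulr_sumr -sumrB; apply: eq_bigr => k _.
by rewrite !mxE; ring.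
Qed.

Lemma dotBZr n (u v w : 'rV[int]_n) a : dot w (u - a *: v) = dot w u - a * dot w v.
Proof. by rewrite dotC dotBZl !(dotC w). Qed.

Lemma has_rep_mv (V : finType) (M : V -> V -> int) i j :
  has_rep M -> has_rep (mv M i j).
Proof.
case=> n [phi E]; exists n, (fun x => phi x - ((x == i)%:R * M i j) *: phi j) => x y.
by rewrite dotBZl !dotBZr !E /mv; ring.
Qed.

Lemma has_rep_signed_iso (V W : finType) (M : V -> V -> int) (N : W -> W -> int) :
  signed_iso M N -> has_rep N -> has_rep M.
Proof.
case=> f [s [bf MN]] [n [phi E]].
exists n, (fun x => sgn (s x) *: phi (f x)) => x y.
transitivity (sgn (s x) * sgn (s y) * dot (phi (f x)) (phi (f y))).
  by rewrite /dot mulr_sumr; apply: eq_bigr => k _; rewrite !mxE; ring.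
by rewrite E MN mulrA mulrACA !sgnM !mul1r.
Qed.

Section MovesClosure.
Variables (V : finType) (M N : V -> V -> int).
Hypothesis MN : mvs M N.

Lemma mvs_root_gram : root_gram M -> root_gram N.
Proof. by move=> rM; elim: MN => // P i j _ rP nij; apply: mv_root_gram. Qed.

Lemma mvs_gconn : root_gram M -> gconn M -> gconn N.
Proof.
move=> rM cM; suff [] : root_gram N /\ gconn N by [].
elim: MN => // P i j _ [rP cP] nij; split; first exact: mv_root_gram.
exact: mv_gconn.
Qed.

(** Moves can be undone, by the same moves in reverse order. *)
Lemma mvs_ind_rev (P : (V -> V -> int) -> Prop) :
  root_gram M ->
  (forall K i j, root_gram K -> i != j -> P K -> P (mv K i j)) ->
  (forall K L, (forall x y, K x y = L x y) -> P K -> P L) ->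
  P N -> P M.
Proof.
move=> rM Pmv Pext; suff [] : root_gram N /\ (P N -> P M) by [].
elim: MN => // K i j _ [rK IH] nij; split; first exact: mv_root_gram.
move=> PK; apply: IH; apply: Pext (Pmv _ _ _ (mv_root_gram rK nij) nij PK).
by move=> x y; apply: mvK.
Qed.

End MovesClosure.

(** ** Obtuse bases *)

Definition obtuse_on (V : finType) (S : {set V}) (M : V -> V -> int) : Prop :=
  forall x y, x \in S -> y \in S -> x != y -> M x y <= 0.

(** The Gram matrix of S is invertible, so some vector in the span has inner
    product 1 with every member of S; the adjugate clears the denominators. *)
Lemma exists_weyl_vector (V : finType) (M : V -> V -> int) (S : {set V}) :
  pd M -> exists w d, 0 < d /\
    forall s, s \in S -> \sum_(t in S) w t * M t s = d :> int.
Proof.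
move=> pdM; pose A : 'M[int]_#|S| := \matrix_(i, j) M (enum_val i) (enum_val j).
have detA : \det A != 0.
  apply/negP => /eqP detA0.
  have : \det (map_mx (intr : int -> algC) A) == 0 by rewrite det_map_mx detA0.
  case/det0P => v v0 vA.
  have := @pd_comp _ _ (@enum_val V (mem S)) M enum_val_inj pdM (v 0).
  suff -> : qform (fun i j : 'I_#|S| => M (enum_val i) (enum_val j)) (v 0) = 0.
    case/rV0Pn: v0 => i vi.
    by rewrite ltxx => /(_ (ex_intro _ i vi)).
  rewrite /qform exchange_big big1 //= => j _.
  transitivity ((v *m map_mx intr A) 0 j * (v 0 j)^*).
    by rewrite mxE mulr_suml; apply: eq_bigr => i _; rewrite !mxE; ring.
  by rewrite vA mxE mul0r.
pose u : 'rV_#|S| := \det A *: (const_mx 1 *m \adj A).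
exists (fun t => \sum_(i | enum_val i == t) u 0 i), (\det A * \det A).
split; first by rewrite lt_neqAle eq_sym mulf_neq0 //= -expr2 sqr_ge0.
move=> s Ss; rewrite big_enum_val.
transitivity ((u *m A) 0 (enum_rank_in Ss s)).
  rewrite [RHS]mxE; apply: eq_bigr => i _.
  rewrite [A _ _]mxE enum_rankK_in //.
  congr (_ * _); rewrite (big_pred1 i) // => k.
  by rewrite (inj_eq enum_val_inj).
by rewrite -scalemxAl -mulmxA mul_adj_mx mul_mx_scalar !mxE mulr1.
Qed.

(** Reflecting v in a member of S with which it makes an acute angle decreases
    its inner product with the vector w; this inner product is bounded. *)
Lemma obtuse_extend (V : finType) (M : V -> V -> int) (S : {set V}) v :
  root_gram M -> v \notin S -> obtuse_on S M ->
  exists2 N, mvs M N & obtuse_on (v |: S) N.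
Proof.
move=> rM vS obM; have [_ _ pdM] := rM.
have [w [d [d0 wd]]] := exists_weyl_vector S pdM.
pose f (N : V -> V -> int) := \sum_(t in S) w t * N v t.
pose B := \sum_(t in S) `|w t|.
have nvS s : s \in S -> v != s by apply: contraTneq => <-.
have fB N : root_gram N -> 0 <= f N + B.
  move=> rN; rewrite /f /B -big_split; apply: sumr_ge0 => t St /=.
  have := root_gram_bound rN (nvS _ St); nia.
suff: forall (k : nat) N, root_gram N -> {in S &, forall s t, N s t = M s t} ->
      f N + B <= k%:Z -> exists2 N', mvs N N' & obtuse_on (v |: S) N'.
  by apply; last exact: (lez_abs (f M + B)).
elim=> [|k IHk] N rN NM Nk.
all: have [/existsP[s /andP[Ss Nvs]]|/existsPn allN] :=
  boolP [exists s, (s \in S) && (0 < N v s)].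
2, 4: exists N; first exact: mvs0.
2, 3: move=> x y; have [symN _ _] := rN.
2, 3: have obv s : s \in S -> N v s <= 0
        by (move=> Ss; have := allN s; rewrite Ss -leNgt).
2, 3: case/setU1P => [->|Sx] /setU1P[->|Sy] nxy;
      [by case/eqP: nxy | exact: obv | by rewrite symN obv
      | by rewrite NM // obM].
all: have N1 : N v s = 1 by (have := root_gram_bound rN (nvS _ Ss); lia).
all: have rN' := mv_root_gram rN (nvS _ Ss).
all: have fN' : f (mv N v s) = f N - d.
1, 3: rewrite /f -(wd s Ss) -sumrB; apply: eq_bigr => t St.
1, 2: rewrite /mv eqxx [t == v]eq_sym (negbTE (nvS _ St)) N1 (NM _ _ Ss St).
1, 2: by have [symM _ _] := rM; rewrite symM /= mulr1n mulr0n; ring.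
  by have := fB _ rN'; rewrite fN'; lia.
have [] := IHk _ rN'.
- move=> a b Sa Sb; rewrite -NM // /mv ![_ == v]eq_sym.
  by rewrite (negbTE (nvS _ Sa)) (negbTE (nvS _ Sb)) /= mulr0n; ring.
- by rewrite fN'; lia.
- move=> N' NN' obN'; exists N' => //; apply: mvs_trans NN'.
  by apply: mvsS (nvS _ Ss); apply: mvs0.
Qed.

Theorem exists_obtuse (V : finType) (M : V -> V -> int) :
  root_gram M -> exists2 N, mvs M N & forall x y, x != y -> N x y <= 0.
Proof.
move=> rM; suff [N MN obN] : exists2 N, mvs M N & obtuse_on [set: V] N.
  by exists N => // x y; apply: obN; rewrite inE.
suff: forall s : seq V, uniq s -> exists2 N, mvs M N & obtuse_on [set x in s] N.
  move=> /(_ _ (enum_uniq V))[N MN obN]; exists N => // x y _ _.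
  by apply: obN; rewrite inE mem_enum.
elim=> [|v s IHs] /=; first by exists M; [exact: mvs0|move=> x y; rewrite inE].
case/andP=> vs /IHs[N MN obN].
have [|N' NN' obN'] := obtuse_extend (mvs_root_gram MN rM) _ obN (v := v).
  by rewrite inE.
exists N'; first exact: mvs_trans NN'.
by move=> x y; rewrite !inE => xs ys; apply: obN'; rewrite !inE.
Qed.

(** * Dynkin diagrams *)

(* Convertible forms of the item type give syntactically different sizes of the
   same list; they are unified before the arithmetic. *)
Ltac slia :=
  repeat match goal with
  | q : seq ?A, H : context [@size ?B ?q] |- _ =>
      tryif constr_eq A B then fail else change (@size B q) with (@size A q) in H
  | q : seq ?A |- context [@size ?B ?q] =>
      tryif constr_eq A B then fail else change (@size B q) with (@size A q)
  end; lia.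

Lemma connect_crossing (V : finType) (e : rel V) (S : {pred V}) x y :
  connect e x y -> x \in S -> y \notin S ->
  exists a b, [/\ a \in S, b \notin S & e a b].
Proof.
case/connectP => p; elim: p x => [|z p IHp] x /= => [_ -> ->//|].
case/andP=> xz zp yE xS yS; have [zS|zS] := boolP (z \in S); first exact: (IHp z).
by exists x, z.
Qed.

Section AffineDiagrams.
Variables (V : finType) (M : V -> V -> int).
Hypotheses (rM : root_gram M) (obM : forall x y, x != y -> M x y <= 0).

Let e x y := M x y == -1.

Lemma link_sym : symmetric e.
Proof. by case: rM => symM _ _ x y; rewrite /e symM. Qed.

Lemma linkE x y : x != y -> M x y = if e x y then -1 else 0.
Proof.
move=> nxy; rewrite /e; case: eqP => // n1.
by have := root_gram_bound rM nxy; have := obM nxy; lia.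
Qed.

Lemma link_neq x y : e x y -> x != y.
Proof. by case: rM => _ diagM _; apply: contraTneq => ->; rewrite /e diagM. Qed.

(** The norm of the vector with nonnegative coordinates c is at most the sum of
    the c x * (2 c x - s), where s sums c over the neighbours of x; so no
    subgraph carries the weights of an affine diagram. *)
Lemma no_affine_weight (c : V -> nat) :
  (exists x, c x != 0)%N ->
  (forall x, c x != 0 -> 2 * c x <= \sum_(y | e x y) c y)%N -> False.
Proof.
case=> x0 cx0 aff; have [_ diagM pdM] := rM.
have := @pd_int _ M (fun x => (c x)%:Z) pdM (ex_intro _ x0 cx0).
rewrite ltNge => /negP; apply; apply: sumr_le0 => x _.
rewrite (_ : \sum_y _ = (c x)%:Z * \sum_y M x y * (c y)%:Z); last first.
  by rewrite mulr_sumr; apply: eq_bigr => y _; ring.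
have [->|cx] := eqVneq (c x) 0%N; first by rewrite mul0r.
apply: mulr_ge0_le0; first by lia.
rewrite (bigD1 x) //= diagM.
have {}aff := aff x cx.
suff : \sum_(i | i != x) M x i * (c i)%:Z <= - (\sum_(y | e x y) c y)%N%:Z.
  by move: aff; move: (\sum_(y | e x y) c y)%N (\sum_(i | i != x) _) => a b; lia.
rewrite (bigID (e x)) /= [X in _ + X]big1 ?addr0; last first.
  by move=> y /andP[yx nex]; rewrite linkE 1?eq_sym // (negbTE nex) mul0r.
rewrite -natz natr_sum -sumrN /=.
rewrite (eq_bigl (e x)) => [|y]; last first.
  by apply/andP/idP => [[]//|exy]; rewrite eq_sym link_neq.
by apply: ler_sum => y /eqP->; rewrite natz; lia.
Qed.

Lemma no_affine (x0 : V) (l : seq V) (w : nat -> nat) (nb : nat -> seq nat) :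
  uniq l -> (exists2 k, k < size l & w k != 0)%N ->
  (forall k, k < size l -> [/\ uniq (nb k),
     forall j, j \in nb k -> (j < size l) && e (nth x0 l k) (nth x0 l j)
     & 2 * w k <= \sum_(j <- nb k) w j])%N -> False.
Proof.
move=> ul [k0 k0l wk0] H.
pose c x := if x \in l then w (index x l) else 0%N.
have cE k : (k < size l)%N -> c (nth x0 l k) = w k.
  by move=> kl; rewrite /c mem_nth // index_uniq.
apply: (@no_affine_weight c); first by exists (nth x0 l k0); rewrite cE.
move=> x; rewrite {1}/c; case: ifP => // xl _.
rewrite -[x](nth_index x0 xl); have kl : (index x l < size l)%N by rewrite index_mem.
move: (index x l) kl => k kl; rewrite cE //; have [ub lb wb] := H k kl.
apply: leq_trans wb _; pose s := [seq nth x0 l j | j <- nb k].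
have us : uniq s.
  rewrite map_inj_in_uniq // => i j /lb/andP[il _] /lb/andP[jl _] /eqP.
  by rewrite nth_uniq // => /eqP.
rewrite [X in (X <= _)%N](_ : _ = \sum_(y <- s) c y)%N; last first.
  rewrite big_map big_seq [RHS]big_seq; apply: eq_bigr => j /lb/andP[jl _].
  by rewrite cE.
rewrite (big_uniq _ us) /= big_mkcond [X in (_ <= X)%N]big_mkcond /=.
apply: leq_sum => y _; case: ifP => // /mapP[j /lb/andP[_ ej] ->].
by rewrite ej.
Qed.

Let chain (q : seq V) := sorted e q.

Lemma chainP x0 q i : chain q -> (i.+1 < size q)%N -> e (nth x0 q i) (nth x0 q i.+1).
Proof. by move=> /(sortedP x0); apply. Qed.

(** The diagram A~, with all weights equal to 1. *)
Lemma no_cycle x0 q : uniq q -> chain q -> (2 < size q)%N ->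
  e (nth x0 q 0) (nth x0 q (size q).-1) -> False.
Proof.
move=> uq cq sq eq0.
pose nb (k : nat) : seq nat := if k == 0%N then [:: 1; (size q).-1]%N
   else if k == (size q).-1 then [:: 0; k.-1]%N else [:: k.-1; k.+1]%N.
apply: (@no_affine x0 q (fun=> 1%N) nb uq); first by exists 0%N => //; apply: leq_trans sq.
move=> k kq; rewrite /nb; case: ifP => [/eqP->|k0].
- split; rewrite ?big_cons ?big_nil ?addn0 //= ?inE; first by slia.
  move=> j; rewrite !inE => /orP[]/eqP->; last by rewrite eq0 andbT; slia.
  by rewrite (chainP x0 cq) ?andbT; slia.
- case: ifP => [/eqP kE|kn].
    split; rewrite ?big_cons ?big_nil ?addn0 //= ?inE; first by slia.
    move=> j; rewrite !inE => /orP[]/eqP->; first by rewrite kE link_sym eq0 andbT; slia.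
    have := @chainP x0 q k.-1 cq; rewrite prednK ?lt0n ?k0 // => /(_ kq).
    by rewrite link_sym => ->; slia.
  split; rewrite ?big_cons ?big_nil ?addn0 //= ?inE; first by slia.
  move=> j; rewrite !inE => /orP[]/eqP->; last by rewrite (chainP x0 cq) ?andbT; slia.
  have := @chainP x0 q k.-1 cq; rewrite prednK ?lt0n ?k0 // => /(_ kq).
  by rewrite link_sym => ->; slia.
Qed.

Let link k j (a b : nat) := ((k == a) && (j == b)) || ((k == b) && (j == a)).

(** For a diagram of fixed size the condition on the weights w is a computation
    with the list E of its edges. *)
Lemma no_affine_list x0 (l : seq V) (w : seq nat) (E : seq (nat * nat)) :
  uniq l -> size w = size l ->
  all (fun ab => [&& ab.1 < size l, ab.2 < size l
                   & e (nth x0 l ab.1) (nth x0 l ab.2)])%N E ->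
  [&& nth 0 w 0 != 0, 0 < size w & all (fun k =>
      2 * nth 0 w k <= sumn [seq nth 0 w j | j <- iota 0 (size w)
                     & has (fun ab => link k j ab.1 ab.2) E])%N
    (iota 0 (size w))]%N -> False.
Proof.
move=> ul sw /allP lE /and3P[w0 sw0 /allP lw].
apply: (@no_affine x0 l (nth 0%N w)
  (fun k => [seq j <- iota 0 (size w) | has (fun ab => link k j ab.1 ab.2) E])) => //.
  by exists 0%N; rewrite -?sw.
move=> k kl; split; first by rewrite filter_uniq ?iota_uniq.
  move=> j; rewrite mem_filter => /andP[/hasP[[a b] /lE/= /and3P[al bl ab]]].
  by case/orP=> /andP[/eqP-> /eqP->] _; rewrite ?al ?bl //= link_sym.
by have := lw k; rewrite sumnE big_map mem_iota sw => /(_ kl).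
Qed.

(** The diagram D~, with weight 2 on the inner vertices of the chain. *)
Lemma no_double_fork x0 q v v' : uniq [:: v, v' & q] -> chain q -> (2 < size q)%N ->
  e v (nth x0 q 1) -> e v' (nth x0 q (size q).-2) -> False.
Proof.
move=> uq cq sq ev ev'.
pose m := size q.
pose w (k : nat) : nat := (if [|| k == 0, k == 1, k == 2 | k == m.+1] then 1 else 2)%N.
pose nb (k : nat) : seq nat := (if k == 0 then [:: 3] else if k == 1 then [:: m] else
  if k == 2 then [:: 3] else if k == m.+1 then [:: m] else
  (if k == 3 then [:: 0] else [::]) ++ (if k == m then [:: 1] else [::])
  ++ [:: k.-1; k.+1])%N.
apply: (@no_affine x0 [:: v, v' & q] w nb uq); first by exists 0%N.
have cq' k : (1 < k)%N -> (k <= m)%N ->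
    e (nth x0 [:: v, v' & q] k) (nth x0 [:: v, v' & q] k.+1).
  by case: k => [|[|k]] //= _ km; apply: chainP.
have evk : e v (nth x0 [:: v, v' & q] 3) by [].
have evk' : e v' (nth x0 [:: v, v' & q] m).
  by rewrite (_ : m = m.-2.+2) //; rewrite /m; slia.
have ms : size [:: v, v' & q] = m.+2 by [].
have m3 : (2 < m)%N by [].
have inner j : (2 < j <= m)%N -> w j = 2%N by move=> jm; rewrite /w; case: ifP; lia.
move=> k; rewrite ms => km.
have leaf j : nb k = [:: j] -> w k = 1%N -> (2 < j <= m)%N ->
    e (nth x0 [:: v, v' & q] k) (nth x0 [:: v, v' & q] j) ->
    [/\ uniq (nb k), forall j, j \in nb k -> (j < m.+2)%N &&
      e (nth x0 [:: v, v' & q] k) (nth x0 [:: v, v' & q] j)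
      & (2 * w k <= \sum_(j <- nb k) w j)%N].
  move=> -> -> jm ekj; split=> //; last by rewrite big_seq1 inner.
  by move=> i; rewrite inE => /eqP->; rewrite ekj andbT; lia.
have [k0|k0] := eqVneq k 0%N; first by apply: (leaf 3%N); rewrite ?k0 //; lia.
have [k1|k1] := eqVneq k 1%N; first by apply: (leaf m); rewrite ?k1 //; lia.
have [k2|k2] := eqVneq k 2%N.
  by apply: (leaf 3%N); rewrite ?k2 // ?cq'; lia.
have [kE|kn] := eqVneq k m.+1.
  apply: (leaf m); [| |lia|by rewrite kE link_sym cq'; lia].
    by rewrite /nb (negbTE k0) (negbTE k1) (negbTE k2) kE eqxx.
  by rewrite /w kE eqxx !orbT.
have nbE : (nb k = (if k == 3 then [:: 0] else [::])
  ++ (if k == m then [:: 1] else [::]) ++ [:: k.-1; k.+1])%N.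
  by rewrite /nb (negbTE k0) (negbTE k1) (negbTE k2) (negbTE kn).
rewrite nbE; split.
- by case: ifP; case: ifP => /=; rewrite ?inE; slia.
- move=> j; rewrite !mem_cat => /or3P[].
  + case: ifP => // /eqP kE; rewrite inE => /eqP->; rewrite kE link_sym evk; slia.
  + case: ifP => // /eqP kE; rewrite inE => /eqP->; rewrite kE link_sym evk'; slia.
  + rewrite !inE => /orP[]/eqP->; last by rewrite cq' ?andbT; slia.
    have := cq' k.-1; rewrite link_sym prednK ?lt0n // => -> //; slia.
- rewrite inner; last by lia.
  rewrite !big_cat /= !big_cons big_nil.
  have w1 j : (1 <= w j)%N by rewrite /w; case: ifP.
  have := w1 0%N; have := w1 1%N; have := w1 k.-1; have := w1 k.+1.
  case: eqP => k3; case: eqP => kM; rewrite ?big_seq1 ?big_nil; try lia.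
  + by have := inner k.+1; lia.
  + by have := inner k.-1; lia.
  + by have := inner k.+1; have := inner k.-1; lia.
Qed.

(** The diagram E~6, with arms v v' and the two halves of q. *)
Lemma no_E6 x0 q v v' : uniq [:: v, v' & q] -> chain q -> size q = 5 ->
  e v (nth x0 q 2) -> e v v' -> False.
Proof.
move=> uq cq sq ev ev'.
by apply: (@no_affine_list x0 [:: v, v' & q] [:: 2; 1; 1; 2; 3; 2; 1]
  [:: (0, 1); (0, 4); (2, 3); (3, 4); (4, 5); (5, 6)]) => //=;
  rewrite sq // /= ?ev ?ev' !(@chainP x0) ?sq.
Qed.

(** The diagram E~7, with v attached to the middle of q. *)
Lemma no_E7 x0 q v : uniq (v :: q) -> chain q -> size q = 7 ->
  e v (nth x0 q 3) -> False.
Proof.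
move=> uq cq sq ev.
by apply: (@no_affine_list x0 (v :: q) [:: 2; 1; 2; 3; 4; 3; 2; 1]
  [:: (0, 4); (1, 2); (2, 3); (3, 4); (4, 5); (5, 6); (6, 7)]) => //=;
  rewrite sq // /= ?ev !(@chainP x0) ?sq.
Qed.

(** The diagram E~8, with arms of lengths 1, 2 and 5 at the third vertex of q. *)
Lemma no_E8 x0 q v : uniq (v :: q) -> chain q -> size q = 8 ->
  e v (nth x0 q 2) -> False.
Proof.
move=> uq cq sq ev.
by apply: (@no_affine_list x0 (v :: q) [:: 3; 2; 4; 6; 5; 4; 3; 2; 1]
  [:: (0, 3); (1, 2); (2, 3); (3, 4); (4, 5); (5, 6); (6, 7); (7, 8)]) => //=;
  rewrite sq // /= ?ev !(@chainP x0) ?sq.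
Qed.

End AffineDiagrams.

Lemma longest_chain (V : finType) (e : rel V) :
  exists p : seq V, [/\ uniq p, sorted e p &
    forall q, uniq q -> sorted e q -> (size q <= size p)%N].
Proof.
pose P m := [exists t : m.-tuple V, uniq t && sorted e t].
have exP : exists m, P m by exists 0%N; apply/existsP; exists [tuple].
have boundP m : P m -> (m <= #|V|)%N.
  case/existsP=> t /andP[ut _]; rewrite -(size_tuple t).
  by rewrite -(card_uniqP ut) max_card.
case: (ex_maxnP exP boundP) => m /existsP[t /andP[ut st]] maxm.
exists t; split=> // q uq sq; rewrite size_tuple; apply: maxm.
by apply/existsP; exists (in_tuple q); rewrite uq sq.
Qed.

Definition segment (V : Type) (p : seq V) i j := take (j - i).+1 (drop i p).

Lemma size_segment (V : Type) (p : seq V) i j :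
  (i <= j < size p)%N -> size (segment p i j) = (j - i).+1.
Proof. by move=> ij; rewrite size_takel // size_drop; slia. Qed.

Lemma nth_segment (V : Type) x0 (p : seq V) i j k :
  (k <= j - i)%N -> nth x0 (segment p i j) k = nth x0 p (i + k).
Proof. by move=> kj; rewrite nth_take ?ltnS // nth_drop. Qed.

Lemma segment_uniq (V : eqType) (p : seq V) i j : uniq p -> uniq (segment p i j).
Proof. by move=> up; apply/take_uniq/drop_uniq. Qed.

Lemma mem_segment (V : eqType) (p : seq V) i j x : x \in segment p i j -> x \in p.
Proof. by move=> /mem_take/mem_drop. Qed.

Lemma segment_sorted (V : eqType) (e : rel V) (p : seq V) i j :
  sorted e p -> sorted e (segment p i j).
Proof. by move=> sp; apply/take_sorted/drop_sorted. Qed.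

Lemma sorted_cons (V : eqType) (e : rel V) x0 (p : seq V) v :
  sorted e p -> (0 < size p)%N -> e v (nth x0 p 0) -> sorted e (v :: p).
Proof. by case: p => //= y p -> _ ->. Qed.

(** The Gram matrix of a Dynkin diagram on 0, ..., n - 1: the vertices
    1, ..., n - 1 form a path, and 0 is attached to the vertex k + 1. The diagram
    is A, D or E according as k is 0, 1 or 2. *)
Definition cart_link (k i j : nat) : bool :=
  ((i == 0) && (j == k.+1) || (0 < i) && (j == i.+1))%N.

Definition cart (k i j : nat) : int :=
  if i == j then 2 else if cart_link k i j || cart_link k j i then -1 else 0.

Section Classification.
Variables (V : finType) (M : V -> V -> int).
Hypotheses (rM : root_gram M) (obM : forall x y, x != y -> M x y <= 0).
Hypothesis cM : gconn M.

Let e x y := M x y == -1.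

Let e_sym : symmetric e.
Proof. exact: link_sym. Qed.

Variable (x0 : V) (p : seq V).
Hypotheses (up : uniq p) (sp : sorted e p).
Hypothesis maxp : forall q, uniq q -> sorted e q -> (size q <= size p)%N.

Let p_gt0 : (0 < size p)%N.
Proof. exact: (@maxp [:: x0]). Qed.

Let p_step i : (i.+1 < size p)%N -> e (nth x0 p i) (nth x0 p i.+1).
Proof. by move: sp => /(sortedP x0); apply. Qed.

(** A chord would close a cycle. *)
Lemma chord_free i j : (i.+1 < j < size p)%N -> e (nth x0 p i) (nth x0 p j) = false.
Proof.
move=> ij; apply/negP => eij; have sz : size (segment p i j) = (j - i).+1.
  by apply: size_segment; slia.
apply: (@no_cycle _ _ rM obM x0 (segment p i j)).
- exact: segment_uniq.
- exact: segment_sorted.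
- by rewrite sz; slia.
- by rewrite sz nth_segment // nth_segment // addn0 subnKC //; slia.
Qed.

Lemma chain_link i j : (i < size p)%N -> (j < size p)%N ->
  e (nth x0 p i) (nth x0 p j) = (j == i.+1) || (i == j.+1).
Proof.
move=> ip jp; have [[ij|ij]|ij] : ((i.+1 < j)%N \/ (j.+1 < i)%N) \/
    (j = i.+1 \/ i = j.+1 \/ i = j) by slia.
- by rewrite chord_free; slia.
- by rewrite e_sym chord_free; slia.
- case: ij => [ij|[ij|ij]].
  + by rewrite ij eqxx p_step -?ij.
  + by rewrite ij eqxx orbT e_sym p_step -?ij.
  + by rewrite ij /e; case: rM => _ -> _; slia.
Qed.

(** A vertex adjacent to an end would prolong the longest path. *)
Lemma end_free v : v \notin p ->
  (e v (nth x0 p 0) = false) * (e v (nth x0 p (size p).-1) = false).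
Proof.
move=> vp; split; apply/negP => ev.
  suff : (size (v :: p) <= size p)%N by rewrite /= ltnn.
  by apply: maxp; rewrite /= ?vp //; apply: sorted_cons ev.
suff : (size (rcons p v) <= size p)%N by rewrite size_rcons ltnn.
apply: maxp; rewrite ?rcons_uniq ?vp //.
case: (p) sp ev => //= y q yq; rewrite rcons_path yq /=.
by rewrite -[size q]/(size (y :: q)).-1 nth_last e_sym.
Qed.

Lemma attached_once v i j : v \notin p -> (i < size p)%N -> (j < size p)%N ->
  e v (nth x0 p i) -> e v (nth x0 p j) -> i = j.
Proof.
move=> vp; wlog ij : i j / (i < j)%N => [H ip jp ei ej|].
  have [|ij] := eqVneq i j => //; have [lij|lji] : (i < j)%N \/ (j < i)%N by slia.
    exact: H.
  by symmetry; apply: H.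
move=> ip jp ei ej; exfalso.
have sz : size (segment p i j) = (j - i).+1 by apply: size_segment; slia.
apply: (@no_cycle _ _ rM obM x0 (v :: segment p i j)).
- by rewrite /= segment_uniq // andbT; apply: contra vp => /mem_segment.
- apply: (sorted_cons (x0 := x0)); rewrite ?sz ?segment_sorted //.
  by rewrite nth_segment ?addn0.
- by rewrite /= sz; slia.
- rewrite /= sz /= nth_segment ?subnKC //; slia.
Qed.

(** Two vertices outside the path would form a diagram D~ with the part of the
    path between their neighbours, extended by one vertex on each side. *)
Lemma fork_unique v j u i : v \notin p -> u \notin p -> u != v ->
  (j < size p)%N -> (i < size p)%N -> (j <= i)%N ->
  e v (nth x0 p j) -> e u (nth x0 p i) -> False.
Proof.
move=> vp unp nuv jp ip ji ev eu.
have j0 : (0 < j)%N.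
  by case: j ev {jp ji} => //; rewrite end_free.
have iS : (i.+1 < size p)%N.
  case: (ltnP i.+1 (size p)) => // pi; have iE : i = (size p).-1 by slia.
  by move: eu; rewrite iE end_free.
have sz : size (segment p j.-1 i.+1) = (i - j).+3.
  by rewrite size_segment; slia.
apply: (@no_double_fork _ _ rM obM x0 (segment p j.-1 i.+1) v u).
- rewrite /= segment_uniq // andbT inE eq_sym negb_or nuv /=.
  by apply/andP; split; [apply: contra vp|apply: contra unp] => /mem_segment.
- exact: segment_sorted.
- by rewrite sz.
- by rewrite nth_segment ?addn1 ?prednK //; slia.
- by rewrite sz nth_segment /=; [rewrite (_ : _ + _ = i)%N //|]; slia.
Qed.

(** The bound on j says that the arm of the path before the vertex j is not the
    longer one; it has length 1, or length 2 with few vertices in all, because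
    otherwise a diagram E~ is found. *)
Lemma fork_classification v j : v \notin p -> (j < size p)%N ->
  e v (nth x0 p j) -> (j + j < size p)%N ->
  [/\ uniq (v :: p), forall x, x \in v :: p,
      forall a b, (a < size (v :: p))%N -> (b < size (v :: p))%N ->
        M (nth x0 (v :: p) a) (nth x0 (v :: p) b) = cart j a b
    & (j == 1) || ((j == 2) && (6 <= size (v :: p) <= 8))]%N.
Proof.
move=> vp jp ev jj.
have j0 : (0 < j)%N by case: (j) ev => //; rewrite end_free.
have uvp : uniq (v :: p) by rewrite /= vp.
split=> //.
- move=> x; apply/idPn => xvp.
  have [a [u [/= avp uvp' mau]]] := connect_crossing (cM v x) (mem_head v p) xvp.
  have nau : a != u by apply: contraNneq uvp' => <-.
  have {mau} : e a u by move: mau; rewrite (linkE rM obM nau) /e; case: ifP.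
  move: uvp'; rewrite inE negb_or => /andP[nuv up'].
  have [-> evu|nav eau] := eqVneq a v.
    (* The path u, v, p_j, ... shows that the arms at p_j have length at least 2. *)
    have j2 : (2 <= j)%N.
      have : (size [:: u, v & segment p j (size p).-1] <= size p)%N.
        apply: maxp.
          rewrite /= inE negb_or nuv segment_uniq // andbT /=.
          by apply/andP; split; [apply: contra up'|apply: contra vp] => /mem_segment.
        apply: (sorted_cons (x0 := x0)) => //=; last by rewrite e_sym.
        apply: (sorted_cons (x0 := x0)); first exact: segment_sorted.
          by rewrite size_segment; clear - jp j0 jj; slia.
        by rewrite nth_segment ?addn0.
      by rewrite /= size_segment; clear - jp j0 jj; slia.
    have sz : size (segment p j.-2 j.+2) = 5.
      by rewrite size_segment; clear - jj j2; slia.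
    apply: (@no_E6 _ _ rM obM x0 (segment p j.-2 j.+2) v u) => //.
    + rewrite /= segment_uniq // andbT inE eq_sym negb_or nuv /=.
      by apply/andP; split; [apply: contra vp|apply: contra up'] => /mem_segment.
    + exact: segment_sorted.
    + by rewrite nth_segment; [rewrite (_ : _ + _ = j)%N //|]; clear - jj j2; slia.
  move: avp; rewrite inE (negbTE nav) => ap.
  have ip : (index a p < size p)%N by rewrite index_mem.
  move: eau; rewrite -(nth_index x0 ap) e_sym; move: (index a p) ip => i ip eui.
  have [ji|ij] := leqP j i; first exact: (fork_unique vp up' nuv jp ip ji ev eui).
  by apply: (fork_unique up' vp _ ip jp (ltnW ij) eui ev); rewrite eq_sym.
- have vE i : (i < size p)%N -> e v (nth x0 p i) = (i == j).
    move=> ip; apply/idP/eqP => [ei|->//].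
    exact: attached_once vp ip jp ei ev.
  move=> a b ap bp; rewrite /cart; have [->|nab] := eqVneq a b.
    by case: rM => _ -> _.
  rewrite (linkE rM obM) ?nth_uniq // -/(e _ _); congr (if _ then _ else _).
  case: a b ap bp nab => [|a] [|b] //= ap bp nab.
  + by rewrite vE // /cart_link /=; slia.
  + by rewrite e_sym vE // /cart_link /=; slia.
  + by rewrite chain_link // /cart_link /=; slia.
- have [j1|[j2|j3]] : j = 1%N \/ (j = 2%N \/ (2 < j)%N) by slia.
  + by rewrite j1.
  + rewrite j2 /=; have [|p8] := leqP (size p) 7; first by move: jj; rewrite j2; slia.
    exfalso; have sz : size (segment p 0 7) = 8 by rewrite size_segment; slia.
    apply: (@no_E8 _ _ rM obM x0 (segment p 0 7) v) => //.
    * by rewrite /= segment_uniq // andbT; apply: contra vp => /mem_segment.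
    * exact: segment_sorted.
    * by rewrite nth_segment // add0n -j2.
  + exfalso; have sz : size (segment p (j - 3) (j + 3)) = 7.
      by rewrite size_segment; slia.
    apply: (@no_E7 _ _ rM obM x0 (segment p (j - 3) (j + 3)) v) => //.
    * by rewrite /= segment_uniq // andbT; apply: contra vp => /mem_segment.
    * exact: segment_sorted.
    * by rewrite nth_segment; [rewrite subnK|lia].
Qed.

End Classification.

(** Connected obtuse bases are Dynkin diagrams. In a longest path no vertex has a
    further neighbour in the path, at most one vertex lies outside, and it is
    attached to a single vertex of the path. *)
Theorem obtuse_classification (V : finType) (M : V -> V -> int) (x0 : V) :
  root_gram M -> (forall x y, x != y -> M x y <= 0) -> gconn M ->
  exists k (l : seq V), [/\ uniq l, forall x, x \in l,
      forall a b, (a < size l)%N -> (b < size l)%N ->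
        M (nth x0 l a) (nth x0 l b) = cart k a b
    & (k < 2) || ((k == 2) && (6 <= size l <= 8))]%N.
Proof.
move=> rM obM cM; pose e x y := M x y == -1.
have [p [up sp maxp]] := longest_chain e.
have [pV|/forallPn/= [y]] := boolP [forall x, x \in p].
  exists 0%N, p; split=> //; first exact/forallP.
  move=> a b ap bp; rewrite /cart; have [->|nab] := eqVneq a b.
    by case: rM => _ -> _.
  rewrite (linkE rM obM) ?nth_uniq // -/(e _ _); congr (if _ then _ else _).
  by rewrite [LHS](chain_link rM obM x0 up sp) // /cart_link; slia.
move=> yp; have p_gt0 : (0 < size p)%N by apply: (@maxp [:: x0]).
have [a [v [/= ap vp mav]]] := connect_crossing (cM (nth x0 p 0) y) (mem_nth x0 p_gt0) yp.
have nav : a != v by apply: contraNneq vp => <-.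
have eva : e v a.
  by rewrite /e link_sym //; move: mav; rewrite (linkE rM obM nav) /e; case: ifP.
have jp : (index a p < size p)%N by rewrite index_mem.
move: eva; rewrite -(nth_index x0 ap); move: (index a p) jp => j jp ev.
have [jj|jj] := ltnP (j + j) (size p).
  have [? ? ? kE] := fork_classification rM obM cM up sp maxp vp jp ev jj.
  exists j, (v :: p); split=> //.
  by move: kE => /orP[/eqP->|->] //; rewrite orbT.
have srp : sorted e (rev p).
  by rewrite rev_sorted (eq_sorted (e' := e)) // => b c; apply: link_sym.
have jr : ((size p).-1 - j < size (rev p))%N by rewrite size_rev; slia.
have maxr q : uniq q -> sorted e q -> (size q <= size (rev p))%N.
  by rewrite size_rev; apply: maxp.
have evr : e v (nth x0 (rev p) ((size p).-1 - j)).
  rewrite nth_rev; last by slia.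
  by rewrite (_ : (_ - _)%N = j) //; slia.
have [] := fork_classification rM obM cM _ srp maxr _ jr evr _.
- by rewrite rev_uniq.
- by rewrite mem_rev.
- by rewrite size_rev; slia.
move=> u1 u2 u3 kE; exists ((size p).-1 - j)%N, (v :: rev p); split=> //.
by move: kE => /orP[/eqP->|->] //; rewrite orbT.
Qed.

Lemma sum_ord_delta n i (F : nat -> int) : (i < n)%N ->
  \sum_(t < n) (i == t)%:R * F t = F i.
Proof.
move=> ni; rewrite (bigD1 (Ordinal ni)) //= eqxx mul1r big1 ?addr0 // => t.
by rewrite -val_eqE /= eq_sym => /negbTE->; rewrite mul0r.
Qed.

(** The diagrams A and D are realized by the vectors e_i - e_(i+1); the extra
    vertex is e_0 - e_1 for A and - e_1 - e_2 for D. *)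
Lemma cart_has_rep n k : (k < 2)%N ->
  has_rep (fun i j : 'I_n => cart k i j).
Proof.
move=> k2; pose f (i : nat) : nat := if (i == 0%N) && (k == 1%N) then 1%N else i.
pose g (i : nat) : nat := if (i == 0%N) && (k == 1%N) then 2%N else i.+1.
pose s (i : nat) : int := if (i == 0%N) && (k == 1%N) then -1 else 1.
pose c (i t : nat) : int := s i * (f i == t)%:R - (g i == t)%:R.
exists n.+3, (fun i : 'I_n => \row_t c i t) => i j.
have fn (a : 'I_n) : (f a < n.+3)%N by rewrite /f; case: ifP => _ //; have := ltn_ord a; slia.
have gn (a : 'I_n) : (g a < n.+3)%N by rewrite /g; case: ifP => _ //; have := ltn_ord a; slia.
transitivity (s i * c j (f i) - c j (g i)).
  rewrite -(sum_ord_delta _ (fn i)) -(sum_ord_delta _ (gn i)) mulr_sumr -sumrB.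
  by apply: eq_bigr => t _; rewrite !mxE {1}/c; ring.
rewrite /c /cart /cart_link /s /f /g.
move: (nat_of_ord i) (nat_of_ord j) => {i j fn gn} i j.
case: k k2 {f g s c} => [|[|k]] // _; rewrite ?andbF ?andbT !natz.
  by do ?case: ifP; lia.
by case: i j => [|i] [|j] /=; do ?case: ifP; lia.
Qed.

(** Moves turn every connected root basis into an obtuse one, which is a Dynkin
    diagram. *)
Theorem dynkin_type (V : finType) (M : V -> V -> int) n :
  #|V| = n -> (0 < n)%N -> root_gram M -> gconn M ->
  exists k N, [/\ mvs M N, signed_iso (fun i j : 'I_n => cart k i j) N
                & (k < 2) || ((k == 2) && (6 <= n <= 8))]%N.
Proof.
move=> Vn n0 rM cM; have [x0 _] : exists x : V, x \in V.
  by apply/card_gt0P; rewrite Vn.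
have [N MN obN] := exists_obtuse rM.
have rN := mvs_root_gram MN rM; have cN := mvs_gconn MN rM cM.
have [k [l [ul lV lN kE]]] := obtuse_classification x0 rN obN cN.
have sl : size l = n.
  by rewrite -Vn -(card_uniqP ul); apply: eq_card => x; rewrite lV.
have lt (i : 'I_n) : (i < size l)%N by rewrite sl.
exists k, N; split=> //; last by rewrite -sl.
exists (fun i : 'I_n => nth x0 l i), (fun=> false); split; last first.
  by move=> i j; rewrite lN ?lt // !mul1r.
apply: inj_card_bij; last by rewrite card_ord Vn.
by move=> i j /eqP; rewrite nth_uniq ?lt // => /eqP/val_inj.
Qed.

(** Moves preserve integral representations, in both directions. *)
Lemma dynkin_has_rep (V : finType) (M N : V -> V -> int) n k :
  root_gram M -> mvs M N -> signed_iso (fun i j : 'I_n => cart k i j) N ->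
  (k < 2)%N -> has_rep M.
Proof.
move=> rM MN iso k2.
apply: (mvs_ind_rev MN (P := @has_rep V)) => // [K i j _ _|K L KL|].
- exact: has_rep_mv.
- by apply: has_rep_signed_iso; apply: signed_iso_ext.
- exact: has_rep_signed_iso (signed_iso_sym iso) (cart_has_rep n k2).
Qed.

(** * Integral vectors and the diagrams E *)

(** An integer is at most its square, so a sum of squares equal to 2 has exactly
    two nonzero terms. *)
Lemma norm2P (K : finType) (f : K -> int) : \sum_k f k * f k = 2 ->
  exists a b, [/\ a != b, f a = 1 \/ f a = -1, f b = 1 \/ f b = -1
                & forall k, k != a -> k != b -> f k = 0].
Proof.
move=> f2; have sq0 k : 0 <= f k * f k by nia.
have [a fa] : exists a, f a != 0.
  apply/existsP; apply: contra_eqT f2 => /existsPn f0.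
  by rewrite big1 // => k _; have := f0 k; rewrite negbK => /eqP->.
have fle k : f k * f k <= 2.
  by rewrite -f2 (bigD1 k) //= lerDl sumr_ge0.
have f1 k : f k != 0 -> f k = 1 \/ f k = -1 by have := fle k; nia.
have fa1 : f a * f a = 1 by have := f1 a fa; nia.
move: f2; rewrite (bigD1 a) //= fa1 => f2.
have {}f2 : \sum_(k | k != a) f k * f k = 1 by apply: (addrI 1); rewrite f2.
have [b /andP[nba fb]] : exists b, (b != a) && (f b != 0).
  apply/existsP; apply: contra_eqT f2 => /existsPn f0.
  by rewrite big1 // => k ka; have := f0 k; rewrite ka negbK => /eqP->.
exists a, b; split; [by rewrite eq_sym|exact: f1|exact: f1|].
move=> k ka kb; move: f2; rewrite (bigD1 b) //= (bigD1 k) ?ka //=.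
set s := \sum_(_ | _) _; have s0 : 0 <= s by apply: sumr_ge0.
by have := f1 b fb; have := sq0 k; nia.
Qed.

(** Two orthogonal roots of the integral lattice that share a coordinate have the
    same support, so they agree modulo 2. *)
Lemma orthogonal_roots_even (K : finType) (f g : K -> int) a :
  \sum_k f k * f k = 2 -> \sum_k g k * g k = 2 -> \sum_k f k * g k = 0 ->
  f a != 0 -> g a != 0 -> forall k, exists h, f k + g k = 2 * h.
Proof.
have other (u : K -> int) : \sum_k u k * u k = 2 -> u a != 0 ->
    exists c, [/\ c != a, u a = 1 \/ u a = -1, u c = 1 \/ u c = -1
             & forall k, k != a -> k != c -> u k = 0].
  move=> /norm2P[x [y [nxy ux uy u0]]] ua.
  have [ax|nax] := eqVneq a x; first by exists y; rewrite ax; split; rewrite // eq_sym.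
  have [ay|nay] := eqVneq a y; first by exists x; rewrite ay; split=> // k ky kx; apply: u0.
  by case/eqP: ua; apply: u0.
move=> f2 g2 fg0 fa ga.
have [c [nca fa1 fc1 f0]] := other f f2 fa.
have [d [nda ga1 gd1 g0]] := other g g2 ga.
have cd : c = d.
  apply/eqP; apply: contra_eqT fg0 => ncd.
  rewrite (bigD1 a) //= big1 ?addr0 => [|k ka]; first by nia.
  have [->|kc] := eqVneq k c; first by rewrite (g0 c) // mulr0.
  by rewrite (f0 k) // mul0r.
subst d => k; have [->|ka] := eqVneq k a.
  have [E|[E|E]] : f a + g a = 2 \/ (f a + g a = 0 \/ f a + g a = -2) by lia.
  - by exists 1.
  - by exists 0.
  - by exists (-1).
have [->|kc] := eqVneq k c.
  have [E|[E|E]] : f c + g c = 2 \/ (f c + g c = 0 \/ f c + g c = -2) by lia.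
  - by exists 1.
  - by exists 0.
  - by exists (-1).
by exists 0; rewrite f0 // g0.
Qed.

Lemma even_no_odd (K : finType) (f g h : K -> int) :
  (forall k, exists r, f k + g k = 2 * r) ->
  \sum_k f k * h k = -1 -> \sum_k g k * h k = 0 -> False.
Proof.
move=> fg; have : exists r : K -> int, forall k, f k + g k = 2 * r k.
  exists (fun k => ((f k + g k) %/ 2)%Z) => k.
  by have [r ->] := fg k; rewrite mulKz.
case=> r rE f1 g0.
have : \sum_k (f k + g k) * h k = -1.
  transitivity (\sum_k f k * h k + \sum_k g k * h k); last by rewrite f1 g0.
  by rewrite -big_split; apply: eq_bigr => k _; rewrite mulrDl.
have -> : \sum_k (f k + g k) * h k = 2 * \sum_k r k * h k.
  by rewrite mulr_sumr; apply: eq_bigr => k _; rewrite rE mulrA.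
move: (\sum_k _) => S; lia.
Qed.

(** The three neighbours of the branch vertex each share exactly one of its two
    coordinates, so two of them, at least one of which starts an arm of length 2,
    agree modulo 2; the next vertex on that arm distinguishes them. *)
Lemma E_no_rep n : (5 < n)%N -> ~ has_rep (fun i j : 'I_n => cart 2 i j).
Proof.
move=> n5 [m [phi phiE]].
have lt k : (k < 6)%N -> (k < n)%N by move=> k6; apply: leq_trans k6 n5.
pose v k (k6 : (k < 6)%N) : 'I_n := Ordinal (lt k k6).
pose f (k : nat) (t : 'I_m) : int := if insub k is Some i then phi i 0 t else 0.
have fE i j : (i < 6)%N -> (j < 6)%N -> \sum_t f i t * f j t = cart 2 i j.
  move=> i6 j6; rewrite -(phiE (v i i6) (v j j6)); apply: eq_bigr => t _.
  by rewrite /f !insubT ?lt // => ? ?; congr (phi _ _ _ * phi _ _ _); apply: val_inj.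
have [a [b [_ fa fb f0]]] := norm2P (fE 3 3 isT isT).
have nbr i : (i < 6)%N -> cart 2 i 3 = -1 -> (f i a != 0) || (f i b != 0).
  move=> i6 i3; rewrite -negb_and; apply/negP => /andP[/eqP fia /eqP fib].
  have := fE i 3%N i6 isT; rewrite i3 big1 // => t _.
  have [->|ta] := eqVneq t a; first by rewrite fia mul0r.
  have [->|tb] := eqVneq t b; first by rewrite fib mul0r.
  by rewrite (f0 t) // mulr0.
have no i j k c : (i < 6)%N -> (j < 6)%N -> (k < 6)%N -> cart 2 i i = 2 -> cart 2 j j = 2 ->
    cart 2 i j = 0 -> cart 2 i k = -1 -> cart 2 j k = 0 ->
    f i c != 0 -> f j c != 0 -> False.
  move=> i6 j6 k6 ii jj ij ik jk fic fjc.
  apply: (@even_no_odd _ (f i) (f j) (f k)); rewrite ?fE //.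
  by apply: (@orthogonal_roots_even _ _ _ c); rewrite ?fE.
have no20 c : f 2%N c != 0 -> f 0%N c != 0 -> False by apply: (no 2 0 1)%N.
have no40 c : f 4%N c != 0 -> f 0%N c != 0 -> False by apply: (no 4 0 5)%N.
have no24 c : f 2%N c != 0 -> f 4%N c != 0 -> False by apply: (no 2 4 1)%N.
case/orP: (nbr 0%N isT erefl) => f0c; case/orP: (nbr 2 isT erefl) => f2c;
  case/orP: (nbr 4 isT erefl) => f4c;
  by [apply: no20 f2c f0c | apply: no40 f4c f0c | apply: no24 f2c f4c].
Qed.

Lemma E_gconn n : (3 < n)%N -> gconn (fun i j : 'I_n => cart 2 i j).
Proof.
case: n => // n n3; pose e (i j : 'I_n.+1) := cart 2 i j != 0.
change (forall i j, connect e i j).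
have esym : connect_sym e.
  by apply: sym_connect_sym => i j; rewrite /e /cart [(i : nat) == j]eq_sym orbC.
suff c3 i : connect e (inord 3) i.
  by move=> i j; apply: connect_trans (c3 j); rewrite esym.
have step (k : nat) : (0 < k)%N -> (k < n)%N -> e (inord k) (inord k.+1).
  move=> k0 kn; rewrite /e /cart /cart_link !inordK ?ltnS //; last by rewrite ltnW.
  by rewrite k0 eqxx orbT; case: ifP.
have c1 k : (0 < k)%N -> (k < n.+1)%N -> connect e (inord 1) (inord k).
  elim: k => // -[|k] IHk _ kn; first exact: connect0.
  by apply: connect_trans (IHk isT (ltnW kn)) _; apply/connect1/step.
have := c1 3%N isT n3; rewrite esym => c31.
have [i0|i0] := posnP i; last first.
  by apply: connect_trans c31 _; have := c1 i i0 (ltn_ord i); rewrite inord_val.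
apply: connect1; rewrite /e /cart /cart_link inordK // i0 /=; lia.
Qed.

Lemma qform_coords (V K : finType) (M : V -> V -> int) (N : V -> K -> int) (d : int)
    (c : V -> algC) :
  (forall x y, d * M x y = \sum_k N x k * N y k) ->
  d%:~R * qform M c =
  \sum_k (\sum_x c x * (N x k)%:~R) * (\sum_x c x * (N x k)%:~R)^*.
Proof.
move=> MN; rewrite /qform mulr_sumr.
transitivity (\sum_x \sum_y \sum_k (c x * (N x k)%:~R) * ((c y)^* * (N y k)%:~R)).
  apply: eq_bigr => u _; rewrite mulr_sumr; apply: eq_bigr => v _.
  transitivity ((d * M u v)%:~R * (c u * (c v)^*)); first by rewrite rmorphM /=; ring.
  by rewrite MN rmorph_sum mulr_suml; apply: eq_bigr => k _; rewrite rmorphM /=; ring.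
transitivity (\sum_x \sum_k \sum_y (c x * (N x k)%:~R) * ((c y)^* * (N y k)%:~R)).
  by apply: eq_bigr => u _; rewrite exchange_big.
rewrite exchange_big; apply: eq_bigr => k _ /=.
rewrite rmorph_sum mulr_suml; apply: eq_bigr => u _.
by rewrite mulr_sumr; apply: eq_bigr => v _; rewrite rmorphM rmorph_int.
Qed.

Lemma pd_coords (V K : finType) (M : V -> V -> int) (N : V -> K -> int) (d : int) :
  0 < d -> (forall x y, d * M x y = \sum_k N x k * N y k) ->
  (forall c : V -> algC, (forall k, \sum_x c x * (N x k)%:~R = 0) -> forall x, c x = 0) ->
  pd M.
Proof.
move=> d0 MN inj c [x cx].
have d0' : 0 < d%:~R :> algC by rewrite ltr0z.
rewrite -(pmulr_rgt0 _ d0') (qform_coords c MN); apply: sumr_neq0_gt0.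
apply/existsP; apply: contraNT cx => /existsPn z0; apply/eqP/inj => k.
by apply/eqP; have := z0 k; rewrite negbK.
Qed.

(** The vertex i > 0 is e_(i-1) - e_i and the vertex 0 is half of the vector with
    three entries -1 followed by five entries 1; all vectors are doubled. The term
    at k = 0 cancels the last summand, which is meant for i > 0. *)
Definition E_coord (i k : nat) : int :=
  (i == 0)%N%:R * ((if (k < 3)%N then -1 else 1) + 2 * (k == 0)%N%:R)
  + 2 * ((i == k.+1)%:R - (i == k)%:R).

Lemma E8_pd : pd (fun i j : 'I_8 => cart 2 i j).
Proof.
apply: (@pd_coords _ _ _ (fun i k : 'I_8 => E_coord i k) 4) => //.
  move=> i j; rewrite !big_ord_recr big_ord0 /=.
  by case: i j => -[|[|[|[|[|[|[|[|i]]]]]]]] // _ [[|[|[|[|[|[|[|[|j]]]]]]]] // _].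
move=> c cN; pose C (i : nat) := \sum_x c x * ((x : nat) == i)%:R.
have Cc (x : 'I_8) : C x = c x.
  by rewrite -[RHS](sum_delta c x); apply: eq_bigr => y _; rewrite -val_eqE.
have C8 : C 8%N = 0 by rewrite /C big1 // => x _; rewrite ltn_eqF ?mulr0.
have Ck k : (k < 8)%N ->
    C 0%N * ((if (k < 3)%N then -1 else 1) + 2 * (k == 0%N)%:R) + 2 * (C k.+1 - C k) = 0.
  move=> k8; rewrite -(cN (Ordinal k8)) /C mulr_suml -sumrB mulr_sumr -big_split.
  apply: eq_bigr => x _ /=; rewrite /E_coord.
  by case: ifP => _; rewrite !(rmorph_nat, rmorphM, rmorphD, rmorphN) ?rmorph1; ring.
have C0 : C 0%N = 0.
  have two0 : 2 != 0 :> algC by rewrite pnatr_eq0.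
  apply: (mulfI two0); rewrite mulr0.
  transitivity (\sum_(k < 8) (C 0%N * ((if (k < 3)%N then -1 else 1)
      + 2 * ((k : nat) == 0%N)%:R) + 2 * (C k.+1 - C k))).
    by rewrite !big_ord_recr big_ord0 /= C8; ring.
  by rewrite big1 // => k _; rewrite Ck.
have CS k : (k < 8)%N -> C k.+1 = C k.
  move=> /Ck; rewrite C0 mul0r add0r => /eqP.
  by rewrite mulf_eq0 pnatr_eq0 /= subr_eq0 => /eqP.
move=> x; rewrite -Cc; case: x => /= k; elim: k => // k IHk k8.
by rewrite CS ?IHk // ltnW.
Qed.

Lemma E_root_gram n : (n <= 8)%N -> root_gram (fun i j : 'I_n => cart 2 i j).
Proof.
move=> n8; split=> [i j|i|]; [by rewrite /cart eq_sym orbC|by rewrite /cart eqxx|].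
have inj : injective (widen_ord n8) by move=> i j /(congr1 val) E; apply: val_inj.
exact: pd_comp inj E8_pd.
Qed.

Lemma has_rep_dec (V : finType) (M : V -> V -> int) : (0 < #|V|)%N ->
  root_gram M -> gconn M -> has_rep M \/ ~ has_rep M.
Proof.
move=> V0 rM cM; have [k [N [MN iso kE]]] := dynkin_type erefl V0 rM cM.
case/orP: kE => [k2|/andP[/eqP k2 /andP[n6 _]]].
  left; exact: dynkin_has_rep rM MN iso k2.
right=> repM; apply: (E_no_rep n6); rewrite k2 in iso; apply: has_rep_signed_iso iso _.
by elim: MN => // K i j _ repK _; apply: has_rep_mv.
Qed.

(** * The classes reached from a diagram E *)

Lemma mv_signed_iso (V W : finType) (M : V -> V -> int) (N : W -> W -> int)
    (f : V -> W) (s : V -> bool) i j :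
  bijective f -> (forall x y, N (f x) (f y) = sgn (s x) * sgn (s y) * M x y) ->
  forall x y, mv N (f i) (f j) (f x) (f y) = sgn (s x) * sgn (s y) * mv M i j x y.
Proof.
move=> bf NM x y; rewrite /mv !NM !(bij_eq bf).
have sjj : sgn (s j) * sgn (s j) = 1 by exact: sgnM.
have tE z : (z == i)%:R * (sgn (s i) * sgn (s j) * M i j)
          = sgn (s z) * sgn (s j) * ((z == i)%:R * M i j) :> int.
  by have [->|_] := eqVneq z i; rewrite /= ?mulr1n ?mulr0n; ring.
rewrite !tE; set a := sgn (s j) in sjj *.
transitivity (sgn (s x) * sgn (s y) * (M x y - a * a * ((x == i)%:R * M i j * M j y)
   - a * a * ((y == i)%:R * M i j * M x j)
   + a * a * (a * a) * ((x == i)%:R * M i j * ((y == i)%:R * M i j) * M j j))).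
  ring.
by rewrite sjj; ring.
Qed.

(** ** A numerical invariant *)

(** Squaring the entries of the square of the Gram matrix removes the signs;
    summing polynomials in them over all vertices removes the labels. *)
Definition weight (V : finType) (M : V -> V -> int) (i j : V) : int :=
  (\sum_k M i k * M j k) ^+ 2.

Definition weight_sum (V : finType) (M : V -> V -> int) : int :=
  \sum_i (\sum_j weight M i j * (\sum_k weight M j k) ^+ 2) ^+ 2.

Lemma weight_sum_signed_iso (V W : finType) (M : V -> V -> int) (N : W -> W -> int) :
  signed_iso M N -> weight_sum N = weight_sum M.
Proof.
case=> f [s [bf NM]].
have wE x y : weight N (f x) (f y) = weight M x y.
  rewrite /weight (reindex f) /=; last exact: onW_bij.
  rewrite (eq_bigr (fun k => (sgn (s x) * sgn (s y)) * (M x k * M y k))).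
    by rewrite -mulr_sumr !exprMn !(expr2 (sgn _)) !sgnM !mul1r.
  move=> k _; rewrite !NM -[RHS]mul1r -(sgnM (s k)); ring.
rewrite /weight_sum (reindex f) /=; last exact: onW_bij.
apply: eq_bigr => x _; congr (_ ^+ 2).
rewrite (reindex f) /=; last exact: onW_bij.
apply: eq_bigr => y _; rewrite wE; congr (_ * _ ^+ 2).
rewrite (reindex f) /=; last exact: onW_bij.
by apply: eq_bigr => z _; rewrite wE.
Qed.

(** ** Gram matrices as lists *)

Definition zmx := seq (seq Z).

Definition zent (A : zmx) (i j : nat) : Z := nth Z0 (nth [::] A i) j.

Definition zfun n (A : zmx) (i j : 'I_n) : int := int_of_Z (zent A i j).

Definition wf (n : nat) (A : zmx) := (size A == n) && all (fun r => size r == n) A.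

Fixpoint upd T (s : seq T) (i : nat) (a : T) : seq T :=
  match s, i with
  | [::], _ => [::]
  | _ :: s', 0%N => a :: s'
  | b :: s', i'.+1 => b :: upd s' i' a
  end.

Lemma size_upd T (s : seq T) i a : size (upd s i a) = size s.
Proof. by elim: s i => [|b s IHs] [|i] //=; rewrite IHs. Qed.

Lemma nth_upd T x0 (s : seq T) i a k : (i < size s)%N ->
  nth x0 (upd s i a) k = if k == i then a else nth x0 s k.
Proof. by elim: s i k => [|b s IHs] [|i] [|k] //= /IHs. Qed.

Definition sub_mul (m : Z) (r s : seq Z) : seq Z :=
  [seq Z.sub p.1 (Z.mul m p.2) | p <- zip r s].

(** The move [mv], as a row operation followed by the same column operation. *)
Definition zmove (i j : nat) (A : zmx) : zmx :=
  let m := zent A i j in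
  [seq upd r i (Z.sub (nth Z0 r i) (Z.mul m (nth Z0 r j))) |
    r <- upd A i (sub_mul m (nth [::] A i) (nth [::] A j))].

Lemma wf_row n A i : wf n A -> (i < n)%N -> size (nth [::] A i) = n.
Proof. by case/andP=> /eqP <- /allP h ij; apply/eqP/h/mem_nth. Qed.

Lemma zmove_wf n A i j : wf n A -> (i < n)%N -> (j < n)%N -> wf n (zmove i j A).
Proof.
move=> wA ni nj; have [/eqP sA _] := andP wA.
rewrite /wf size_map size_upd sA eqxx /=; apply/allP => r /mapP[r' r'A ->].
rewrite size_upd; have /(nthP [::])[k] := r'A.
rewrite size_upd sA => kn <-; rewrite nth_upd ?sA //.
case: ifP => _; last by rewrite (wf_row wA).
by rewrite size_map size_zip !(wf_row wA) // minnn.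
Qed.

Lemma zent_move n A i j x y : wf n A -> (i < n)%N -> (j < n)%N -> (x < n)%N -> (y < n)%N ->
  let t z := if z == i then zent A i j else Z0 in
  let row z := Z.sub (zent A x z) (Z.mul (t x) (zent A j z)) in
  zent (zmove i j A) x y = Z.sub (row y) (Z.mul (t y) (row j)).
Proof.
move=> wA ni nj nx ny /=; have [/eqP sA _] := andP wA.
rewrite {1}/zent (nth_map [::]) ?size_upd ?sA //.
rewrite [nth [::] (upd A _ _) x]nth_upd ?sA //.
have rowE z : (z < n)%N ->
  nth Z0 (if x == i then sub_mul (zent A i j) (nth [::] A i) (nth [::] A j)
           else nth [::] A x) z
  = Z.sub (zent A x z) (Z.mul (if x == i then zent A i j else Z0) (zent A j z)).
  move=> nz; case: eqP => [->|_]; last by rewrite Z.mul_0_l Z.sub_0_r.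
  rewrite (nth_map (Z0, Z0)) ?size_zip ?(wf_row wA) ?minnn //.
  by rewrite nth_zip ?(wf_row wA).
set r := (if x == i then _ else _) in rowE *.
have sr : size r = n.
  rewrite /r; case: ifP => _; last by rewrite (wf_row wA).
  by rewrite size_map size_zip !(wf_row wA) // minnn.
rewrite nth_upd ?sr //; have [->|nyi] := eqVneq y i; first by rewrite !rowE.
by rewrite Z.mul_0_l Z.sub_0_r rowE.
Qed.

Lemma zfun_move n A (i j : 'I_n) : wf n A -> i != j ->
  forall x y, zfun (zmove i j A) x y = mv (zfun A) i j x y.
Proof.
move=> wA nij x y; rewrite {1}/zfun (zent_move wA) ?ltn_ord //=.
rewrite /mv /zfun !rmorphB !rmorphM !rmorphB !rmorphM /=.
rewrite -!(inj_eq val_inj) /=.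
have tE (z : 'I_n) : int_of_Z (if (z : nat) == i then zent A i j else Z0)
            = ((z : nat) == i)%:R * int_of_Z (zent A i j).
  by case: eqP => _; rewrite ?mul1r ?mul0r ?rmorph0.
by rewrite !tE; ring.
Qed.

Definition zsum (s : seq Z) : Z := foldr Z.add Z0 s.

Fixpoint zdot (r s : seq Z) : Z :=
  match r, s with
  | a :: r', b :: s' => Z.add (Z.mul a b) (zdot r' s')
  | _, _ => Z0
  end.

Definition zsq (a : Z) := Z.mul a a.

(** The list forms of [weight] and [weight_sum]: the entries of W are the
    weights, and the vertex keys are the terms that are squared and summed. *)
Definition vertex_keys (A : zmx) : seq Z :=
  let W := [seq [seq zsq (zdot r s) | s <- A] | r <- A] in
  let d := [seq zsq (zsum r) | r <- W] in
  [seq zdot r d | r <- W].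

Definition key (A : zmx) : Z := zsum [seq zsq a | a <- vertex_keys A].

Lemma zsumE n (s : seq Z) : size s = n ->
  int_of_Z (zsum s) = \sum_(i < n) int_of_Z (nth Z0 s i).
Proof.
move=> <-; elim: s => [|a s IHs] /=; first by rewrite big_ord0.
by rewrite big_ord_recl /= -IHs -rmorphD.
Qed.

Lemma zdotE n (r s : seq Z) : size r = n -> size s = n ->
  int_of_Z (zdot r s) = \sum_(i < n) int_of_Z (nth Z0 r i) * int_of_Z (nth Z0 s i).
Proof.
move=> <-; elim: r s => [|a r IHr] [|b s] //=; first by rewrite big_ord0.
by case=> /IHr IH; rewrite big_ord_recl /= -IH -rmorphM -rmorphD.
Qed.

Lemma zsqE a : int_of_Z (zsq a) = int_of_Z a ^+ 2.
Proof. by rewrite expr2 -rmorphM. Qed.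

Lemma keyE n A : wf n A -> int_of_Z (key A) = weight_sum (zfun (n := n) A).
Proof.
move=> wA; have [/eqP sA _] := andP wA.
pose W := [seq [seq zsq (zdot r s) | s <- A] | r <- A].
have sW : size W = n by rewrite size_map.
have rW i : (i < n)%N -> nth [::] W i = [seq zsq (zdot (nth [::] A i) s) | s <- A].
  by move=> ni; rewrite (nth_map [::]) ?sA.
have srW i : (i < n)%N -> size (nth [::] W i) = n by move=> /rW->; rewrite size_map.
have wE (i j : 'I_n) : int_of_Z (nth Z0 (nth [::] W i) j) = weight (zfun A) i j.
  rewrite rW ?ltn_ord // (nth_map [::]) ?sA ?ltn_ord // zsqE; congr (_ ^+ 2).
  by rewrite (zdotE (n := n)) ?(wf_row wA) ?ltn_ord.
rewrite /key (zsumE (n := n)) ?size_map //; apply: eq_bigr => i _.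
rewrite (nth_map Z0) ?size_map ?sA ?ltn_ord // zsqE; congr (_ ^+ 2).
rewrite (nth_map [::]) ?size_map ?sA ?ltn_ord // -/W.
rewrite (zdotE (n := n)) ?srW ?size_map ?sA ?ltn_ord //.
apply: eq_bigr => j _; rewrite wE; congr (_ * _).
rewrite (nth_map [::]) ?sW ?ltn_ord // zsqE; congr (_ ^+ 2).
by rewrite (zsumE (n := n)) ?srW ?ltn_ord //; apply: eq_bigr => k _; rewrite wE.
Qed.

(** A frame lists the signed vectors of a family that are to be taken as its new
    first, second, ... member. *)
Definition frame := seq (nat * bool).

Definition zneg (b : bool) (a : Z) := if b then Z.opp a else a.

Definition relabel (f : frame) (A : zmx) : zmx :=
  [seq let r := nth [::] A p.1 in
       [seq zneg (p.2 (+) q.2) (nth Z0 r q.1) | q <- f] | p <- f].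

Definition zmx_eqb (A B : zmx) := all2 (all2 Z.eqb) A B.

Lemma zmx_eqbP A B : zmx_eqb A B -> A = B.
Proof.
elim: A B => [|r A IHA] [|s B] //= /andP[rs /IHA->]; congr (_ :: _).
elim: r s rs => [|a r IHr] [|b s] //= /andP[/Z.eqb_spec-> /IHr->] //.
Qed.

Definition is_frame (n : nat) (f : frame) :=
  [&& size f == n, uniq (unzip1 f) & all (fun a => a < n)%N (unzip1 f)].

Lemma znegE b a : int_of_Z (zneg b a) = sgn b * int_of_Z a.
Proof. by case: b; rewrite /zneg ?mul1r // rmorphN mulN1r. Qed.

Lemma relabel_signed_iso n f A : is_frame n f ->
  signed_iso (zfun (n := n) (relabel f A)) (zfun (n := n) A).
Proof.
case/and3P => /eqP sf uf /allP ltf.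
have nthlt (i : 'I_n) : (nth 0%N (unzip1 f) i < n)%N.
  by apply: ltf; rewrite mem_nth // size_map sf.
pose g i := Ordinal (nthlt i).
have injg : injective g.
  move=> i j /(congr1 val) /= /eqP; rewrite nth_uniq ?size_map ?sf //.
  by move/eqP/val_inj.
exists g, (fun i : 'I_n => (nth (0%N, false) f i).2); split; first exact: injF_bij.
move=> i j; rewrite /zfun /zent /relabel.
rewrite (nth_map (0%N, false)) ?sf // (nth_map (0%N, false)) ?sf // znegE.
rewrite /= !(nth_map (0%N, false)) ?sf // /sgn signr_addb.
by rewrite mulrA mulrACA -!signr_addb !addbb !mul1r.
Qed.

(** ** Exceptional Gram functions *)

Definition exceptional_root (V : finType) (M : V -> V -> int) : Prop :=
  [/\ root_gram M, gconn M & ~ has_rep M].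

Lemma connect_homo (V W : finType) (e : rel V) (e' : rel W) (f : V -> W) x y :
  (forall a b, e a b -> e' (f a) (f b)) -> connect e x y -> connect e' (f x) (f y).
Proof.
move=> fE /connectP[p]; elim: p x => [|z p IHp] x /=; first by move=> _ ->.
by case/andP=> /fE xz /IHp IH /IH; apply: connect_trans (connect1 xz).
Qed.

Lemma gconn_signed_iso (V W : finType) (M : V -> V -> int) (N : W -> W -> int) :
  signed_iso M N -> gconn M -> gconn N.
Proof.
case=> f [s [[g fK gK] NM]] cM x y; rewrite -[x]gK -[y]gK.
apply: connect_homo (cM (g x) (g y)) => a b Mab.
by rewrite NM !mulf_neq0 ?sgn_neq0.
Qed.

Lemma root_gram_signed_iso (V W : finType) (M : V -> V -> int) (N : W -> W -> int) :
  signed_iso M N -> root_gram M -> root_gram N.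
Proof.
move=> iso [symM diagM pdM]; have [f [s [[g fK gK] NM]]] := iso.
split; last exact: pd_signed_iso pdM.
- by move=> x y; rewrite -[x]gK -[y]gK !NM symM [sgn _ * sgn _]mulrC.
- by move=> x; rewrite -[x]gK !NM diagM sgnM.
Qed.

Lemma exceptional_signed_iso (V W : finType) (M : V -> V -> int) (N : W -> W -> int) :
  signed_iso M N -> exceptional_root M -> exceptional_root N.
Proof.
move=> iso [rM cM nM]; split; first exact: root_gram_signed_iso rM.
- exact: gconn_signed_iso cM.
- by move=> repN; apply: nM; apply: has_rep_signed_iso repN.
Qed.

Lemma exceptional_mv (V : finType) (M : V -> V -> int) i j :
  i != j -> exceptional_root M -> exceptional_root (mv M i j).
Proof.
move=> nij [rM cM nM]; split; [exact: mv_root_gram|exact: mv_gconn|].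
move=> /(has_rep_mv i j); apply: contra_not nM => rep; apply: has_rep_signed_iso rep.
by apply: signed_iso_ext => x y; rewrite mvK.
Qed.

Theorem exceptional_diagram (V : finType) (M : V -> V -> int) n :
  #|V| = n -> (0 < n)%N -> exceptional_root M ->
  (6 <= n <= 8)%N /\
  exists2 N, mvs M N & signed_iso (fun i j : 'I_n => cart 2 i j) N.
Proof.
move=> Vn n0 [rM cM nM]; have [k [N [MN iso kE]]] := dynkin_type Vn n0 rM cM.
case/orP: kE => [k2|/andP[/eqP k2 n68]].
  by case: nM; apply: dynkin_has_rep rM MN iso k2.
by subst k; split=> //; exists N.
Qed.

(** ** Atlases *)

(** A row of an atlas consists of a matrix, of the row and the move from which it
    arises, and of one certificate for each move (i, j) with a nonzero entry:
    the number of a row and the frame that turns the moved matrix into the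
    matrix of that row. *)
Definition cert := (positive * frame)%type.
Definition atlas_row := (zmx * (positive * (nat * nat)) * seq cert)%type.

Definition matrices (t : seq atlas_row) : seq zmx := [seq r.1.1 | r <- t].

Definition live_moves (n : nat) (A : zmx) : seq (nat * nat) :=
  [seq p <- [seq (i, j) | i <- iota 0 n, j <- iota 0 n]
     | (p.1 != p.2) && ~~ Z.eqb (zent A p.1 p.2) Z0].

Fixpoint index_from (k : positive) (t : seq atlas_row) : PositiveMap.t zmx :=
  if t is r :: t' then PositiveMap.add k r.1.1 (index_from (Pos.succ k) t')
  else PositiveMap.empty zmx.

Definition cert_ok (n : nat) (ix : PositiveMap.t zmx) A (p : nat * nat) (c : cert) : bool :=
  is_frame n c.2 &&
  (if PositiveMap.find c.1 ix is Some B
   then zmx_eqb (relabel c.2 (zmove p.1 p.2 A)) B else false).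

Definition closed_ok (n : nat) (t : seq atlas_row) : bool :=
  let ix := index_from 1 t in
  all (fun r : atlas_row => all2 (cert_ok n ix r.1.1) (live_moves n r.1.1) r.2) t.

(** The list t is read from row k on; ix holds the matrices of the earlier rows,
    among which each matrix has its parent. *)
Fixpoint reach_ok (n : nat) k (ix : PositiveMap.t zmx) (t : seq atlas_row) : bool :=
  if t is (A, (p, (i, j)), _) :: t' then
    [&& (i < n)%N, (j < n)%N, i != j,
        (if PositiveMap.find p ix is Some P then zmx_eqb (zmove i j P) A else false)
      & reach_ok n (Pos.succ k) (PositiveMap.add k A ix) t']
  else true.

Definition E_zmx (n : nat) : zmx :=
  [seq [seq (if i == j then Zpos 2 else if cart_link 2 i j || cart_link 2 j i
             then Zneg 1 else Z0) | j <- iota 0 n] | i <- iota 0 n].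

(** The first matrix is that of E, all others arise from it by moves, the moves
    lead back to the listed matrices, and these have distinct keys. *)
Definition atlas_ok (n : nat) (t : seq atlas_row) : bool :=
  [&& (if t is r :: t' then
         zmx_eqb r.1.1 (E_zmx n) &&
         reach_ok n 2 (PositiveMap.add 1%positive (E_zmx n) (PositiveMap.empty zmx)) t'
       else false),
      closed_ok n t
    & pairwise (fun a b => ~~ Z.eqb a b) [seq key A | A <- matrices t]].

Lemma E_zmxP n : wf n (E_zmx n) /\
  forall i j : 'I_n, zfun (E_zmx n) i j = cart 2 i j.
Proof.
split.
  rewrite /wf size_map size_iota eqxx /=; apply/allP => r /mapP[i _ ->].
  by rewrite size_map size_iota.
move=> i j; rewrite /zfun /zent (nth_map 0%N) ?size_iota ?ltn_ord //.
rewrite (nth_map 0%N) ?size_iota ?ltn_ord // !nth_iota ?ltn_ord // !add0n /cart.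
by case: ifP => // _; case: ifP.
Qed.

Section AtlasSoundness.
Variables (n : nat) (t : seq atlas_row).
Hypotheses (n68 : (6 <= n <= 8)%N) (ok : atlas_ok n t).

Let good A := wf n A /\ exceptional_root (zfun (n := n) A).

Lemma E_exceptional : exceptional_root (fun i j : 'I_n => cart 2 i j).
Proof.
case/andP: n68 => n6 n8; split; first exact: E_root_gram.
- by apply: E_gconn; apply: leq_trans n6.
- exact: E_no_rep.
Qed.

Lemma E_zmx_good : good (E_zmx n).
Proof.
have [wE EE] := E_zmxP n; split=> //.
apply: exceptional_signed_iso E_exceptional.
exact: signed_iso_ext.
Qed.

Lemma reach_good k ix s :
  (forall p A, PositiveMap.find p ix = Some A -> good A) ->
  reach_ok n k ix s -> forall A, A \in matrices s -> good A.
Proof.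
elim: s k ix => // -[[A [p [i j]]] cs] s IHs k ix ixP /= /and5P[ni nj nij].
case E: (PositiveMap.find p ix) => [P|] // /zmx_eqbP PA hs.
have gA : good A.
  have [wP eP] := ixP _ _ E; rewrite -PA; split; first exact: zmove_wf.
  pose i' := Ordinal ni; pose j' := Ordinal nj.
  have nij' : i' != j' by [].
  apply: exceptional_signed_iso (exceptional_mv nij' eP).
  by apply: signed_iso_ext => x y; rewrite -(zfun_move wP nij').
move=> C; rewrite inE => /orP[/eqP->//|]; apply: IHs hs _.
move=> q B; case: (PositiveMap.E.eq_dec q k) => [->|nqk].
  by rewrite PositiveMap.gss => -[<-].
by rewrite PositiveMap.gso //; apply: ixP.
Qed.

Lemma atlas_good A : A \in matrices t -> good A.
Proof.
case/and3P: ok; case: t => // r0 s /andP[/zmx_eqbP r0E hs] _ _.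
rewrite inE => /orP[/eqP->|]; first by rewrite r0E; apply: E_zmx_good.
apply: reach_good hs A => p B.
case: (PositiveMap.E.eq_dec p 1%positive) => [->|np].
  by rewrite PositiveMap.gss => -[<-]; apply: E_zmx_good.
by rewrite PositiveMap.gso // PositiveMap.gempty.
Qed.

Lemma index_matrices k s p A : PositiveMap.find p (index_from k s) = Some A ->
  A \in matrices s.
Proof.
elim: s k => [|r s IHs] k /=; first by rewrite PositiveMap.gempty.
case: (PositiveMap.E.eq_dec p k) => [->|np].
  by rewrite PositiveMap.gss => -[<-]; rewrite mem_head.
by rewrite PositiveMap.gso // inE => /IHs->; rewrite orbT.
Qed.

(** A move (i, j) with entry 0 changes nothing; all others have a certificate. *)
Lemma atlas_closed A (i j : 'I_n) : A \in matrices t -> i != j ->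
  exists2 B, B \in matrices t & signed_iso (mv (zfun A) i j) (zfun (n := n) B).
Proof.
move=> At nij; have [wr [rr _ _]] := atlas_good At.
have [m0|m0] := eqVneq (zent A i j) Z0.
  exists A => //; apply: signed_iso_ext => x y.
  have z0 : zfun A i j = 0 by rewrite /zfun m0.
  by rewrite /mv z0; ring.
pose r0 : atlas_row := ([::], (1%positive, (0, 0)%N), [::]).
have /(nthP [::])[u] := At; rewrite size_map => ut; rewrite (nth_map r0) //.
set r := nth r0 t u => rA; subst A.
case/and3P: ok => _ /(all_nthP r0)/(_ u ut) hr _; rewrite -/r in hr.
have : (i : nat, j : nat) \in live_moves n r.1.1.
  rewrite mem_filter /= nij /=; apply/andP; split.
    by apply: contraNN m0 => /Z.eqb_spec->.
  by apply/allpairsP; exists (i : nat, j : nat); rewrite !mem_iota !ltn_ord.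
move=> /(nthP (0, 0)%N)[k kl kE].
move: hr; rewrite all2E => /andP[/eqP sz /all_nthP].
move=> /(_ ((0, 0)%N, (1%positive, [::])) k).
rewrite size_zip -sz minnn kl nth_zip // kE => /(_ isT) /andP[/= fr].
case E: PositiveMap.find => [B|] // /zmx_eqbP rB.
exists B; first exact: index_matrices E.
apply: signed_iso_trans (signed_iso_ext (zfun_move wr nij)) _.
by rewrite -rB; apply: signed_iso_sym; apply: relabel_signed_iso.
Qed.

(** The matrix of E is listed, and by reversibility M arises from it by moves. *)
Theorem atlas_complete (V : finType) (M : V -> V -> int) :
  #|V| = n -> exceptional_root M ->
  exists2 A, A \in matrices t & signed_iso M (zfun (n := n) A).
Proof.
move=> Vn eM; have n0 : (0 < n)%N by case/andP: n68; case: n.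
have [rM _ _] := eM; have [_ [N MN iso]] := exceptional_diagram Vn n0 eM.
apply: (mvs_ind_rev MN (P := fun K => exists2 A, A \in matrices t &
          signed_iso K (zfun (n := n) A))) => //.
- move=> K i j rK nij [A At Kr]; have [f [s [bf KE]]] := Kr.
  have nfij : f i != f j by rewrite (bij_eq bf).
  have [B Bt iso'] := atlas_closed At nfij; exists B => //.
  apply: signed_iso_trans iso'; exists f, s; split=> //.
  exact: mv_signed_iso.
- move=> K L KL [A At Kr]; exists A => //; apply: signed_iso_trans Kr.
  by apply: signed_iso_ext.
- have := ok; case/and3P; case: t => // r0 s /andP[/zmx_eqbP r0E _] _ _.
  exists r0.1.1; first exact: mem_head.
  rewrite r0E; apply: signed_iso_trans (signed_iso_sym iso) _.
  by apply: signed_iso_ext => i j; have [_ ->] := E_zmxP n.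
Qed.

Lemma atlas_distinct i j : (i < size t)%N -> (j < size t)%N ->
  signed_iso (zfun (n := n) (nth [::] (matrices t) i))
             (zfun (n := n) (nth [::] (matrices t) j)) -> i = j.
Proof.
have wft k : (k < size t)%N -> wf n (nth [::] (matrices t) k).
  by move=> kt; have [] := @atlas_good (nth [::] (matrices t) k); rewrite ?mem_nth ?size_map.
case/and3P: ok => _ _ /(pairwiseP Z0) pw.
have lt a b : (a < b)%N -> (b < size t)%N ->
    signed_iso (zfun (n := n) (nth [::] (matrices t) a))
               (zfun (n := n) (nth [::] (matrices t) b)) -> False.
  move=> ab bt iso; have at_ := ltn_trans ab bt.
  have := pw a b; rewrite !inE !size_map => /(_ at_ bt ab) /negP; apply.
  rewrite !(nth_map [::]) ?size_map //; apply/Z.eqb_spec/(can_inj int_of_ZK).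
  by rewrite !(keyE (n := n)) ?wft // (weight_sum_signed_iso iso).
move=> it jt iso; have [ij|[//|ji]] : (i < j)%N \/ (i = j \/ (j < i)%N) by lia.
  by case: (lt i j).
by case: (lt j i) => //; apply: signed_iso_sym.
Qed.

End AtlasSoundness.

(** ** Three atlases *)

Fixpoint first_some A B (f : A -> option B) (s : seq A) : option B :=
  if s is a :: s' then (if f a is Some b then Some b else first_some f s') else None.

(** Extends the frame f of A by backtracking so that A, relabelled, has the
    given rows; the vertex keys restrict the candidates. *)
Fixpoint find_frame (A : zmx) (keysA : seq Z) (rows : seq (Z * seq Z)) (f : frame) :
    option frame :=
  if rows is (k, r) :: rows' then
    first_some (fun p : nat * bool =>
      if Z.eqb (nth Z0 keysA p.1) k &&
         all2 Z.eqb [seq zneg (p.2 (+) q.2) (zent A p.1 q.1) | q <- f] (take (size f) r)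
      then find_frame A keysA rows' (rcons f p) else None)
     [seq (v, b) | v <- iota 0 (size A), b <- [:: false; true]]
  else Some f.

(** The matrices found are stored by their key, with their number. *)
Definition store := PositiveMap.t (positive * seq Z * zmx).

Definition visit (n : nat) (A : zmx) (k0 : positive)
    (st : store * positive * seq (zmx * (positive * (nat * nat))) * seq cert)
    (p : nat * nat) :=
  let: (found, k, queue, certs) := st in
  let B := zmove p.1 p.2 A in
  let keysB := vertex_keys B in
  let keyB := Z.to_pos (zsum [seq zsq a | a <- keysB]) in
  match PositiveMap.find keyB found with
  | Some (c, keysC, C) =>
      if find_frame B keysB (zip keysC C) [::] is Some f
      then (found, k, queue, (c, f) :: certs) else st
  | None =>
      (PositiveMap.add keyB (k, keysB, B) found, Pos.succ k, (B, (k0, p)) :: queue,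
       (k, [seq (v, false) | v <- iota 0 n]) :: certs)
  end.

(** Breadth-first search; k0 is the number of the next matrix to be visited, and
    k the number of matrices found, plus one. *)
Fixpoint search (fuel n : nat) (k0 : positive) (found : store) (k : positive)
    (todo queue : seq (zmx * (positive * (nat * nat)))) (acc : seq atlas_row) :
    seq atlas_row :=
  if fuel is fuel'.+1 then
    match todo with
    | (A, par) :: todo' =>
        let: (found', k', queue', certs) :=
          foldl (visit n A k0) (found, k, queue, [::]) (live_moves n A) in
        search fuel' n (Pos.succ k0) found' k' todo' queue' ((A, par, rev certs) :: acc)
    | [::] => if nilp queue then rev acc
              else search fuel' n k0 found k (rev queue) [::] acc
    end
  else [::].

Definition atlas (n : nat) : seq atlas_row :=
  let A := E_zmx n in
  let found := PositiveMap.add (Z.to_pos (key A)) (1%positive, vertex_keys A, A)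
                 (PositiveMap.empty _) in
  search 2000 n 1 found 2 [:: (A, (1%positive, (0, 0)%N))] [::] [::].

(** The lists are evaluated once; [atlas_ok] then recomputes every move, frame
    and key from them. *)
Definition atlas6 := Eval vm_compute in atlas 6.
Definition atlas7 := Eval vm_compute in atlas 7.
Definition atlas8 := Eval vm_compute in atlas 8.

Lemma atlas6_ok : atlas_ok 6 atlas6.
Proof. by vm_cast_no_check (erefl true). Qed.

Lemma atlas7_ok : atlas_ok 7 atlas7.
Proof. by vm_cast_no_check (erefl true). Qed.

Lemma atlas8_ok : atlas_ok 8 atlas8.
Proof. by vm_cast_no_check (erefl true). Qed.

Lemma size_atlas :
  [/\ size atlas6 = 32%N, size atlas7 = 233%N & size atlas8 = 1242%N].
Proof. by split; vm_compute. Qed.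

(** * Exceptional edge-signed graphs *)

Lemma gram_neq0 (V : finType) (G : sgraph V) x y :
  (gram G x y != 0) = (x == y) || underlying G x y.
Proof. by rewrite /gram; have [//|_] := eqVneq x y; apply: sadj_neq0. Qed.

Lemma gconn_gram (V : finType) (G : sgraph V) :
  gconn (gram G) <-> forall x y, connect (underlying G) x y.
Proof.
split=> cG x y; apply: connect_sub (cG x y) => {}x {}y.
  by rewrite gram_neq0 => /predU1P[->|/connect1]; first exact: connect0.
by move=> Gxy; apply: connect1; rewrite gram_neq0 Gxy orbT.
Qed.

Lemma has_rep_gram (V : finType) (G : sgraph V) :
  has_rep (gram G) <-> exists n (phi : V -> 'rV[int]_n), integral_rep G phi.
Proof.
split=> [[n [phi E]]|[n [phi [E2 E]]]]; exists n, phi.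
  split=> [x|x y nxy]; first by rewrite E gram_diag.
  by rewrite E /gram (negbTE nxy).
by move=> x y; rewrite /gram; case: eqP => [->|/eqP/E].
Qed.

Lemma exceptional_gtP (V : finType) (G : sgraph V) :
  exceptional_gt G <-> (0 < #|V|)%N /\ exceptional_root (gram G).
Proof.
split=> [[[[V0 cG] _ nG] /eig_gt_gram pdG]|[V0 [[_ _ pdG] cG nG]]].
  split=> //; split; [split=> // x *| |].
  - exact: gram_sym.
  - exact: gram_diag.
  - exact/gconn_gram.
  - by move=> /has_rep_gram.
have gtG : smallest_eig_gt (sadj_mx G) (- 2) by apply/eig_gt_gram.
split=> //; split.
- by split=> //; apply/gconn_gram.
- by move=> a /gtG/ltW.
- by move=> /has_rep_gram.
Qed.

Lemma exceptional_gt_card (W : finType) (G : sgraph W) :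
  exceptional_gt G -> [\/ #|W| = 6%N, #|W| = 7%N | #|W| = 8%N].
Proof.
case/exceptional_gtP => W0 eG; have [n68 _] := exceptional_diagram erefl W0 eG.
have [->|[->|->]] : #|W| = 6%N \/ (#|W| = 7%N \/ #|W| = 8%N) by lia.
- exact: Or31.
- exact: Or32.
- exact: Or33.
Qed.

Section GraphOfGram.
Variables (V : finType) (M : V -> V -> int).

Let entry c : rel V := fun x y => [&& x != y, M x y == c & M y x == c].

Lemma graph_of_gram_sym c : symmetric (entry c).
Proof. by move=> x y; rewrite /entry eq_sym [(M x y == c) && _]andbC. Qed.

Lemma graph_of_gram_irr c : irreflexive (entry c).
Proof. by move=> x; rewrite /entry eqxx. Qed.

Lemma graph_of_gram_disj x y :
  Graph (graph_of_gram_sym 1) (graph_of_gram_irr 1) x y ->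
  ~~ Graph (graph_of_gram_sym (-1)) (graph_of_gram_irr (-1)) x y.
Proof. by rewrite /= /entry => /and3P[-> /eqP-> _]. Qed.

Definition graph_of_gram : sgraph V := SGraph graph_of_gram_disj.

Lemma graph_of_gramK : root_gram M -> forall x y, gram graph_of_gram x y = M x y.
Proof.
move=> rM x y; have [symM diagM _] := rM.
rewrite /gram; have [->|nxy] := eqVneq x y; first by rewrite diagM.
rewrite /sadj /= /entry nxy [M y x]symM !andbb /=.
by have := root_gram_bound rM nxy; do 2?case: eqP => //; lia.
Qed.

End GraphOfGram.

Lemma atlas_count n k t : (6 <= n <= 8)%N -> atlas_ok n t -> size t = k ->
  exceptional_gt_count n k.
Proof.
move=> n68 ok <-; pose A i := nth [::] (matrices t) i.
have good (i : 'I_(size t)) : exceptional_root (zfun (n := n) (A i)).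
  by have [] := @atlas_good n t n68 ok (A i); rewrite ?mem_nth ?size_map.
have gramA (i : 'I_(size t)) x y :
    gram (graph_of_gram (zfun (n := n) (A i))) x y = zfun (A i) x y.
  by apply: graph_of_gramK; case: (good i).
have isoA (i : 'I_(size t)) :
    signed_iso (zfun (n := n) (A i)) (gram (graph_of_gram (zfun (n := n) (A i)))).
  exact: signed_iso_ext.
exists (fun i : 'I_(size t) => graph_of_gram (zfun (n := n) (A i))); split.
- move=> i; apply/exceptional_gtP; split.
    by rewrite card_ord; case/andP: n68 => n6 _; apply: leq_trans n6.
  exact: exceptional_signed_iso (good i).
- move=> i j /sw_equivP iso; apply: val_inj.
  apply: (@atlas_distinct n t n68 ok) => //=.
  exact: signed_iso_trans (isoA i) (signed_iso_trans iso (signed_iso_sym (isoA j))).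
- move=> V G Vn /exceptional_gtP[_ eG].
  have [B /(nthP [::])[i ilt <-] iso] := atlas_complete n68 ok Vn eG.
  rewrite size_map in ilt; exists (Ordinal ilt); apply/sw_equivP.
  exact: signed_iso_trans iso (isoA (Ordinal ilt)).
Qed.

Theorem exceptional_gt_counts :
  [/\ exceptional_gt_count 6 32, exceptional_gt_count 7 233
    & exceptional_gt_count 8 1242].
Proof.
have [s6 s7 s8] := size_atlas.
split; first exact: (@atlas_count 6 _ atlas6 isT atlas6_ok s6).
  exact: (@atlas_count 7 _ atlas7 isT atlas7_ok s7).
exact: (@atlas_count 8 _ atlas8 isT atlas8_ok s8).
Qed.

(** * Trees and unicyclic graphs *)

(** ** Spanning trees grown leaf by leaf *)

Lemma eq_set2 (K : finType) (a b c d : K) :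
  [set a; b] = [set c; d] -> (a = c /\ b = d) \/ (a = d /\ b = c).
Proof.
move=> E; have ca : c \in [set a; b] by rewrite E set21.
have da : d \in [set a; b] by rewrite E set22.
have : a \in [set c; d] by rewrite -E set21.
have : b \in [set c; d] by rewrite -E set22.
case/set2P: ca => ->; case/set2P: da => ->; rewrite !inE ?orbb; auto.
  by move=> /eqP->; auto.
by move=> _ /eqP->; auto.
Qed.

Section Growth.
Variables (K W : finType) (inc : W -> {set K}).

(** The members of W are edges of a multigraph on K, with ends given by inc. The
    edges in F form a tree on the vertices in S, to which leaves are added. *)
Inductive grows : {set K} -> {set W} -> Prop :=
| grows0 k : grows [set k] set0
| growsS S F x u v : grows S F -> u \in S -> v \notin S -> inc x = [set u; v] ->
    grows (v |: S) (x |: F).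

Definition link (A : {set W}) : rel K :=
  fun a b => [exists x in A, inc x == [set a; b]].

Lemma linkP (A : {set W}) a b :
  reflect (exists2 x, x \in A & inc x = [set a; b]) (link A a b).
Proof. by apply: (iffP exists_inP) => -[x xA /eqP xE]; exists x => //; apply/eqP. Qed.

Lemma link_sym_rel A : symmetric (link A).
Proof. by move=> a b; apply/linkP/linkP => -[x xA xE]; exists x => //; rewrite xE setUC. Qed.

Lemma grows_sub S F x : grows S F -> x \in F -> inc x \subset S.
Proof.
elim=> {S F} [k|S F y u v _ IH uS vS yE]; first by rewrite inE.
case/setU1P => [->|/IH xS]; last exact: subset_trans xS (subsetUr _ _).
by rewrite yE subUset !sub1set !inE uS eqxx orbT.
Qed.

Lemma grows_pair S F x : grows S F -> x \in F ->
  exists u v, u != v /\ inc x = [set u; v].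
Proof.
elim=> {S F} [k|S F y u v _ IH uS vS yE]; first by rewrite inE.
case/setU1P => [->|//]; exists u, v; split=> //.
by apply: contraNneq vS => <-.
Qed.

Lemma grows_new S F x u v : grows S F -> v \notin S -> inc x = [set u; v] -> x \notin F.
Proof.
move=> gSF vS xE; apply: contra vS => xF.
by have /subsetP := grows_sub gSF xF; apply; rewrite xE set22.
Qed.

Lemma grows_card S F : grows S F -> #|S| = #|F|.+1.
Proof.
elim=> {S F} [k|S F y u v gSF IH uS vS yE]; first by rewrite cards1 cards0.
by rewrite !cardsU1 vS (grows_new gSF vS yE) IH.
Qed.

Lemma grows_inj S F : grows S F -> {in F &, injective inc}.
Proof.
elim=> {S F} [k|S F y u v gSF IH uS vS yE]; first by move=> x y; rewrite inE.
have new x : x \in F -> inc x <> inc y.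
  move=> xF E; case/negP: vS; have /subsetP := grows_sub gSF xF; apply.
  by rewrite E yE set22.
move=> x z /setU1P[->|xF] /setU1P[->|zF] // E; last exact: IH.
  by case: (new z zF).
by case: (new x xF).
Qed.

(** The last leaf occurs in a single edge, whose coefficient therefore vanishes. *)
Lemma grows_indep (R : idomainType) (N : W -> K -> R) S F (c : W -> R) :
  grows S F -> (forall x k, (N x k != 0) = (k \in inc x)) ->
  (forall k, \sum_(x in F) c x * N x k = 0) -> forall x, x \in F -> c x = 0.
Proof.
move=> gSF N0; elim: gSF => {S F} [k|S F y u v gSF IH uS vS yE] cN x; first by rewrite inE.
have yF := grows_new gSF vS yE.
have cy : c y = 0.
  have := cN v; rewrite big_setU1 //= big1 ?addr0 => [/eqP|z zF].
    by rewrite mulf_eq0 => /orP[/eqP//|]; rewrite -[_ == 0]negbK N0 yE set22.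
  suff /eqP-> : N z v == 0 by rewrite mulr0.
  rewrite -[_ == 0]negbK N0; apply: contra vS => vz.
  by have /subsetP := grows_sub gSF zF; apply.
case/setU1P => [->//|xF]; apply: IH => // k.
by have := cN k; rewrite big_setU1 //= cy mul0r add0r.
Qed.

(** When a leaf is added, the sign of the new edge corrects the sign at its old
    end, and the sign of the leaf corrects the other one. *)
Lemma grows_signs (N : W -> K -> int) S F :
  grows S F -> (forall x k, k \in inc x -> N x k = 1 \/ N x k = -1) ->
  exists (eps : K -> bool) (del : W -> bool), forall x k, x \in F -> k \in inc x ->
    sgn (del x) * sgn (eps k) * N x k = 1.
Proof.
move=> gSF N1; elim: gSF => {S F} [k|S F y u v gSF [eps [del IH]] uS vS yE].
  by exists (fun=> false), (fun=> false) => x k'; rewrite inE.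
pose d := (N y u == -1) (+) eps u.
exists (fun k => if k == v then (N y v == -1) (+) d else eps k).
exists (fun x => if x == y then d else del x) => x k.
have yF := grows_new gSF vS yE.
have nuv : u != v by apply: contraNneq vS => <-.
have Ns k' : k' \in inc y -> sgn (N y k' == -1) * N y k' = 1.
  by move=> /N1[->|->].
case/setU1P => [->|xF].
  rewrite eqxx yE => /set2P[->|->]; rewrite ?eqxx ?(negbTE nuv) /d /sgn !signr_addb
    -/(sgn _) -!/(sgn _).
    transitivity (sgn (eps u) * sgn (eps u) * (sgn (N y u == -1) * N y u)); first by ring.
    by rewrite sgnM Ns // yE set21.
  transitivity ((sgn (eps u) * sgn (eps u)) * (sgn (N y u == -1) * sgn (N y u == -1))
                 * (sgn (N y v == -1) * N y v)); first by ring.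
  by rewrite !sgnM Ns // yE set22.
move=> kx; rewrite ifN; last by apply: contraNneq yF => <-.
rewrite ifN; first exact: IH.
apply: contraNneq vS => <-; have /subsetP := grows_sub gSF xF; exact.
Qed.

(** Trees are bipartite: y is a proper 2-colouring. *)
Lemma grows_alternate S F : grows S F ->
  exists y : K -> bool, forall x a b, x \in F -> inc x = [set a; b] -> y b = ~~ y a.
Proof.
move=> gSF; elim: gSF => {S F} [k|S F x u v gSF [y IH] uS vS xE].
  by exists (fun=> false) => x a b; rewrite inE.
have nuv : u != v by apply: contraNneq vS => <-.
exists (fun k => if k == v then ~~ y u else y k) => z a b /setU1P[->|zF] E.
  case: (eq_set2 (etrans (esym xE) E)) => -[<- <-]; rewrite eqxx (negbTE nuv) //.
  by rewrite negbK.
have /subsetP sub := grows_sub gSF zF.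
have nv k : k \in inc z -> (k == v) = false.
  by move=> kz; apply: contraNF vS => /eqP <-; apply: sub.
by rewrite !nv ?E ?set21 ?set22 //; apply: IH zF E.
Qed.

Lemma grows_connect S F a b : grows S F -> a \in S -> b \in S -> connect (link F) a b.
Proof.
move=> gSF; elim: gSF a b => {S F} [k|S F x u v gSF IH uS vS xE] a b.
  by rewrite !inE => /eqP-> /eqP->; apply: connect0.
have sub c d : connect (link F) c d -> connect (link (x |: F)) c d.
  apply: connect_sub => {}c {}d /linkP[z zF zE]; apply/connect1/linkP.
  by exists z => //; rewrite inE zF orbT.
have csym : connect_sym (link (x |: F)) := sym_connect_sym (@link_sym_rel _).
have uv : connect (link (x |: F)) u v by apply/connect1/linkP; exists x; rewrite ?setU11.
have cu c : c \in v |: S -> connect (link (x |: F)) u c.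
  by case/setU1P => [->//|cS]; apply/sub/IH.
by move=> /cu ua /cu; apply: connect_trans; rewrite csym.
Qed.

Lemma grows_spanning (A : {set W}) k0 :
  (forall k, connect (link A) k0 k) -> exists2 F : {set W}, F \subset A & grows [set: K] F.
Proof.
move=> cA; suff : forall n (S : {set K}) (F : {set W}), (#|~: S| <= n)%N -> k0 \in S ->
    F \subset A -> grows S F -> exists2 F : {set W}, F \subset A & grows [set: K] F.
  move=> /(_ #|~: [set k0]| [set k0] set0 (leqnn _)); apply; rewrite ?inE ?sub0set //.
  exact: grows0.
elim=> [|n IHn] S F.
  rewrite leqn0 cards_eq0 => /eqP S0 _ FA gSF; exists F => //.
  by rewrite -[S]setCK S0 setC0 in gSF.
have [/eqP -> _ _ FA gSF|] := boolP (S == setT); first by exists F.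
rewrite -subTset => /subsetPn[k _ kS] Sn k0S FA gSF.
have [u [v [uS vS /linkP[x xA xE]]]] := connect_crossing (cA k) k0S kS.
apply: (IHn (v |: S) (x |: F)).
- rewrite -ltnS; apply: leq_trans Sn; apply: proper_card; rewrite properC.
  by apply/properP; split; [apply: subsetUr|exists v; rewrite ?setU11].
- by rewrite inE k0S orbT.
- by rewrite subUset sub1set xA.
- exact: growsS gSF uS vS xE.
Qed.

Lemma alternate_path (y : K -> bool) (A : {set W}) a q :
  (forall x a b, x \in A -> inc x = [set a; b] -> y b = ~~ y a) ->
  path (link A) a q -> y (last a q) = y a (+) odd (size q).
Proof.
move=> yA; elim: q a => [|b q IHq] a /=; first by rewrite addbF.
case/andP=> /linkP[x xA xE] /IHq->; rewrite (yA _ _ _ xA xE).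
by case: (y a); case: (odd _).
Qed.

End Growth.

(** ** Cycles *)

Definition cycle_edges (V : finType) (c : seq V) : {set {set V}} :=
  [set [set x; next c x] | x in c].

Section CycleEdges.
Variables (V : finType) (c : seq V).
Hypotheses (uc : uniq c) (c2 : (2 < size c)%N).

Lemma next_next_neq x : x \in c -> (next c x != x) && (next c (next c x) != x).
Proof.
move=> xc; have [i s E] := rot_to xc.
rewrite -!(next_rot i uc) E.
have : uniq (x :: s) by rewrite -E rot_uniq.
have : size (x :: s) = size c by rewrite -E size_rot.
case: s {E} => [|y [|z s]] sz; try by move: c2; rewrite -sz.
rewrite /= !inE !negb_or => /and3P[/and3P[nxy nxz xs] /andP[nyz ys] _].
by rewrite eqxx [y == x]eq_sym (negbTE nxy) eqxx /= eq_sym nxz.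
Qed.

Lemma cycle_edge_inj : {in c &, injective (fun x => [set x; next c x])}.
Proof.
move=> x y xc yc /eq_set2[[]//|[-> E]].
by have := next_next_neq yc; rewrite E eqxx andbF.
Qed.

Lemma card_cycle_edges : #|cycle_edges c| = size c.
Proof. by rewrite card_in_imset; [apply/card_uniqP|apply: cycle_edge_inj]. Qed.

(** Every vertex lies on an even number of edges of a cycle. *)
Lemma cycle_edges_even k : \sum_(e in cycle_edges c) (k \in e)%:R = 0 :> 'F_2.
Proof.
rewrite big_imset /=; last exact: cycle_edge_inj.
transitivity (\sum_(x in c) ((x == k)%:R + (k == next c x)%:R) : 'F_2).
  apply: eq_bigr => x xc; rewrite !inE [k == x]eq_sym.
  have /andP[nx _] := next_next_neq xc.
  case: eqP => [<-|_]; last by rewrite add0r.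
  by rewrite [x == _]eq_sym (negbTE nx) addr0.
have two : 1 + 1 = 0 :> 'F_2 by apply: val_inj.
rewrite big_split /=; have [kc|kc] := boolP (k \in c); last first.
  rewrite big1 ?add0r => [|x xc]; last first.
    by rewrite (_ : (x == k) = false) //; apply: contraNF kc => /eqP <-.
  rewrite big1 // => x xc; rewrite (_ : (k == next c x) = false) //.
  by apply: contraNF kc => /eqP ->; rewrite mem_next.
have one y : y \in c -> \sum_(x in c) (x == y)%:R = 1 :> 'F_2.
  move=> yc; rewrite (bigD1 y) //= eqxx big1 ?addr0 // => x /andP[_ /negbTE->] //.
rewrite one // -[RHS]two; congr (_ + _); rewrite -[RHS](one (prev c k)); last by rewrite mem_prev.
apply: eq_bigr => x xc; congr (nat_of_bool _)%:R; apply/eqP/eqP => ->.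
  by rewrite prev_next.
by rewrite next_prev.
Qed.

Lemma cycle_edges_sub (G : graph V) : cycle G c -> cycle_edges c \subset edges G.
Proof.
move=> cG; apply/subsetP => _ /imsetP[x xc ->]; rewrite inE.
apply/existsP; exists x; apply/existsP; exists (next c x).
by rewrite eqxx andbT (next_cycle cG).
Qed.

End CycleEdges.

Lemma is_cycleP (V : finType) (G : graph V) C :
  is_cycle G C <-> exists c, [/\ (2 < size c)%N, uniq c, cycle G c & C = cycle_edges c].
Proof.
split=> -[c]; first by case=> c2 /andP[cG uc] CE; exists c.
by case=> c2 uc cG CE; exists c; split=> //; apply/andP.
Qed.

Section GrowthCycles.
Variables (K W : finType) (inc : W -> {set K}).

(** Modulo 2 the edges of a cycle are dependent. *)
Lemma grows_acyclic S F c : grows inc S F -> uniq c -> (2 < size c)%N ->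
  cycle_edges c \subset inc @: F -> False.
Proof.
move=> gSF uc c2 /subsetP sub.
pose N x k : 'F_2 := (k \in inc x)%:R; pose d x : 'F_2 := (inc x \in cycle_edges c)%:R.
have N0 x k : (N x k != 0) = (k \in inc x) by rewrite /N; case: (k \in _).
have dN k : \sum_(x in F) d x * N x k = 0.
  rewrite -[RHS](cycle_edges_even uc c2 k).
  transitivity (\sum_(e in inc @: F) (e \in cycle_edges c)%:R * (k \in e)%:R : 'F_2).
    by rewrite big_imset //=; apply: grows_inj gSF.
  rewrite big_mkcond [RHS]big_mkcond; apply: eq_bigr => e _ /=.
  case: ifP => eF; case: ifP => eC; rewrite ?mul1r ?mul0r //.
  by rewrite sub in eF.
have [x xc] : exists x, x \in c by case: (c) c2 => // x s _; exists x; rewrite mem_head.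
have xE : [set x; next c x] \in cycle_edges c by apply: imset_f.
have /imsetP[y yF yE] := sub _ xE.
by have := grows_indep gSF N0 dN yF; rewrite /d -yE xE.
Qed.

(** Both cycles contain p, so their sum modulo 2 is supported on the tree F and
    vanishes by independence. *)
Lemma cycle_edges_unique S F p c d : grows inc S F ->
  uniq c -> (2 < size c)%N -> uniq d -> (2 < size d)%N ->
  cycle_edges c \subset inc @: (p |: F) -> cycle_edges d \subset inc @: (p |: F) ->
  cycle_edges c = cycle_edges d.
Proof.
move=> gSF uc c2 ud d2 subc subd.
have pin e : uniq e -> (2 < size e)%N -> cycle_edges e \subset inc @: (p |: F) ->
    inc p \in cycle_edges e.
  move=> ue e2 /subsetP sub; apply/idPn => npe.
  apply: (@grows_acyclic S F e) => //; apply/subsetP => f fe.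
  have /imsetP[x /setU1P[xp|xF] fE] := sub f fe; last by rewrite fE imset_f.
  by rewrite fE xp in fe; rewrite fe in npe.
have pc := pin c uc c2 subc; have pd' := pin d ud d2 subd.
have npF : inc p \notin inc @: F.
  apply/negP => pF; apply: (@grows_acyclic S F c) => //.
  by apply: subset_trans subc _; rewrite imsetU1 subUset sub1set pF subxx.
pose N x k : 'F_2 := (k \in inc x)%:R.
pose h x : 'F_2 := (inc x \in cycle_edges c)%:R + (inc x \in cycle_edges d)%:R.
have N0 x k : (N x k != 0) = (k \in inc x) by rewrite /N; case: (k \in _).
have two : 1 + 1 = 0 :> 'F_2 by apply: val_inj.
have sumE e k : uniq e -> (2 < size e)%N -> cycle_edges e \subset inc @: (p |: F) ->
    \sum_(x in F) (inc x \in cycle_edges e)%:R * N x k = - (k \in inc p)%:R.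
  move=> ue e2 sub; have := cycle_edges_even ue e2 k.
  rewrite (big_setD1 (inc p)) ?pin //= => /eqP; rewrite addr_eq0 => /eqP ->; rewrite opprK.
  transitivity (\sum_(f in inc @: F) (f \in cycle_edges e)%:R * (k \in f)%:R : 'F_2).
    by rewrite big_imset //=; apply: grows_inj gSF.
  rewrite big_mkcond [RHS]big_mkcond; apply: eq_bigr => f _ /=.
  rewrite in_setD1; case: ifP => fF; case: ifP => /andP fC; rewrite ?mul1r ?mul0r //.
  - by have [_ ->] := fC; rewrite mul1r.
  - case: (boolP (f \in _)) fC => fe fC; rewrite ?mul0r //; case: fC; split=> //.
    by apply: contraNneq npF => <-.
  - have [fp fe] := fC; have /imsetP[x /setU1P[xp|xF] fE] := subsetP sub f fe.
      by rewrite fE xp eqxx in fp.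
    by rewrite fE imset_f in fF.
have hN k : \sum_(x in F) h x * N x k = 0.
  under eq_bigr => x _ do rewrite mulrDl.
  rewrite big_split /= !sumE // -opprD; case: (k \in inc p); rewrite ?two ?addr0 oppr0 //.
have heq := grows_indep gSF N0 hN.
apply/setP => f; have [fF|fF] := boolP (f \in inc @: (p |: F)); last first.
  have [fc fd] := (contra (subsetP subc f) fF, contra (subsetP subd f) fF).
  by rewrite (negbTE fc) (negbTE fd).
have /imsetP[x /setU1P[->|xF] ->] := fF; first by rewrite pc pd'.
by have := heq x xF; rewrite /h; case: (_ \in _); case: (_ \in _).
Qed.

(** The fundamental cycle of an edge p outside the tree F. *)
Lemma fundamental_cycle S F p a b : grows inc S F -> a \in S -> b \in S -> a != b ->
  inc p = [set a; b] -> inc p \notin inc @: F ->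
  exists q, [/\ uniq (a :: q), path (link inc F) a q, last a q = b, (2 < size (a :: q))%N
              & [/\ inc p \in cycle_edges (a :: q)
              & cycle_edges (a :: q) \subset inc @: (p |: F)]].
Proof.
move=> gSF aS bS nab pE npF.
have /connectP[q0 pq0 bE0] := grows_connect gSF aS bS.
case/shortenP: pq0 bE0 => q pq uq _ bE.
have sz : (2 < size (a :: q))%N.
  case: q pq uq bE => [|c [|d q]] //=; first by move=> _ _ E; rewrite E eqxx in nab.
  move=> /andP[/linkP[x xF xE] _] _ cE; case/negP: npF.
  by rewrite pE cE -xE imset_f.
have edgeE x : x \in a :: q -> (x = b /\ next (a :: q) x = a) \/
    link inc F x (next (a :: q) x).
  move=> xq; rewrite next_nth xq.
  have : (index x (a :: q) < (size q).+1)%N by rewrite -[(size q).+1]/(size (a :: q)) index_mem.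
  have := nth_index a xq; move: (index x (a :: q)) => i xE.
  rewrite ltnS leq_eqVlt => /orP[/eqP iE|ilt].
    left; rewrite nth_default ?iE //; split=> //.
    by rewrite bE (last_nth a) -iE.
  by right; have /(pathP a)/(_ _ ilt) := pq; rewrite xE.
have bq : b \in a :: q by rewrite bE mem_last.
have nextb : next (a :: q) b = a.
  by rewrite next_nth bq bE index_last // nth_default.
exists q; split=> //; split.
  by apply/imsetP; exists b; rewrite // nextb pE setUC.
apply/subsetP => _ /imsetP[x xq ->]; case: (edgeE x xq) => [[-> ->]|/linkP[y yF <-]].
  by rewrite setUC -pE imset_f ?setU11.
by rewrite imset_f // inE yF orbT.
Qed.

End GrowthCycles.

(** ** Graphs and their edges *)

Section LineVertices.
Variables (V : finType) (H : graph V).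

Lemma adj_neq a b : H a b -> a != b.
Proof. by apply: contraTneq => ->; rewrite adj_irr. Qed.

Lemma line_vertexP (e : line_vertex H) :
  exists a b, [/\ a != b, H a b & val e = [set a; b]].
Proof.
have := valP e; rewrite inE => /existsP[a /existsP[b /andP[Hab /eqP eE]]].
by exists a, b; split=> //; apply: adj_neq.
Qed.

Lemma line_vertex_of a b : H a b -> exists e : line_vertex H, val e = [set a; b].
Proof.
move=> Hab; have abE : [set a; b] \in edges H.
  by rewrite inE; apply/existsP; exists a; apply/existsP; exists b; rewrite Hab eqxx.
by exists (Sub [set a; b] abE : line_vertex H); rewrite SubK.
Qed.

Lemma line_vertex_adj (e : line_vertex H) a b : val e = [set a; b] -> H a b.
Proof.
have [c [d [_ Hcd ->]]] := line_vertexP e.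
by move/eq_set2 => [[<- <-]|[<- <-]] //; rewrite adj_sym.
Qed.

Let inc (e : line_vertex H) : {set V} := val e.

Lemma link_line_vertex a b : link inc setT a b = H a b.
Proof.
apply/linkP/idP => [[e _]|Hab]; first exact: line_vertex_adj.
by have [e eE] := line_vertex_of Hab; exists e.
Qed.

Lemma link_adj (A : {set line_vertex H}) a b : link inc A a b -> H a b.
Proof. by case/linkP => e _; apply: line_vertex_adj. Qed.

Lemma fundamental_is_cycle F (p : line_vertex H) : grows inc setT F -> p \notin F ->
  exists2 c, is_cycle H (cycle_edges c) & cycle_edges c \subset inc @: (p |: F).
Proof.
move=> gF pF; have [a [b [nab Hab pE]]] := line_vertexP p.
have npF : inc p \notin inc @: F by apply: contra pF => /imsetP[e eF /val_inj->].
have [q [uq pq lq sq [_ sub]]] :=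
  fundamental_cycle gF (in_setT a) (in_setT b) nab pE npF.
exists (a :: q) => //; apply/is_cycleP; exists (a :: q); split=> //.
rewrite /cycle rcons_path lq adj_sym Hab andbT.
by apply: sub_path pq => c d; apply: link_adj.
Qed.

(** An edge outside a spanning tree would close a cycle. *)
Lemma tree_grows : is_tree H -> grows inc setT setT.
Proof.
case=> -[V0 cH] acyc _; have /card_gt0P[x0 _] := V0.
have [k|F _ gF] := grows_spanning (inc := inc) (A := setT) (k0 := x0).
  by rewrite (eq_connect link_line_vertex).
suff -> : setT = F by [].
symmetry; apply/eqP; rewrite -subTset; apply/subsetP => p _; apply/idPn => pF.
by have [c /acyc] := fundamental_is_cycle gF pF.
Qed.

(** Removing an edge u of its cycle turns a unicyclic graph into a tree, in which
    the rest of the cycle joins the ends of u. *)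
Lemma unicyclic_grows C (u : line_vertex H) : unicyclic H C -> val u \in C ->
  grows inc setT (~: [set u]) /\
  exists a b q, [/\ a != b, val u = [set a; b], path (link inc (~: [set u])) a q,
                    last a q = b & (size q).+1 = #|C|].
Proof.
case=> -[V0 cH] uniqC uC.
have /is_cycleP[c [c2 uc cc CE]] : is_cycle H C by apply/uniqC.
move: uC; rewrite CE => /imsetP[x xc uE].
have [i q rE] := rot_to (etrans (mem_next c x) xc).
set a := next c x in rE uE.
have uq : uniq (a :: q) by rewrite -rE rot_uniq.
have cq : cycle H (a :: q) by rewrite -rE rot_cycle.
have sq : size (a :: q) = size c by rewrite -rE size_rot.
have nextq : next (a :: q) =1 next c by move=> z; rewrite -rE next_rot.
have memq : a :: q =i c by move=> z; rewrite -rE mem_rot.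
have lq : last a q = x.
  have : next (a :: q) (last a q) = next (a :: q) x.
    by rewrite [RHS]nextq next_nth mem_last index_last // nth_default.
  by move/(can_inj (prev_next uq)).
have pH : path H a q by move: cq; rewrite /cycle rcons_path => /andP[].
have pq : path (link inc (~: [set u])) a q.
  apply/(pathP a) => k kq; have Hk := (pathP a pH) k kq.
  have [e eE] := line_vertex_of Hk; apply/linkP; exists e => //.
  rewrite !inE; apply/eqP => eu; have kE : nth a (a :: q) k = x.
    have kin : nth a (a :: q) k \in a :: q by rewrite mem_nth //= ltnW.
    apply: (cycle_edge_inj uc c2) => //; first by rewrite -memq.
    rewrite -uE -eu eE -nextq next_nth kin index_uniq //= ltnW //.
  have : nth a (a :: q) k == nth a (a :: q) (size q) by rewrite kE -lq (last_nth a).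
  by rewrite nth_uniq //= ?ltnS 1?ltnW // => /eqP kE'; rewrite kE' ltnn in kq.
have conn z : connect (link inc (~: [set u])) a z.
  have csym := sym_connect_sym (@link_sym_rel _ _ inc (~: [set u])).
  have ax : connect (link inc (~: [set u])) a x by apply/connectP; exists q.
  apply: connect_sub (cH a z) => y w Hyw; have [e eE] := line_vertex_of Hyw.
  have [eu|neu] := eqVneq e u; last by apply/connect1/linkP; exists e; rewrite ?inE.
  move: eE; rewrite eu uE => /eq_set2[[<- <-]|[<- <-]] //.
  by rewrite csym.
have [F FA gF] := grows_spanning conn.
have FE : F = ~: [set u].
  apply/eqP; rewrite eqEsubset FA /=; apply/subsetP => p pu; apply/idPn => pF.
  have [d /uniqC dE /subsetP sub] := fundamental_is_cycle gF pF.
  have uC : inc u \in cycle_edges d by rewrite dE CE /inc uE; apply/imsetP; exists x.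
  have /imsetP[w wpF /val_inj uw] := sub _ uC; subst w.
  case/setU1P: wpF pu => [->|uF]; rewrite !inE ?eqxx //.
  by have := subsetP FA u uF; rewrite !inE eqxx.
rewrite -{1}FE; split=> //; exists a, x, q; split=> //.
- by have /andP[] := next_next_neq uc c2 xc.
- by rewrite uE setUC.
- by rewrite card_cycle_edges // -sq.
Qed.

End LineVertices.

Section EdgeGraph.
Variables (K : finType) (E : {set {set K}}).

Let adjE : rel K := fun a b => (a != b) && ([set a; b] \in E).

Lemma edge_graph_sym : symmetric adjE.
Proof. by move=> a b; rewrite /adjE eq_sym setUC. Qed.

Lemma edge_graph_irr : irreflexive adjE.
Proof. by move=> a; rewrite /adjE eqxx. Qed.

Definition edge_graph : graph K := Graph edge_graph_sym edge_graph_irr.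

Lemma edges_edge_graph : (forall e, e \in E -> exists a b, a != b /\ e = [set a; b]) ->
  edges edge_graph = E.
Proof.
move=> pairE; apply/setP => e; rewrite inE; apply/existsP/idP.
  by case=> a /existsP[b /andP[/andP[_ abE] /eqP->]].
move=> eE; have [a [b [nab eab]]] := pairE e eE.
by exists a; apply/existsP; exists b; rewrite /= /adjE nab -eab eE eqxx.
Qed.

End EdgeGraph.

Section GrownGraphs.
Variables (K W : finType) (inc : W -> {set K}).

Lemma edge_graph_connected (F A : {set W}) : grows inc setT F -> F \subset A ->
  gconnected (edge_graph (inc @: A)).
Proof.
move=> gF FA; split.
  by rewrite -cardsT (grows_card gF).
move=> x y; apply: connect_sub (grows_connect gF (in_setT x) (in_setT y)) => a b.
case/linkP => e eF eE; apply: connect1; rewrite /= -eE imset_f ?andbT ?(subsetP FA) //.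
have [c [d [ncd]]] := grows_pair gF eF; rewrite eE.
by move/eq_set2 => [[-> ->]|[-> ->]] //; rewrite eq_sym.
Qed.

Lemma grows_tree F : grows inc setT F -> F != set0 -> is_tree (edge_graph (inc @: F)).
Proof.
move=> gF /set0Pn[x xF]; have [a [b [nab xE]]] := grows_pair gF xF.
have edgesF : edges (edge_graph (inc @: F)) = inc @: F.
  apply: edges_edge_graph => e /imsetP[y yF ->]; exact: grows_pair gF yF.
split; first exact: edge_graph_connected gF (subxx _).
- move=> C /is_cycleP[c [c2 uc cc _]]; apply: (grows_acyclic gF uc c2).
  by rewrite -edgesF; apply: cycle_edges_sub.
- by exists a, b; rewrite /= nab -xE imset_f.
Qed.

Lemma grows_unicyclic F p a b : grows inc setT F -> a != b -> inc p = [set a; b] ->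
  inc p \notin inc @: F ->
  exists q, [/\ uniq (a :: q), path (link inc F) a q, last a q = b, (2 < size (a :: q))%N
     & [/\ inc p \in cycle_edges (a :: q)
         & unicyclic (edge_graph (inc @: (p |: F))) (cycle_edges (a :: q))]].
Proof.
move=> gF nab pE npF; set H := edge_graph _.
have [q [uq pq lq sq [pC sub]]] :=
  fundamental_cycle gF (in_setT a) (in_setT b) nab pE npF.
have edgesH : edges H = inc @: (p |: F).
  apply: edges_edge_graph => e /imsetP[y /setU1P[->|yF] ->]; first by exists a, b.
  exact: grows_pair gF yF.
exists q; split=> //; split=> //; split; first by apply: edge_graph_connected gF (subsetUr _ _).
move=> D; split.
  case/is_cycleP => c [c2 uc cc ->]; apply: (@cycle_edges_unique _ _ _ _ _ p _ _ gF) => //.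
  by rewrite -edgesH; apply: cycle_edges_sub.
move=> ->; apply/is_cycleP; exists (a :: q); split=> //.
have baE : [set b; a] = inc p by rewrite pE setUC.
rewrite /cycle rcons_path lq /= eq_sym nab baE imset_f ?setU11 // !andbT.
apply: sub_path pq => c d /linkP[y yF yE]; rewrite -yE imset_f ?inE ?yF ?orbT // andbT.
have [c' [d' [ncd]]] := grows_pair gF yF; rewrite yE.
by move/eq_set2 => [[-> ->]|[-> ->]] //; rewrite eq_sym.
Qed.

Hypothesis inc_pair : forall x, exists a b, a != b /\ inc x = [set a; b].

Lemma edges_imset (E : {set W}) : edges (edge_graph (inc @: E)) = inc @: E.
Proof. by apply: edges_edge_graph => e /imsetP[x _ ->]. Qed.

Lemma card_line_vertex (E : {set W}) : {in E &, injective inc} ->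
  #|line_vertex (edge_graph (inc @: E))| = #|E|.
Proof.
by move=> injE; rewrite card_sig -(card_in_imset injE) -[in RHS]edges_imset; apply: eq_card.
Qed.

Lemma line_vertex_bij : injective inc ->
  exists f : W -> line_vertex (edge_graph (inc @: setT)),
    bijective f /\ forall x, val (f x) = inc x.
Proof.
move=> inj_inc; have ex x : inc x \in edges (edge_graph (inc @: setT)).
  by rewrite edges_imset imset_f.
exists (fun x => Sub (inc x) (ex x)); split=> [|x]; last exact: SubK.
apply: inj_card_bij => [x y /(congr1 val)|]; first by rewrite !SubK => /inj_inc.
by rewrite card_line_vertex ?cardsT // => x y _ _; apply: inj_inc.
Qed.

Lemma twin_vertex_bij p : {in ~: [set p] &, injective inc} ->
  exists f : W -> option (line_vertex (edge_graph (inc @: ~: [set p]))),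
    [/\ bijective f, f p = None
      & forall x, x != p -> exists2 e, f x = Some e & val e = inc x].
Proof.
move=> injF; pose L := line_vertex (edge_graph (inc @: ~: [set p])).
pose f x : option L := if x == p then None else insub (inc x).
have fE x : x != p -> exists2 e, f x = Some e & val e = inc x.
  move=> xp; have ex : inc x \in edges (edge_graph (inc @: ~: [set p])).
    by rewrite edges_imset imset_f // !inE.
  by exists (Sub (inc x) ex); rewrite ?SubK // /f (negbTE xp) insubT.
have fp : f p = None by rewrite /f eqxx.
exists f; split=> //; apply: inj_card_bij => [x y|].
  have [->|xp] := eqVneq x p; have [->|yp] := eqVneq y p => //.
  - by have [e -> _] := fE y yp; rewrite fp.
  - by have [e -> _] := fE x xp; rewrite fp.
  have [e -> eE] := fE x xp; have [e' -> eE'] := fE y yp => -[ee'].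
  by apply: injF; rewrite ?inE // -eE -eE' ee'.
rewrite card_option card_line_vertex //.
by rewrite -[X in (_ <= X)%N](cardsC [set p]) cards1.
Qed.

End GrownGraphs.

(** * Integral coordinates of line graphs *)

Definition ind (K : finType) (e : {set K}) (k : K) : int := (k \in e)%:R.

Lemma sum_pair (K : finType) (g : K -> int) a b : a != b ->
  (forall k, k \notin [set a; b] -> g k = 0) -> \sum_k g k = g a + g b.
Proof.
move=> nab g0; rewrite (bigD1 a) //= (bigD1 b) 1?eq_sym //= big1 ?addr0 // => k.
by case/andP=> ka kb; apply: g0; rewrite !inE negb_or ka.
Qed.

Lemma sum_ind (K : finType) (g : K -> int) a b : a != b ->
  \sum_k ind [set a; b] k * g k = g a + g b.
Proof.
move=> nab; rewrite (sum_pair nab) => [|k kab].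
  by rewrite /ind set21 set22 !mul1r.
by rewrite /ind (negbTE kab) mul0r.
Qed.

Lemma meet_pair (K : finType) (a b : K) (f : {set K}) :
  ([set a; b] :&: f != set0) = (a \in f) || (b \in f).
Proof.
apply/set0Pn/orP => [[k]|[af|bf]]; last by exists b; rewrite !inE eqxx orbT.
  by rewrite !inE => /andP[/pred2P[]-> ->]; auto.
by exists a; rewrite !inE eqxx.
Qed.

Lemma pair_contained (K : finType) (a b : K) (f : {set K}) :
  a != b -> (exists c d, f = [set c; d]) -> a \in f -> b \in f -> f = [set a; b].
Proof.
move=> nab [c [d ->]] /set2P[]ac /set2P[]bd; move: nab; rewrite ac bd ?eqxx //.
by rewrite setUC.
Qed.

Section LineGraphCoordinates.
Variables (V : finType) (H : graph V).

Lemma not_both (e f : line_vertex H) a b : e != f -> val e = [set a; b] ->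
  ~~ ((a \in val f) && (b \in val f)).
Proof.
move=> nef eE; apply: contra nef => /andP[af bf].
have [c [d [_ _ fE]]] := line_vertexP f.
have nab : a != b by apply: (@adj_neq _ H); apply: line_vertex_adj eE.
apply/eqP/val_inj; rewrite /= eE; symmetry; apply: pair_contained => //.
by exists c, d.
Qed.

Lemma line_ind (e f : line_vertex H) :
  \sum_k ind (val e) k * ind (val f) k =
  if e == f then 2 else (line_graph H e f)%:R.
Proof.
have [a [b [nab _ eE]]] := line_vertexP e.
rewrite eE (sum_ind _ nab) /ind; have [<-|nef] := eqVneq e f.
  by rewrite eE set21 set22.
rewrite /= /line_rel nef eE meet_pair /=.
by have := not_both nef eE; case: (a \in _); case: (b \in _).
Qed.

Lemma line_graph_gram (e f : line_vertex H) :
  gram (all_pos (line_graph H)) e f = \sum_k ind (val e) k * ind (val f) k.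
Proof.
rewrite line_ind /gram; case: eqP => // _.
by rewrite /sadj /= andbT andbF; case: (line_rel _ _).
Qed.

(** The coordinates of the twin are e_v - e_w. *)
Definition twin_vec (v w : V) (e : option (line_vertex H)) (k : V) : int :=
  if e is Some e then ind (val e) k else (k == v)%:R - (k == w)%:R.

Lemma sum_twin (v w : V) (g : V -> int) :
  \sum_k ((k == v)%:R - (k == w)%:R) * g k = g v - g w.
Proof.
under eq_bigr => k _ do rewrite mulrC mulrBr.
by rewrite sumrB !sum_delta.
Qed.

Lemma line_twin_gram v w e f : v != w ->
  gram (line_twin H v w) e f = \sum_k twin_vec v w e k * twin_vec v w f k.
Proof.
move=> nvw; have mixed (x : line_vertex H) : gram (line_twin H v w) None (Some x)
    = \sum_k twin_vec v w None k * twin_vec v w (Some x) k.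
  rewrite /= sum_twin /gram /sadj /= /twin_nbr /ind orbF.
  have [xE|nx] /= := eqVneq (val x) [set v; w]; first by rewrite xE set21 set22.
  have [c [d [_ _ xE]]] := line_vertexP x.
  have : ~~ ((v \in val x) && (w \in val x)).
    by apply: contra nx => /andP[vx wx]; apply/eqP/pair_contained => //; exists c, d.
  by case: (v \in _); case: (w \in _).
case: e f => [e|] [f|] //.
- rewrite -line_graph_gram /gram (inj_eq (@Some_inj _)).
  by rewrite /sadj /= !andbF !andbT.
- rewrite gram_sym mixed; by apply: eq_bigr => k _; rewrite mulrC.
- by rewrite gram_diag /= sum_twin !eqxx [w == v]eq_sym (negbTE nvw).
Qed.

End LineGraphCoordinates.

Section DaggerCoordinates.
Variables (V : finType) (H : graph V) (u u' : line_vertex H) (a b : V).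
Hypotheses (nuu' : u != u') (uE : val u = [set a; b]) (bu' : b \in val u').
Hypothesis no_triangle : forall x y z, H x y -> H y z -> H z x -> False.

(** Without triangles, the edges that meet two edges with common end b all
    contain b. *)
Lemma max_clique_star y : (y \in max_clique (line_graph H) u u') = (b \in val y).
Proof.
have Hab : H a b by apply: line_vertex_adj uE.
have [c [nbc u'E]] : exists c, c != a /\ val u' = [set b; c].
  have [d [e [nde Hde dE]]] := line_vertexP u'.
  have := bu'; rewrite dE => /set2P[] bE; [exists e|exists d]; rewrite bE.
    split=> //; apply: contra_neq nuu' => ea; apply: val_inj.
    by rewrite /= uE dE bE ea setUC.
  split; last by rewrite setUC.
  by apply: contra_neq nuu' => da; apply: val_inj; rewrite /= uE dE bE da.
have sub (Q : {set line_vertex H}) z : is_clique (line_graph H) Q ->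
    u \in Q -> u' \in Q -> z \in Q -> b \in val z.
  move=> /'forall_in_'forall_in_implyP clQ uQ u'Q zQ; apply/idPn => bz.
  have nzu : z != u by apply: contraNneq bz => ->; rewrite uE set22.
  have nzu' : z != u' by apply: contraNneq bz => ->.
  have /= := clQ u uQ z zQ; rewrite eq_sym nzu /line_rel eq_sym nzu uE meet_pair.
  rewrite (negbTE bz) orbF => /(_ isT) /= az.
  have /= := clQ u' u'Q z zQ; rewrite eq_sym nzu' /line_rel eq_sym nzu' u'E meet_pair.
  rewrite (negbTE bz) => /(_ isT) /= cz.
  have [d [e [_ _ zE]]] := line_vertexP z.
  have zac : val z = [set a; c] by apply: pair_contained => //; [rewrite eq_sym|exists d, e].
  apply: (no_triangle Hab); first exact: line_vertex_adj u'E.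
  by apply: (line_vertex_adj (e := z)); rewrite zac setUC.
apply/bigcupP/idP => [[Q /and3P[/maxsetP[clQ _] uQ u'Q] yQ]|by_]; first exact: sub clQ uQ u'Q yQ.
pose star := [set z : line_vertex H | b \in val z].
have uS : u \in star by rewrite inE uE set22.
have u'S : u' \in star by rewrite inE.
exists star; last by rewrite inE.
rewrite uS u'S !andbT; apply/maxsetP; split.
  apply/'forall_in_'forall_in_implyP => x; rewrite inE => bx z; rewrite inE => bz nxz.
  by rewrite /= /line_rel nxz; apply/set0Pn; exists b; rewrite inE bx.
move=> Q clQ /subsetP SQ; apply/eqP; rewrite eqEsubset; apply/andP; split; last exact/subsetP.
by apply/subsetP => z zQ; rewrite inE; apply: sub clQ _ _ zQ; apply: SQ.
Qed.

(** The sign at the end b of u is reversed. *)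
Definition dagger_vec (e : line_vertex H) (k : V) : int :=
  sgn ((e == u) && (k == b)) * ind (val e) k.

Lemma line_dagger_gram e f :
  gram (line_dagger u u') e f = \sum_k dagger_vec e k * dagger_vec f k.
Proof.
have nab : a != b by apply: (@adj_neq _ H); apply: line_vertex_adj uE.
have mixed (x : line_vertex H) : x != u ->
    gram (line_dagger u u') u x = \sum_k dagger_vec u k * dagger_vec x k.
  move=> nxu; transitivity (ind (val x) a - ind (val x) b); last first.
    transitivity (\sum_k ind (val u) k * (sgn (k == b) * ind (val x) k)).
      rewrite uE (sum_ind _ nab) (negbTE nab) eqxx !mulN1r mul1r //.
    apply: eq_bigr => k _; rewrite /dagger_vec eqxx (negbTE nxu) /= mul1r; ring.
  rewrite /gram eq_sym (negbTE nxu) /sadj /= eqxx /= (negbTE nxu) orbF max_clique_star.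
  rewrite /line_rel eq_sym nxu uE meet_pair /ind.
  have := @not_both _ H u x a b _ uE; rewrite eq_sym nxu => /(_ isT).
  by case: (a \in _); case: (b \in _).
have [eu|neu] := eqVneq e u; have [fu|nfu] := eqVneq f u.
- rewrite eu fu gram_diag (eq_bigr (fun k => ind (val u) k * ind (val u) k)).
    by rewrite line_ind eqxx.
  by move=> k _; rewrite /dagger_vec mulrACA sgnM mul1r.
- by rewrite eu mixed.
- by rewrite fu gram_sym mixed //; apply: eq_bigr => k _; rewrite mulrC.
- rewrite (eq_bigr (fun k => ind (val e) k * ind (val f) k)); last first.
    by move=> k _; rewrite /dagger_vec (negbTE neu) (negbTE nfu) !mul1r.
  rewrite line_ind /gram; case: eqP => // _.
  by rewrite /sadj /= (negbTE neu) (negbTE nfu) andbT andbF; case: (line_rel _ _).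
Qed.

End DaggerCoordinates.

Lemma even_unicyclic_no_triangle (V : finType) (H : graph V) C :
  unicyclic H C -> ~~ odd #|C| -> forall x y z, H x y -> H y z -> H z x -> False.
Proof.
move=> [_ uniqC] evC x y z xy yz zx.
have nxy := adj_neq xy; have nyz := adj_neq yz; have nzx := adj_neq zx.
have u3 : uniq [:: x; y; z] by rewrite /= !inE negb_or nxy nyz andbT eq_sym nzx.
have CE : cycle_edges [:: x; y; z] = C.
  apply/uniqC/is_cycleP; exists [:: x; y; z]; split=> //.
  by rewrite /= xy yz zx.
by move: evC; rewrite -CE card_cycle_edges.
Qed.

(** ** The families are positive definite *)

Section IndependentRows.
Variables (K W : finType) (inc : W -> {set K}) (N : W -> K -> int).
Hypothesis NE : forall x k, (N x k != 0) = (k \in inc x).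

Let NC x k : algC := (N x k)%:~R.

Let NCE x k : (NC x k != 0) = (k \in inc x).
Proof. by rewrite /NC intr_eq0 NE. Qed.

Lemma tree_rows_free : grows inc setT setT -> forall c : W -> algC,
  (forall k, \sum_x c x * NC x k = 0) -> forall x, c x = 0.
Proof.
move=> gT c cN x; apply: (grows_indep gT NCE _ (in_setT x)) => k.
by rewrite -[RHS](cN k); apply: eq_bigl => y; rewrite inE.
Qed.

(** A vector z orthogonal to the edges of the tree, but not to the additional
    edge p, isolates the coefficient of p. *)
Lemma extra_row_free p (z : K -> int) : grows inc setT (~: [set p]) ->
  (forall x, x != p -> \sum_k N x k * z k = 0) -> \sum_k N p k * z k != 0 ->
  forall c : W -> algC, (forall k, \sum_x c x * NC x k = 0) -> forall x, c x = 0.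
Proof.
move=> gF zF zp c cN.
have cp : c p = 0.
  have : \sum_x c x * (\sum_k N x k * z k)%:~R = 0.
    transitivity (\sum_k (\sum_x c x * NC x k) * (z k)%:~R); last first.
      by rewrite big1 // => k _; rewrite cN mul0r.
    under [RHS]eq_bigr => k _ do rewrite mulr_suml.
    rewrite exchange_big; apply: eq_bigr => x _ /=.
    rewrite rmorph_sum mulr_sumr; apply: eq_bigr => k _ /=.
    by rewrite rmorphM /= mulrA.
  rewrite (bigD1 p) //= [X in _ + X]big1 ?addr0 => [/eqP|x xp]; last by rewrite zF // mulr0.
  by rewrite mulf_eq0 intr_eq0 (negbTE zp) orbF => /eqP.
move=> x; have [->//|xp] := eqVneq x p.
apply: (grows_indep gF NCE); last by rewrite !inE.
move=> k; rewrite -[RHS](cN k) [RHS](bigD1 p) //= cp mul0r add0r.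
by apply: eq_bigl => y; rewrite !inE.
Qed.

End IndependentRows.

Lemma grows_imset (K W W' : finType) (inc : W -> {set K}) (inc' : W' -> {set K}) (g : W -> W') S F :
  (forall x, inc' (g x) = inc x) -> grows inc S F -> grows inc' S (g @: F).
Proof.
move=> gE; elim=> {S F} [k|S F x u v _ IH uS vS xE]; first by rewrite imset0; apply: grows0.
by rewrite imsetU1; apply: growsS IH uS vS _; rewrite gE.
Qed.

Lemma sgn_opp b : sgn (~~ b) = - sgn b.
Proof. by case: b. Qed.

Lemma tree_pd (V : finType) (H : graph V) : is_tree H -> pd (gram (all_pos (line_graph H))).
Proof.
move=> /tree_grows gT.
apply: (@pd_coords _ _ _ (fun e k => ind (val e) k) 1) => // [e f|].
  by rewrite mul1r line_graph_gram.
apply: tree_rows_free gT => e k; rewrite /ind; by case: (k \in _).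
Qed.

Lemma odd_unicyclic_pd (V : finType) (H : graph V) C :
  unicyclic H C -> odd #|C| -> pd (gram (all_pos (line_graph H))).
Proof.
move=> uniC oddC; have [_ uniqC] := uniC.
have /is_cycleP[c [c2 uc cc CE]] : is_cycle H C by apply/uniqC.
have [x xc] : exists x, x \in c by case: (c) c2 => // x s _; exists x; rewrite mem_head.
have xC : [set x; next c x] \in C by rewrite CE; apply/imsetP; exists x.
have xH : [set x; next c x] \in edges H.
  by apply: (subsetP (cycle_edges_sub cc)); rewrite -CE.
pose u : line_vertex H := Sub [set x; next c x] xH.
have [gF [a [b [q [nab uE pq lq sq]]]]] := unicyclic_grows (u := u) uniC xC.
have [y yF] := grows_alternate gF.
have yb := alternate_path yF pq; rewrite lq in yb.
apply: (@pd_coords _ _ _ (fun e k => ind (val e) k) 1) => // [e f|].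
  by rewrite mul1r line_graph_gram.
apply: (extra_row_free (z := fun k => sgn (y k)) _ gF).
- by move=> e k; rewrite /ind; case: (k \in _).
- move=> e eu; have [a' [b' [nab' _ eE]]] := line_vertexP e.
  rewrite eE (sum_ind _ nab') (yF e a' b') ?inE //.
  by rewrite sgn_opp addrN.
- rewrite uE (sum_ind _ nab) yb (_ : odd (size q) = false) ?addbF; first by case: (y a).
  by move: oddC; rewrite -sq /= => /negbTE.
Qed.

Lemma even_unicyclic_pd (V : finType) (H : graph V) C (u u' : line_vertex H) :
  unicyclic H C -> ~~ odd #|C| -> val u \in C -> val u' \in C -> line_graph H u u' ->
  pd (gram (line_dagger u u')).
Proof.
move=> uniC evC uC u'C /andP[nuu' /set0Pn[b /setIP[bu bu']]].
have [gF [a' [b' [q [nab' uE' pq lq sq]]]]] := unicyclic_grows uniC uC.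
have [y yF] := grows_alternate gF.
have yb := alternate_path yF pq; rewrite lq in yb.
have {}yb : y b' = ~~ y a'.
  by rewrite yb (_ : odd (size q) = true) ?addbT //; move: evC; rewrite -sq /= negbK.
have [a [uE yab nab]] : exists a, [/\ val u = [set a; b], y b = ~~ y a & a != b].
  have := bu; rewrite uE' => /set2P[]->; first by exists b'; rewrite setUC yb negbK eq_sym.
  by exists a'.
have notri := even_unicyclic_no_triangle uniC evC.
apply: (@pd_coords _ _ _ (dagger_vec u b) 1) => // [e f|].
  by rewrite mul1r (line_dagger_gram nuu' uE bu' notri).
apply: (extra_row_free (z := fun k => sgn (y k)) _ gF).
- move=> e k; rewrite /dagger_vec mulf_eq0 negb_or sgn_neq0 /= /ind.
  by case: (k \in _).
- move=> e eu; have [c [d [ncd _ eE]]] := line_vertexP e.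
  rewrite (eq_bigr (fun k => ind (val e) k * sgn (y k))); last first.
    by move=> k _; rewrite /dagger_vec (negbTE eu) mul1r.
  rewrite eE (sum_ind _ ncd) (yF e c d) ?inE //.
  by rewrite sgn_opp addrN.
- rewrite (eq_bigr (fun k => ind (val u) k * (sgn (k == b) * sgn (y k)))); last first.
    by move=> k _; rewrite /dagger_vec eqxx /=; ring.
  rewrite uE (sum_ind _ nab) eqxx (negbTE nab) yab sgn_opp.
  by case: (y a).
Qed.

Lemma twin_pd (V : finType) (H : graph V) v w :
  is_tree H -> H v w -> pd (gram (line_twin H v w)).
Proof.
move=> /tree_grows gT Hvw; have nvw := adj_neq Hvw.
pose inc (e : option (line_vertex H)) := if e is Some e then val e else [set v; w].
have gF : grows inc setT (~: [set None]).
  have -> : ~: [set None] = Some @: [set: line_vertex H].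
    apply/setP => -[e|]; rewrite !inE; first by rewrite imset_f ?inE.
    by symmetry; apply/imsetP => -[].
  exact: grows_imset gT.
have [y yF] := grows_alternate gF.
have yvw : y w = ~~ y v.
  have [e eE] := line_vertex_of Hvw.
  by apply: (yF (Some e)); rewrite ?inE.
apply: (@pd_coords _ _ _ (@twin_vec _ H v w) 1) => // [e f|].
  by rewrite mul1r line_twin_gram.
apply: (extra_row_free (z := fun k => sgn (y k)) _ gF).
- move=> [e|] k; rewrite /= /ind ?inE; first by case: (k \in _).
  have [->|] := eqVneq k v; first by rewrite (negbTE nvw).
  by case: (k == w).
- move=> [e|] // _; have [c [d [ncd _ eE]]] := line_vertexP e.
  rewrite /= eE (sum_ind _ ncd) (yF (Some e) c d) ?inE //.
  by rewrite sgn_opp addrN.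
- by rewrite /= sum_twin yvw; case: (y v).
Qed.

Theorem families_pd (W : finType) (S : sgraph W) : in_families S -> pd (gram S).
Proof.
have iso (X : finType) (G : sgraph X) : sw_equiv S G -> pd (gram G) -> pd (gram S).
  by move=> /sw_equivP/signed_iso_sym; apply: pd_signed_iso.
case=> [[V [H [HT]]]|[V [H [C [u [u' [uniC evC [uC u'C uu'] ]]]]]]|[V [H [v [w [HT vw]]]]]|].
- move=> eqS; apply: iso eqS _; case: HT => [|[C uniC oddC]]; first exact: tree_pd.
  exact: odd_unicyclic_pd uniC oddC.
- move=> eqS; apply: iso eqS _; exact: even_unicyclic_pd uniC evC uC u'C uu'.
- move=> eqS; apply: iso eqS _; exact: twin_pd.
- by case=> V [G [[_ /eig_gt_gram pdG] eqS]]; apply: iso eqS pdG.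
Qed.

(** * Integral representations give the families *)

Lemma signed_iso_coords (K V W : finType) (M : V -> V -> int) (P : W -> W -> int)
    (N : V -> K -> int) (N' : W -> K -> int) (f : V -> W)
    (eps : K -> bool) (del : V -> bool) :
  bijective f -> (forall x y, M x y = \sum_k N x k * N y k) ->
  (forall x y, P x y = \sum_k N' x k * N' y k) ->
  (forall x k, N' (f x) k = sgn (del x) * sgn (eps k) * N x k) -> signed_iso M P.
Proof.
move=> bf MN PN' N'N; exists f, del; split=> // x y.
rewrite MN PN' mulr_sumr; apply: eq_bigr => k _.
rewrite !N'N; transitivity (sgn (del x) * sgn (del y) *
  (sgn (eps k) * sgn (eps k)) * (N x k * N y k)); first by ring.
by rewrite sgnM mulr1.
Qed.

Lemma has_rep_coords (V : finType) (M : V -> V -> int) : has_rep M ->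
  exists n (N : V -> 'I_n -> int), (forall x y, M x y = \sum_k N x k * N y k) /\
    forall k, exists x, N x k != 0.
Proof.
case=> m [phi phiE]; pose A := [set k | [exists x, phi x 0 k != 0]].
exists #|A|, (fun x k => phi x 0 (enum_val k)); split; last first.
  by move=> k; have := enum_valP k; rewrite inE => /existsP[x xk]; exists x.
move=> x y; rewrite -phiE /dot -(big_enum_val (fun k => phi x 0 k * phi y 0 k)).
rewrite [LHS](bigID (mem A)) /= [X in _ + X]big1 ?addr0 // => k.
rewrite inE negb_exists => /forallP/(_ x); rewrite negbK => /eqP->.
by rewrite mul0r.
Qed.

Section Coordinates.
Variables (K W : finType) (M : W -> W -> int) (N : W -> K -> int).
Hypotheses (rM : root_gram M) (cM : gconn M) (W0 : (0 < #|W|)%N).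
Hypothesis MN : forall x y, M x y = \sum_k N x k * N y k.
Hypothesis N_used : forall k, exists x, N x k != 0.

Definition coord_inc (x : W) : {set K} := [set k | N x k != 0].
Let inc := coord_inc.

Lemma coord_incE x k : (N x k != 0) = (k \in inc x).
Proof. by rewrite inE. Qed.

Lemma coord_pair x : exists a b, [/\ a != b, inc x = [set a; b],
  N x a = 1 \/ N x a = -1 & N x b = 1 \/ N x b = -1].
Proof.
have [_ diagM _] := rM; have := diagM x; rewrite MN => /norm2P[a [b [nab a1 b1 N0]]].
exists a, b; split=> //; apply/setP => k; rewrite inE !inE.
have [->|ka] /= := eqVneq k a; first by case: a1 => ->.
have [->|kb] /= := eqVneq k b; first by case: b1 => ->.
by rewrite N0 ?eqxx.
Qed.

Lemma coord_unit x k : k \in inc x -> N x k = 1 \/ N x k = -1.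
Proof. by have [a [b [_ -> a1 b1]]] := coord_pair x; case/set2P => ->. Qed.

(** Vectors with nonzero inner product share a coordinate. *)
Lemma coord_connect : exists k0, forall k, connect (link inc setT) k0 k.
Proof.
have /card_gt0P[x0 _] := W0; have [k0 [b [_ x0E _ _]]] := coord_pair x0.
have csym := sym_connect_sym (@link_sym_rel _ _ inc setT).
have step x k l : k \in inc x -> l \in inc x -> connect (link inc setT) k l.
  have [a [c [_ xE _ _]]] := coord_pair x.
  have ac : connect (link inc setT) a c by apply/connect1/linkP; exists x.
  by rewrite xE => /set2P[]-> /set2P[]->; rewrite ?connect0 // csym.
pose S := [pred x | [forall k, (k \in inc x) ==> connect (link inc setT) k0 k]].
have SP x : reflect (forall k, k \in inc x -> connect (link inc setT) k0 k) (x \in S).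
  by apply: (iffP forallP) => H k; apply/implyP/H.
have x0S : x0 \in S by apply/SP => k kx; apply: (step x0) => //; rewrite x0E set21.
exists k0 => k; have [x kx] := N_used k; rewrite coord_incE in kx.
apply: (SP x _ k kx); apply/idPn => xS.
have [y [z [/SP yS /negP zS Myz]]] := connect_crossing (cM x0 x) x0S xS.
apply: zS; apply/SP => l lz.
have [j /andP[jy jz]] : exists j, (j \in inc y) && (j \in inc z).
  apply/existsP; apply: contraNT Myz => /existsPn nj; rewrite MN big1 // => j _.
  have := nj j; rewrite -!coord_incE -negb_or negbK => /orP[]/eqP->.
    by rewrite mul0r.
  by rewrite mulr0.
exact: connect_trans (yS j jy) (step z j l jz lz).
Qed.

Let A : 'M[algC]_(#|W|, #|K|) := \matrix_(i, j) (N (enum_val i) (enum_val j))%:~R.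

(** The coordinate vectors are linearly independent. *)
Lemma coord_rank : \rank A = #|W|.
Proof.
have [_ _ pdM] := rM; apply/eqP; rewrite -/(row_free A) -kermx_eq0.
apply/rowV0P => v /sub_kermxP vA; apply/rowP => i; rewrite mxE.
pose c x := v 0 (enum_rank x); have [//|vi] := eqVneq (v 0 i) 0.
have : 0 < qform M c by apply: pdM; exists (enum_val i); rewrite /c enum_valK.
have MN1 x y : 1 * M x y = \sum_k N x k * N y k by rewrite mul1r MN.
have := qform_coords c MN1; rewrite mul1r big1 => [q0|k _].
  by rewrite q0 ltxx.
rewrite (_ : \sum_x _ = (v *m A) 0 (enum_rank k)); first by rewrite vA mxE mul0r.
rewrite mxE (reindex _ (onW_bij _ (@enum_val_bij W))) /=.
by apply: eq_bigr => j _; rewrite mxE /c enum_valK enum_rankK.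
Qed.

Lemma coord_card : (#|W| <= #|K|)%N.
Proof. by rewrite -coord_rank rank_leq_col. Qed.

(** A nonzero vector orthogonal to all of them shows that they do not span. *)
Lemma coord_orthogonal (z : K -> int) k :
  (forall x, \sum_k N x k * z k = 0) -> z k != 0 -> (#|W| < #|K|)%N.
Proof.
move=> zN zk; rewrite -coord_rank -mxrank_tr ltn_neqAle rank_leq_row andbT.
apply/negP; rewrite -/(row_free A^T) => freeA.
pose v : 'rV[algC]_#|K| := \row_j (z (enum_val j))%:~R.
have vA : v *m A^T = 0.
  apply/rowP => i; rewrite mxE mxE -[RHS](rmorph0 (intr : int -> algC)) -(zN (enum_val i)).
  rewrite rmorph_sum [RHS](reindex _ (onW_bij _ (@enum_val_bij K))) /=.
  by apply: eq_bigr => j _; rewrite !mxE rmorphM mulrC.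
have : v == 0 by rewrite -(mulmx_free_eq0 v freeA) vA.
by move/eqP/rowP/(_ (enum_rank k))/eqP; rewrite !mxE enum_rankK intr_eq0 (negbTE zk).
Qed.

(** A spanning tree has one edge less than there are coordinates, and by
    independence there are at least as many coordinates as vectors. *)
Lemma coord_spanning : exists2 F : {set W}, grows inc setT F & (#|~: F| <= 1)%N.
Proof.
have [k0 conn] := coord_connect; have [F _ gF] := grows_spanning conn.
exists F => //; have := grows_card gF; rewrite cardsT => KF.
by have := coord_card; rewrite KF -(cardsC F) -addn1 leq_add2l.
Qed.

End Coordinates.

(** The coordinate vectors are the signed edges of a multigraph on the coordinates
    with a spanning tree F and at most one further edge p. Signs of coordinates
    and of vectors can be chosen so that all vectors in F become e_a + e_b; then
    independence decides the signs of p. *)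
Theorem rep_families (W : finType) (S : sgraph W) : (0 < #|W|)%N ->
  root_gram (gram S) -> gconn (gram S) -> has_rep (gram S) ->
  [\/ is_line_graph S, is_line_dagger S | is_line_twin S].
Proof.
move=> W0 rM cM /has_rep_coords[n [N [MN Nused]]].
have [F gF F1] := coord_spanning rM cM W0 MN Nused.
pose inc := coord_inc N.
have unit := coord_unit rM MN; have pair := coord_pair rM MN.
rewrite -/inc in unit pair gF.
have inc_pair x : exists a b, a != b /\ inc x = [set a; b].
  by have [a [b [nab xE _ _]]] := pair x; exists a, b.
have [eps [del epsF]] := grows_signs gF unit.
pose N1 x k := sgn (del x) * sgn (eps k) * N x k.
have N1out x k : k \notin inc x -> N1 x k = 0.
  by rewrite inE negbK => /eqP xk; rewrite /N1 xk mulr0.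
have N1F x k : x \in F -> N1 x k = ind (inc x) k.
  move=> xF; rewrite /ind; have [kx|kx] := boolP (k \in inc x); first exact: epsF.
  exact: N1out.
have [FT|[p pF]] : F = setT \/ exists p, p \notin F.
  have [/eqP|] := boolP (F == setT); first by left.
  by rewrite -subTset => /subsetPn[p _ pF]; right; exists p.
  (* Without a further edge the vectors are the edges of a tree. *)
  have inj : injective inc by move=> x y; apply: (grows_inj gF); rewrite FT.
  have [f [bf fE]] := line_vertex_bij inc_pair inj.
  apply: Or31; exists 'I_n, (edge_graph (inc @: setT)); split.
    left; rewrite -FT; apply: (grows_tree gF).
    by have /card_gt0P[x _] := W0; apply/set0Pn; exists x; rewrite FT.
  apply/sw_equivP.
  apply: (signed_iso_coords (N' := fun e k => ind (val e) k) (eps := eps) (del := del) bf MN).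
    exact: line_graph_gram.
  by move=> x k; rewrite fE -N1F ?FT.
have FE : F = ~: [set p].
  rewrite -[F]setCK; congr (~: _); apply/eqP; rewrite eq_sym eqEcard cards1 F1 andbT.
  by rewrite sub1set inE.
have [a [b [nab pE Npa Npb]]] := pair p.
have N1p k : k \in [set a; b] -> N1 p k = 1 \/ N1 p k = -1.
  rewrite -pE => /unit; rewrite /N1.
  by case: (del p); case: (eps k); case=> ->; ((left; done) || (right; done)).
(* Replacing the vector p by its opposite makes a given coordinate positive. *)
have flip (f : bool) x k : sgn (if x == p then del x (+) f else del x) * sgn (eps k) * N x k
    = (if x == p then sgn f * N1 x k else N1 x k).
  by case: (x == p) => //; rewrite /N1 /sgn signr_addb; ring.
have N1a := N1p a (set21 a b); have N1b := N1p b (set22 a b).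
pose t := N1 p a == -1.
have ta : sgn t * N1 p a = 1 by rewrite /t; case: N1a => ->.
(* If p is parallel to a tree edge x0, the bound on their inner product makes
   its signs opposite, so p is the twin of x0. *)
have [/imsetP[x0 x0F pE0]|npF] := boolP (inc p \in inc @: F).
  have Nab : N1 p b = - N1 p a.
    have npx0 : p != x0 by apply: contraNneq pF => ->.
    have : gram S p x0 = sgn (del p) * sgn (del x0) * (N1 p a + N1 p b).
      rewrite -(sum_ind (N1 p) nab) -pE mulr_sumr MN; apply: eq_bigr => k _.
      rewrite pE0 -N1F // /N1; transitivity ((sgn (del p) * sgn (del p)) *
        (sgn (del x0) * sgn (del x0)) * (sgn (eps k) * sgn (eps k)) * (N p k * N x0 k)).
        by rewrite !sgnM !mul1r.
      by ring.
    move=> E; have := root_gram_bound rM npx0; rewrite E.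
    by case: N1a => ->; case: N1b => ->; case: (del p); case: (del x0).
  have injF : {in ~: [set p] &, injective inc} by rewrite -FE; apply: grows_inj gF.
  have [f [bf fp fE]] := twin_vertex_bij inc_pair injF.
  apply: Or33; exists 'I_n, (edge_graph (inc @: ~: [set p])), a, b; split.
  - rewrite -FE; apply: (grows_tree gF); by apply/set0Pn; exists x0.
  - by rewrite /= nab -pE pE0 imset_f // -FE.
  apply/sw_equivP.
  apply: (signed_iso_coords (N' := @twin_vec _ _ a b) (eps := eps)
           (del := fun x => if x == p then del x (+) t else del x) bf MN).
    by move=> x y; apply: line_twin_gram.
  move=> x k; rewrite flip; have [->|xp] := eqVneq x p; last first.
    have [e -> eE] := fE x xp; rewrite /= eE N1F // FE !inE //.
  rewrite fp /=; have [->|ka] := eqVneq k a; first by rewrite ta (negbTE nab).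
  have [->|kb] := eqVneq k b; first by rewrite Nab mulrN ta.
  by rewrite N1out ?mulr0 // pE !inE negb_or ka.
have pFT : p |: F = setT.
  by apply/setP => x; rewrite FE !inE orbN.
have inj : injective inc.
  move=> x y E; have [xp|xp] := eqVneq x p; have [yp|yp] := eqVneq y p.
  - by rewrite xp yp.
  - by case/negP: npF; rewrite -xp E imset_f // FE !inE.
  - by case/negP: npF; rewrite -yp -E imset_f // FE !inE.
  - by apply: (grows_inj gF); rewrite ?FE ?inE.
have [q [uq pq lq sq [pC uniC]]] := grows_unicyclic gF nab pE npF.
rewrite pFT in uniC.
have cardC : #|cycle_edges (a :: q)| = (size q).+1 by rewrite card_cycle_edges.
have [y yF] := grows_alternate gF.
have yb := alternate_path yF pq; rewrite lq in yb.
(* The alternating vector y is orthogonal to the tree, hence not to p. As the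
   length of the cycle decides whether a and b have the same colour, it decides
   whether the signs of p are equal. *)
have Nz : N1 p a * sgn (y a) + N1 p b * sgn (y b) != 0.
  apply/negP => /eqP Nz0.
  have WK : #|W| = #|'I_n|.
    have := grows_card gF; rewrite cardsT => ->.
    by rewrite -cardsT -pFT cardsU1 pF.
  pose z k := sgn (eps k) * sgn (y k).
  suff /(coord_orthogonal rM MN)/(_ (mulf_neq0 (sgn_neq0 (eps a)) (sgn_neq0 (y a)))) :
      forall x, \sum_k N x k * z k = 0 by rewrite WK ltnn.
  move=> x; transitivity (sgn (del x) * \sum_k N1 x k * sgn (y k)).
    rewrite mulr_sumr; apply: eq_bigr => k _; rewrite /N1 /z.
    transitivity ((sgn (del x) * sgn (del x)) * (N x k * (sgn (eps k) * sgn (y k)))).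
      by rewrite sgnM mul1r.
    by ring.
  have [->|xp] := eqVneq x p.
    rewrite (sum_pair nab) ?Nz0 ?mulr0 // => k kab.
    by rewrite N1out ?mul0r // pE.
  have xF : x \in F by rewrite FE !inE.
  have [c [d [ncd xE]]] := inc_pair x.
  rewrite (eq_bigr (fun k => ind (inc x) k * sgn (y k))) => [|k _]; last by rewrite N1F.
  by rewrite xE (sum_ind _ ncd) (yF x c d) // sgn_opp addrN mulr0.
have [f [bf fE]] := line_vertex_bij inc_pair inj.
have NF x k : x != p -> N1 x k = ind (inc x) k by move=> xp; rewrite N1F // FE !inE.
have [oddC|evC] := boolP (odd #|cycle_edges (a :: q)|).
  have Nab : N1 p b = N1 p a.
    move: Nz; rewrite yb; move: oddC; rewrite cardC /= => /negbTE->; rewrite addbF.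
    by case: N1a => ->; case: N1b => ->; case: (y a).
  apply: Or31; exists 'I_n, (edge_graph (inc @: setT)); split.
    by right; exists (cycle_edges (a :: q)).
  apply/sw_equivP.
  apply: (signed_iso_coords (N' := fun e k => ind (val e) k) (eps := eps)
           (del := fun x => if x == p then del x (+) t else del x) bf MN).
    exact: line_graph_gram.
  move=> x k; rewrite flip fE; have [->|xp] := eqVneq x p; last by rewrite NF.
  rewrite /ind; have [|kp] := boolP (k \in inc p); last by rewrite N1out ?mulr0.
  by rewrite pE => /set2P[]->; rewrite ?Nab ta.
have Nab : N1 p b = - N1 p a.
  move: Nz; rewrite yb; move: evC; rewrite cardC /= negbK => ->; rewrite addbT.
  by case: N1a => ->; case: N1b => ->; case: (y a).
(* The two edges of the cycle at one end b' of p serve as u and u'. *)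
have /imsetP[a' a'q pE'] := pC; set b' := next (a :: q) a' in pE'.
have /andP[nba' _] := next_next_neq uq sq a'q; rewrite -/b' in nba'.
have b'q : b' \in a :: q by rewrite mem_next.
have u'C : [set b'; next (a :: q) b'] \in cycle_edges (a :: q).
  by apply/imsetP; exists b'.
have [u' u'E] : exists u' : line_vertex (edge_graph (inc @: setT)),
    val u' = [set b'; next (a :: q) b'].
  have [_ uniqC] := uniC; have /is_cycleP[c [c2 uc cc CE]] := (uniqC _).2 erefl.
  have u'H := subsetP (cycle_edges_sub cc) _; rewrite -CE in u'H.
  by exists (exist (fun e => e \in edges _) _ (u'H _ u'C)).
pose u := f p.
have uE : val u = [set a'; b'] by rewrite fE.
have nuu' : u != u'.
  apply: contraNneq nba' => uu'; apply/eqP/(cycle_edge_inj uq sq) => //.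
  by rewrite -/b' -uE uu' u'E.
have bu' : b' \in val u' by rewrite u'E set21.
have [Nb' Na'] : N1 p b' = - N1 p a' /\ (N1 p a' = 1 \/ N1 p a' = -1).
  by have := pE'; rewrite pE => /eq_set2[[<- <-]|[<- <-]]; split; rewrite // Nab opprK.
pose t' := N1 p a' == -1.
have ta' : sgn t' * N1 p a' = 1 by rewrite /t'; case: Na' => ->.
apply: Or32; exists 'I_n, (edge_graph (inc @: setT)), (cycle_edges (a :: q)), u, u'.
split=> //.
  split; [by rewrite fE|by rewrite u'E|].
  by rewrite /= /line_rel nuu' uE; apply/set0Pn; exists b'; rewrite inE set22 bu'.
apply/sw_equivP.
apply: (signed_iso_coords (N' := dagger_vec u b') (eps := eps)
         (del := fun x => if x == p then del x (+) t' else del x) bf MN).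
  by apply: (line_dagger_gram nuu' uE bu'); apply: even_unicyclic_no_triangle uniC evC.
move=> x k; rewrite flip /dagger_vec fE (bij_eq bf).
have [->|xp] /= := eqVneq x p; last by rewrite NF // mul1r.
rewrite /ind pE'; have [->|ka] := eqVneq k a'.
  by rewrite ta' set21 eq_sym (negbTE nba').
have [->|kb] := eqVneq k b'; first by rewrite Nb' mulrN ta' set22.
have kab : k \notin [set a'; b'] by rewrite !inE negb_or ka.
by rewrite N1out ?pE' // (negbTE kab) !mulr0.
Qed.

(** * Components and the matrix of a Hoffman graph *)

Theorem connected_families (W : finType) (S : sgraph W) :
  sconnected S -> pd (gram S) <-> in_families S.
Proof.
move=> [W0 cS]; split; last exact: families_pd.
move=> pdS; have rS : root_gram (gram S).
  by split=> // x *; [apply: gram_sym|apply: gram_diag].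
have gS : gconn (gram S) by apply/gconn_gram.
have [repS|nrepS] := has_rep_dec W0 rS gS.
  case: (rep_families W0 rS gS repS); [exact: Or41|exact: Or42|exact: Or43].
apply: Or44; exists W, S; split; first exact/exceptional_gtP.
by apply/sw_equivP; apply: signed_iso_refl.
Qed.

Section Components.
Variables (V : finType) (G : sgraph V).

Let e := underlying G.
Let e_sym : connect_sym e := sym_connect_sym (adj_sym e).

Lemma scomponent_gram t x y :
  gram (scomponent G t) x y = gram G (val x) (val y).
Proof. by rewrite /gram (inj_eq val_inj). Qed.

Lemma scomponent_connected t : sconnected (scomponent G t).
Proof.
split.
  by apply/card_gt0P; exists (Sub t (connect0 e t)).
have from_t x : connect (underlying (scomponent G t)) (Sub t (connect0 e t)) x.
  case: x => x tx; have /connectP[p] := tx.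
  elim/last_ind: p x tx => [|p z IHp] x tx /=.
    move=> _ xt; rewrite (_ : Sub t _ = Sub x tx) ?connect0 //.
    by apply: val_inj; rewrite /= xt.
  rewrite rcons_path last_rcons => /andP[tp pz] xz; subst z.
  have tl : connect e t (last t p) by apply/connectP; exists p.
  apply: connect_trans (IHp _ tl tp erefl) (connect1 _).
  exact: pz.
have csym := sym_connect_sym (adj_sym (underlying (scomponent G t))).
by move=> x y; apply: connect_trans (from_t y); rewrite csym.
Qed.

(** The form is the orthogonal sum of its restrictions to the components. *)
Lemma pd_components : pd (gram G) <-> forall t, pd (gram (scomponent G t)).
Proof.
split=> [pdG t c c0|pdt c [x0 cx0]].
  have -> : qform (gram (scomponent G t)) c
      = qform (fun x y : {x | connect e t x} => gram G (val x) (val y)) c.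
    by apply: eq_bigr => x _; apply: eq_bigr => y _; rewrite scomponent_gram.
  exact: (pd_comp val_inj pdG c0).
pose r := fingraph.root e; pose ct t x := if r x == t then c x else 0.
have split_form : qform (gram G) c = \sum_t qform (gram G) (ct t).
  rewrite /qform [RHS]exchange_big; apply: eq_bigr => x _ /=.
  rewrite [RHS]exchange_big; apply: eq_bigr => y _ /=.
  rewrite (bigD1 (r x)) //= big1 ?addr0 => [|t tr]; last first.
    by rewrite /ct eq_sym (negbTE tr) mul0r mulr0.
  rewrite /ct eqxx; have [_|nxy] := eqVneq (r y) (r x); first by [].
  suff -> : gram G x y = 0 by rewrite !mul0r.
  apply/eqP; rewrite -[_ == 0]negbK gram_neq0 negb_or; apply/andP; split.
    by apply: contraNneq nxy => ->.
  by apply: contra nxy => xy; rewrite eq_sym root_connect // connect1.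
have pos t : (exists x, ct t x != 0) -> 0 < qform (gram G) (ct t).
  case=> x; rewrite {1}/ct; have [rx cx|_] := eqVneq (r x) t; last by rewrite eqxx.
  have tE z : connect e t z = (r z == t).
    by rewrite -rx /r -(root_connect e_sym) root_root // eq_sym.
  have tx : connect e t x by rewrite tE rx.
  have := pdt t (fun z => c (val z)) (ex_intro _ (Sub x tx) cx).
  suff -> : qform (gram (scomponent G t)) (fun z => c (val z)) = qform (gram G) (ct t) by [].
  transitivity (qform (fun x y : {x | connect e t x} => gram G (val x) (val y))
                  (fun z => c (val z))).
    by apply: eq_bigr => z _; apply: eq_bigr => w _; rewrite scomponent_gram.
  rewrite qform_push.
  have dE z : \sum_(w : {x | connect e t x} | val w == z) c (val w) = ct t z.
    rewrite /ct -tE; have [tz|ntz] := boolP (connect e t z).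
      by rewrite (sum_fiber (fun w => c (val w)) (Sub z tz) val_inj).
    by rewrite big1 // => w /eqP wz; case/negP: ntz; rewrite -wz (valP w).
  by apply: eq_bigr => z _; apply: eq_bigr => w _; rewrite !dE.
have nonneg t : 0 <= qform (gram G) (ct t).
  have [/existsP/pos/ltW//|/existsPn ct0] := boolP [exists x, ct t x != 0].
  rewrite /qform big1 // => x _; rewrite big1 // => y _.
  by have := ct0 x; rewrite negbK => /eqP->; rewrite mul0r mulr0.
rewrite split_form (bigD1 (r x0)) //= ltr_pwDl ?sumr_ge0 //.
by apply: pos; exists x0; rewrite /ct eqxx.
Qed.

End Components.

Section HoffmanMatrix.
Variables (V : finType) (H : hoffman V).
Hypothesis H_one : forall x, x \in slim H -> #|fat_nbrs H x| = 1%N.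

Let common (i j : 'I_#|slim H|) : int :=
  \sum_(y in fat H) (H (enum_val i) y)%:R * (H (enum_val j) y)%:R.

Lemma hoffman_mxE i j :
  hoffman_mx H i j = (H (enum_val i) (enum_val j))%:R - common i j.
Proof.
rewrite !mxE; congr (_ - _); rewrite /common [RHS]big_enum_val.
by apply: eq_bigr => k _; rewrite !mxE.
Qed.

Lemma sum_fat (i : 'I_#|slim H|) : \sum_(y in fat H) (H (enum_val i) y)%:R = 1%R :> int.
Proof.
transitivity (#|fat_nbrs H (enum_val i)|%:R : int); last by rewrite H_one ?enum_valP.
rewrite -sum1_card natr_sum big_mkcond [RHS]big_mkcond /=; apply: eq_bigr => y _.
by rewrite inE; case: (y \in fat H); case: (H _ y).
Qed.

Lemma common_diag i : common i i = 1.
Proof.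
rewrite -(sum_fat i); apply: eq_bigr => y _.
by case: (H _ y).
Qed.

Lemma common_bound i j : 0 <= common i j <= 1.
Proof.
apply/andP; split; first by apply: sumr_ge0 => y _; case: (H _ y); case: (H _ y).
rewrite -(sum_fat i); apply: ler_sum => y _.
by case: (H _ y); case: (H _ y).
Qed.

(** Every slim vertex has one fat neighbour, and two slim vertices have at most
    one in common, so B = A - I for the adjacency matrix A of the special graph. *)
Lemma hoffman_gram i j : gram (special H) i j = hoffman_mx H i j - (- 3) *+ (i == j).
Proof.
rewrite /gram hoffman_mxE; have [->|nij] := eqVneq i j.
  by rewrite adj_irr common_diag.
rewrite mulr0n subr0 /sadj /= nij hoffman_mxE /=.
have := common_bound i j; case: (H _ _) => /= /andP[]; do 2?case: eqP => //=; lia.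
Qed.

Lemma hoffman_eig_gt : smallest_eig_gt (hoffman_mx H) (- 3) <-> pd (gram (special H)).
Proof. by apply: smallest_eig_gtP; [apply: hoffman_mx_sym|apply: hoffman_gram]. Qed.

End HoffmanMatrix.

Theorem theorem19 (V : finType) (H : hoffman V)
    (H_fat : fat_hoffman H)
    (H_one : forall x, x \in slim H -> #|fat_nbrs H x| = 1%N) :
  [/\ (* connected special graph *)
      sconnected (special H) ->
      (smallest_eig_gt (hoffman_mx H) (- 3) <-> in_families (special H)),
      (* arbitrary special graph, component by component *)
      smallest_eig_gt (hoffman_mx H) (- 3) <->
      (forall i, in_families (scomponent (special H) i)),
      (* the number of graphs in the exceptional family *)
      (forall (W : finType) (G : sgraph W),
         exceptional_gt G -> [\/ #|W| = 6%N, #|W| = 7%N | #|W| = 8%N])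
    & [/\ exceptional_gt_count 6 32,
          exceptional_gt_count 7 233
        & exceptional_gt_count 8 1242]].
Proof.
split.
- by move=> cS; rewrite hoffman_eig_gt //; apply: connected_families.
- rewrite hoffman_eig_gt // pd_components; split=> famH i.
    by apply/connected_families; [apply: scomponent_connected|apply: famH].
  by apply/connected_families; [apply: scomponent_connected|apply: famH].
- exact: exceptional_gt_card.
- exact: exceptional_gt_counts.
Qed.
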